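(* Let $a,b,c,c'\in\mathbb{C}$ with $\Re(c)>\Re(b)>0$, $a,c'\notin\mathbb{Z}_{\le0}$, let $\delta\in(0,\frac{\pi}{2})$ be fixed and let $\mathbb{S}=\{y\in\mathbb{C}:|\arg y|\le\frac{\pi}{2}-\delta\}$. Fix a real number $x$ with $0<x<1$. Then, as $y\to\infty$ with $y\in\mathbb{S}$, $$\Psi_1[a,b;c,c';x,y]\sim\frac{\Gamma(c)\Gamma(c')}{\Gamma(a)\Gamma(b)}\,x^{b-c}(1-x)^{c'+2(c-a-b)}y^{a+b-c-c'}\mathrm{e}^{\frac{y}{1-x}}.$$
   Context: All arguments and complex powers take principal values; $f\sim g$ means $f/g\to1$. The Humbert function $\Psi_1$ is defined for $c,c'\notin\mathbb{Z}_{\le 0}$ by $$\Psi_1[a,b;c,c';x,y]=\sum_{m,n=0}^{\infty}\frac{(a)_{m+n}(b)_m}{(c)_m(c')_n}\frac{x^m}{m!}\frac{y^n}{n!}\quad(|x|<1,\ |y|<\infty),$$ where $(\cdot)_n$ is the Pochhammer symbol. *)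

(* Defs.v *)
(* Stdlib reals + Coquelicot. *)
From Stdlib Require Import Reals Factorial Lra.
From Coquelicot Require Import Coquelicot.

Local Open Scope C_scope.

Definition Cexp (z : C) : C :=
  (exp (Re z) * cos (Im z), exp (Re z) * sin (Im z))%R.

(* Principal argument, with values in ]-PI, PI] for z <> 0
   (see [Carg_bounds] and [Carg_polar]). The value at 0 is irrelevant. *)
Definition Carg (z : C) : R :=
  if Rlt_dec (Im z) 0 then (- acos (Re z / Cmod z))%R
  else acos (Re z / Cmod z).

Definition Clog (z : C) : C := (ln (Cmod z), Carg z).

(* Principal value of z ^ w, for z <> 0. *)
Definition Cpower (z w : C) : C := Cexp (w * Clog z).

(* Limits and sums of complex sequences, taken componentwise; meaningful
   when the sequence (resp. the series) converges. *)
Definition CLim_seq (u : nat -> C) : C :=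
  (real (Lim_seq (fun n => Re (u n))), real (Lim_seq (fun n => Im (u n)))).

Definition CSeries (u : nat -> C) : C :=
  (Series (fun n => Re (u n)), Series (fun n => Im (u n))).

Fixpoint pochhammer (a : C) (n : nat) : C :=
  match n with
  | O => 1
  | S k => pochhammer a k * (a + INR k)
  end.

Definition nonpos_integer (z : C) : Prop := exists k : nat, z = - RtoC (INR k).

(* Euler's definition: Gamma(z) = lim n! n^z / (z (z + 1) ... (z + n)),
   for z not a nonpositive integer. *)
Definition CGamma (z : C) : C :=
  CLim_seq (fun n => INR (fact n) * Cpower (INR n) z / pochhammer z (S n)).

(* The double series converges absolutely for |x| < 1 and c, c' not
   nonpositive integers, so that its sum is the iterated sum. *)
Definition Psi1 (a b c c' x y : C) : C :=
  CSeries (fun m => CSeries (fun n =>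
    pochhammer a (m + n) * pochhammer b m
      / (pochhammer c m * pochhammer c' n)
    * (x ^ m / INR (fact m)) * (y ^ n / INR (fact n)))).

(* Neighbourhoods of the point at infinity of the complex plane. *)
Definition C_infty (P : C -> Prop) : Prop :=
  exists M : R, forall z : C, (M < Cmod z)%R -> P z.

Global Instance C_infty_filter : Filter C_infty.
Proof.
constructor.
- now exists 0%R.
- intros P Q [M HM] [N HN]; exists (Rmax M N); intros z Hz; split.
  + apply HM; eapply Rle_lt_trans; [apply Rmax_l | exact Hz].
  + apply HN; eapply Rle_lt_trans; [apply Rmax_r | exact Hz].
- intros P Q HPQ [M HM]; exists M; auto.
Qed.

Definition asymp_equiv (F : (C -> Prop) -> Prop) (f g : C -> C) : Prop :=
  filterlim (fun y => f y / g y) F (locally (RtoC 1)).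

Definition sector (delta : R) (y : C) : Prop :=
  (Rabs (Carg y) <= PI / 2 - delta)%R.

Lemma Re_div_Cmod_bound (z : C) : z <> 0 -> (-1 <= Re z / Cmod z <= 1)%R.
Proof.
intros Hz; pose proof (proj1 (Cmod_gt_0 z) Hz) as Hm.
pose proof (Rabs_le_between (Re z) (Cmod z)) as [H _].
specialize (H (re_le_Cmod z)).
split; apply (Rmult_le_reg_r (Cmod z)); try exact Hm;
  unfold Rdiv; rewrite Rmult_assoc, Rinv_l by lra; lra.
Qed.

Lemma Carg_bounds (z : C) : z <> 0 -> (- PI < Carg z <= PI)%R.
Proof.
intros Hz; unfold Carg.
pose proof (acos_bound (Re z / Cmod z)) as Hb; pose proof PI_RGT_0.
destruct (Rlt_dec (Im z) 0) as [Hi|Hi]; [split|]; try lra.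
destruct (Req_dec (acos (Re z / Cmod z)) PI) as [E|E]; [|lra].
exfalso.
assert (Hc : (Re z / Cmod z = -1)%R).
{ rewrite <- (cos_acos (Re z / Cmod z)) by now apply Re_div_Cmod_bound.
  now rewrite E, cos_PI. }
pose proof (proj1 (Cmod_gt_0 z) Hz) as Hm.
assert (Hr : (Re z = - Cmod z)%R).
{ apply (Rmult_eq_reg_r (/ Cmod z)); [|apply Rinv_neq_0_compat; lra].
  change (Re z * / Cmod z)%R with (Re z / Cmod z)%R.
  rewrite Hc; field; lra. }
pose proof (Cmod2_alt z) as H2; rewrite Hr in H2; nra.
Qed.

Lemma Carg_polar (z : C) : z <> 0 ->
  z = (Cmod z * cos (Carg z), Cmod z * sin (Carg z))%R.
Proof.
intros Hz; pose proof (proj1 (Cmod_gt_0 z) Hz) as Hm.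
pose proof (Re_div_Cmod_bound z Hz) as Hb.
assert (Hs : (Cmod z * sin (acos (Re z / Cmod z)) = Rabs (Im z))%R).
{ rewrite sin_acos by exact Hb.
  rewrite <- (sqrt_Rsqr (Cmod z)) at 1 by lra.
  rewrite <- sqrt_mult_alt by apply Rle_0_sqr.
  rewrite <- sqrt_Rsqr_abs; f_equal.
  unfold Rsqr; pose proof (Cmod2_alt z) as H2.
  replace (Cmod z * Cmod z * (1 - Re z / Cmod z * (Re z / Cmod z)))%R
    with (Cmod z ^ 2 - Re z ^ 2)%R by (field; lra).
  rewrite H2; ring. }
rewrite (surjective_pairing z) at 1; unfold Carg.
destruct (Rlt_dec (Im z) 0) as [Hi|Hi]; f_equal.
- rewrite cos_neg, cos_acos by exact Hb.
  change (fst z) with (Re z); field; lra.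
- rewrite sin_neg, Ropp_mult_distr_r_reverse, Hs, Rabs_left by exact Hi.
  change (snd z) with (Im z); ring.
- rewrite cos_acos by exact Hb.
  change (fst z) with (Re z); field; lra.
- rewrite Hs, Rabs_pos_eq by lra; reflexivity.
Qed.

(* Main.v *)
(* Write [z = y / (1 - x)] and [M] for the Kummer function. Replacing
   [(b)_m / (c)_m] by [t^m] in the double series gives
   [phi t = (1 - x t)^(-a) M(a, c', y / (1 - x t))], so [Psi1] is the average of
   [phi] over the beta distribution, whose moments are [(b)_m / (c)_m].

   In a cone [Re z >= kappa |z|], the pair
   [v = z^(c-a) e^(-z) M(a, c, z)], [q = z^(c-a) e^(-z) M(a - 1, c, z)] solves
   a first order linear system in which [q] is damped; an energy estimate on
   rays bounds it, and the variation of [v] between [|z|] and [z] is then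
   [O(1 / |z|)]. On the positive axis the limit of [v] is the limit of
   [n^(c-a) (a)_n / (c)_n], by a Poisson concentration argument.

   So [phi t] is close to [P e^z e^(-xi z (1 - t))] with [xi = x / (1 - x)],
   whose beta average is again a Kummer function, [M(b, c, xi z)]. The error
   is controlled by comparing the complex beta average with the one of real
   parameters [Re b], [Re c]; no integral is needed, since both are limits of
   beta-binomial averages by the Vandermonde identity. *)

Require Import Defs.
From Stdlib Require Import Reals Factorial Lra Lia.
From Coquelicot Require Import Coquelicot.

Local Open Scope C_scope.

(** The obstacle is that the error must be small relative to an average that itself decays like
    [|z|^(-Re (c - b))]. An error bound uniform in [t] is therefore not enough: it has to keep a
    factor [exp (- lam |z| (1 - t))]. The beta average of this factor, for real parameters, is again
    a Kummer value and is at most of the order of the main term, so a pointwise relative error [e2]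
    becomes a relative error [O (e2)] of the average. Uniformity in [t] comes from
    [y / (1 - x t) = s z] with [s = (1 - x) / (1 - x t)] between [1 - x] and 1: all arguments of [M]
    lie on the ray of [z], at distance at least [(1 - x) |z|] from 0, so one limit of [v] in the
    cone serves every [t]. For complex [b] and [c] the beta weights are not positive. Their moduli
    are bounded by a constant times the weights of real parameters, because [(b)_n / (Re b)_n]
    behaves like the unimodular [n^(b - Re b)] up to a constant. All Gamma factors come from Euler's
    limit, through [n^(c - a) (a)_n / (c)_n]. *)

(** * Modulus and components of a complex number *)

Lemma im_le_Cmod (z : C) : (Rabs (Im z) <= Cmod z)%R.
Proof.
  eapply Rle_trans; [apply Rmax_r | apply (Rmax_Cmod z)].
Qed.

Lemma C_eta (z : C) : z = (Re z, Im z).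
Proof. now destruct z. Qed.

Lemma C_ext (z w : C) : Re z = Re w -> Im z = Im w -> z = w.
Proof. destruct z, w; simpl; congruence. Qed.

Lemma Cmod_le_add (z : C) : (Cmod z <= Rabs (Re z) + Rabs (Im z))%R.
Proof.
  replace z with (RtoC (Re z) + Ci * RtoC (Im z)) at 1
    by (apply C_ext; simpl; ring).
  eapply Rle_trans; [apply Cmod_triangle|].
  rewrite Cmod_mult, !Cmod_R, Cmod_Ci; lra.
Qed.

Lemma Cmod_sub_triangle (z w : C) : (Cmod (z - w) <= Cmod z + Cmod w)%R.
Proof. rewrite <- (Cmod_opp w); apply Cmod_triangle. Qed.

Lemma Cmod_ge_sub (z w : C) : (Cmod z - Cmod w <= Cmod (z + w))%R.
Proof.
  pose proof (Cmod_sub_triangle (z + w) w) as H.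
  replace (z + w - w) with z in H by ring; lra.
Qed.

Lemma Cmod_RtoC_nonneg (r : R) : (0 <= r)%R -> Cmod r = r.
Proof. intros; rewrite Cmod_R; now apply Rabs_pos_eq. Qed.

Lemma Cmod_div_R (z : C) (r : R) : (0 < r)%R -> Cmod (z / r) = (Cmod z / r)%R.
Proof.
  intros; rewrite Cmod_div, Cmod_RtoC_nonneg; try lra.
  intros E; apply RtoC_inj in E; lra.
Qed.

Lemma Cmod_Re_sqr (z : C) : Re (Cconj z * z) = (Cmod z ^ 2)%R.
Proof. rewrite Cmod2_alt; destruct z; simpl; ring. Qed.

Lemma RtoC_neq_0 (r : R) : r <> 0%R -> RtoC r <> 0.
Proof. intros H E; apply H, RtoC_inj, E. Qed.

Lemma INR_fact_pos (n : nat) : (0 < INR (fact n))%R.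
Proof. apply lt_0_INR, lt_O_fact. Qed.

(** * Series of complex numbers *)

Lemma ex_series_mult_l (k : R) (u : nat -> R) :
  ex_series u -> ex_series (fun n => k * u n)%R.
Proof. apply (ex_series_scal (V := R_NormedModule)). Qed.

(** Absolute convergence. [CSeries] sums real and imaginary parts separately; this one condition
    gives the convergence of both. *)
Definition summable (u : nat -> C) : Prop := ex_series (fun n => Cmod (u n)).

Lemma ex_series_dominated (u v : nat -> R) :
  (forall n, Rabs (u n) <= v n)%R -> ex_series v -> ex_series u.
Proof. intros H; apply (ex_series_le (V := R_CompleteNormedModule) u v H). Qed.

Lemma summable_le (u : nat -> C) (v : nat -> R) :
  (forall n, Cmod (u n) <= v n)%R -> ex_series v -> summable u.
Proof.
  intros H; apply ex_series_dominated; intros n.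
  now rewrite Rabs_pos_eq by apply Cmod_ge_0.
Qed.

Lemma summable_Re (u : nat -> C) :
  summable u -> ex_series (fun n => Re (u n)).
Proof. apply ex_series_dominated; intros n; apply re_le_Cmod. Qed.

Lemma summable_Im (u : nat -> C) :
  summable u -> ex_series (fun n => Im (u n)).
Proof. apply ex_series_dominated; intros n; apply im_le_Cmod. Qed.

Lemma summable_ext (u v : nat -> C) :
  (forall n, u n = v n) -> summable u -> summable v.
Proof. intros H; apply ex_series_ext; intros n; now rewrite H. Qed.

Lemma summable_plus (u v : nat -> C) :
  summable u -> summable v -> summable (fun n => u n + v n).
Proof.
  intros Hu Hv; apply (summable_le _ (fun n => Cmod (u n) + Cmod (v n))%R).
  - intros n; apply Cmod_triangle.
  - now apply (ex_series_plus (V := R_NormedModule)).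
Qed.

Lemma summable_scal (k : C) (u : nat -> C) :
  summable u -> summable (fun n => k * u n).
Proof.
  intros Hu; apply (summable_le _ (fun n => Cmod k * Cmod (u n))%R).
  - intros n; rewrite Cmod_mult; lra.
  - now apply ex_series_mult_l.
Qed.

Lemma summable_minus (u v : nat -> C) :
  summable u -> summable v -> summable (fun n => u n - v n).
Proof.
  intros Hu Hv.
  apply summable_ext with (fun n => u n + (- (1)) * v n).
  - intros n; ring.
  - apply summable_plus, summable_scal; assumption.
Qed.

Lemma summable_shift (u : nat -> C) :
  summable u <-> summable (fun n => u (S n)).
Proof. apply (ex_series_incr_1 (V := R_NormedModule)). Qed.

Lemma CSeries_ext (u v : nat -> C) :
  (forall n, u n = v n) -> CSeries u = CSeries v.
Proof.
  intros H; unfold CSeries; f_equal; apply Series_ext; intros n; now rewrite H.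
Qed.

Lemma CSeries_plus (u v : nat -> C) : summable u -> summable v ->
  CSeries (fun n => u n + v n) = CSeries u + CSeries v.
Proof.
  intros Hu Hv; apply C_ext; simpl.
  - rewrite <- Series_plus by now apply summable_Re.
    apply Series_ext; reflexivity.
  - rewrite <- Series_plus by now apply summable_Im.
    apply Series_ext; reflexivity.
Qed.

Lemma CSeries_scal (k : C) (u : nat -> C) : summable u ->
  CSeries (fun n => k * u n) = k * CSeries u.
Proof.
  intros Hu; pose proof (summable_Re _ Hu); pose proof (summable_Im _ Hu).
  apply C_ext; simpl.
  - rewrite <- !Series_scal_l, <- Series_minus
      by now apply ex_series_mult_l.
    apply Series_ext; reflexivity.
  - rewrite <- !Series_scal_l, <- Series_plus
      by now apply ex_series_mult_l.
    apply Series_ext; reflexivity.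
Qed.

Lemma CSeries_minus (u v : nat -> C) : summable u -> summable v ->
  CSeries (fun n => u n - v n) = CSeries u - CSeries v.
Proof.
  intros Hu Hv.
  rewrite (CSeries_ext _ (fun n => u n + (- (1)) * v n)) by (intros; ring).
  rewrite CSeries_plus, CSeries_scal by (try apply summable_scal; assumption).
  ring.
Qed.

Lemma CSeries_shift (u : nat -> C) : summable u ->
  CSeries u = u O + CSeries (fun n => u (S n)).
Proof.
  intros Hu; apply C_ext; simpl.
  - rewrite Series_incr_1 by now apply summable_Re. reflexivity.
  - rewrite Series_incr_1 by now apply summable_Im. reflexivity.
Qed.

Lemma CSeries_RtoC (u : nat -> R) :
  CSeries (fun n => RtoC (u n)) = RtoC (Series u).
Proof.
  apply C_ext; simpl; [reflexivity|].
  rewrite (Series_ext _ (fun n => 0 * 0)%R) by (intros; simpl; ring).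
  rewrite Series_scal_l; ring.
Qed.

(* Multiplying by the conjugate of the sum reduces to the real inequality. *)
Lemma Cmod_CSeries_le (u : nat -> C) : summable u ->
  (Cmod (CSeries u) <= Series (fun n => Cmod (u n)))%R.
Proof.
  intros Hu; set (s := CSeries u).
  destruct (Req_dec (Cmod s) 0) as [E|E].
  { rewrite E, <- (Rmult_0_l (Series (fun n => Cmod (u n)))), <- Series_scal_l.
    apply Series_le; [|exact Hu].
    intros n; rewrite Rmult_0_l; split; [lra|apply Cmod_ge_0]. }
  pose proof (Cmod_ge_0 s) as Hs.
  apply Rmult_le_reg_l with (Cmod s); [lra|].
  replace (Cmod s * Cmod s)%R with (Cmod s ^ 2)%R by ring.
  rewrite <- Cmod_Re_sqr; unfold s at 2; rewrite <- CSeries_scal by exact Hu.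
  rewrite <- Series_scal_l; simpl.
  assert (H : ex_series (fun n => Cmod s * Cmod (u n))%R)
    by now apply ex_series_mult_l.
  assert (Hb : forall n,
    (Rabs (Re (Cconj s * u n)) <= Cmod s * Cmod (u n))%R).
  { intros n; rewrite <- (Cmod_conj s), <- Cmod_mult; apply re_le_Cmod. }
  assert (Ha : ex_series (fun n => Rabs (Re (Cconj s * u n)))).
  { apply (ex_series_dominated _ _) with (2 := H).
    intros n; rewrite Rabs_Rabsolu; apply Hb. }
  eapply Rle_trans; [apply Rle_abs|].
  eapply Rle_trans; [apply Series_Rabs; exact Ha|].
  apply Series_le; [|exact H].
  intros n; split; [apply Rabs_pos|apply Hb].
Qed.

Lemma CSeries_bound (u : nat -> C) (v : nat -> R) :
  (forall n, Cmod (u n) <= v n)%R -> ex_series v ->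
  (Cmod (CSeries u) <= Series v)%R.
Proof.
  intros H Hv; pose proof (summable_le _ _ H Hv) as Hu.
  eapply Rle_trans; [now apply Cmod_CSeries_le|].
  apply Series_le; [|exact Hv].
  intros n; split; [apply Cmod_ge_0|apply H].
Qed.

(** * Finite sums and interchange of summations *)

(** The sum runs over [k < n], so a range from 0 to [N] is written with [S N] terms. *)
Fixpoint Csum (u : nat -> C) (n : nat) : C :=
  match n with O => 0 | S k => Csum u k + u k end.

Lemma Csum_ext (u v : nat -> C) (n : nat) :
  (forall k, (k < n)%nat -> u k = v k) -> Csum u n = Csum v n.
Proof.
  induction n; intros H; simpl; [reflexivity|].
  rewrite IHn, H by auto; reflexivity.
Qed.

Lemma Csum_scal (k : C) (u : nat -> C) (n : nat) :
  Csum (fun i => k * u i) n = k * Csum u n.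
Proof. induction n; cbn [Csum]; [ring|rewrite IHn; ring]. Qed.

Lemma Csum_plus (u v : nat -> C) (n : nat) :
  Csum (fun i => u i + v i) n = Csum u n + Csum v n.
Proof. induction n; cbn [Csum]; [ring|rewrite IHn; ring]. Qed.

Lemma Csum_first (u : nat -> C) (n : nat) :
  Csum u (S n) = u O + Csum (fun k => u (S k)) n.
Proof. induction n; cbn [Csum] in *; [ring|rewrite IHn; ring]. Qed.

Lemma CSeries_split (u : nat -> C) (n : nat) : summable u ->
  CSeries u = Csum u n + CSeries (fun k => u (n + k)%nat).
Proof.
  intros Hu; induction n; cbn [Csum]; [now rewrite Cplus_0_l|].
  rewrite IHn, (CSeries_shift (fun k => u (n + k)%nat)).
  - rewrite Nat.add_0_r, (CSeries_ext (fun k => u (n + S k)%nat)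
      (fun k => u (S n + k)%nat)) by (intros; f_equal; lia).
    ring.
  - unfold summable; now rewrite <- (ex_series_incr_n (fun n => Cmod (u n))).
Qed.

Lemma Csum_CSeries (a : nat -> nat -> C) (n : nat) :
  (forall k, (k < n)%nat -> summable (a k)) ->
  summable (fun m => Csum (fun k => a k m) n) /\
  CSeries (fun m => Csum (fun k => a k m) n) = Csum (fun k => CSeries (a k)) n.
Proof.
  induction n; intros H; cbn [Csum].
  - assert (H0 : summable (fun _ => 0)).
    { exists 0%R. apply (is_series_ext (fun _ => 0%R)).
      - intros; now rewrite Cmod_0.
      - eapply filterlim_ext; [|apply filterlim_const].
        intros k; symmetry; rewrite sum_n_const; apply Rmult_0_r. }
    split; [exact H0|].
    transitivity (0 * CSeries (fun _ => 0)); [|ring].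
    rewrite <- CSeries_scal by exact H0; apply CSeries_ext; intros; ring.
  - destruct IHn as [H1 H2]; [auto|].
    split; [apply summable_plus; auto|].
    rewrite CSeries_plus, H2; auto.
Qed.

Fixpoint Rsum (u : nat -> R) (n : nat) : R :=
  match n with O => 0 | S k => Rsum u k + u k end%R.

Lemma Csum_RtoC (u : nat -> R) (n : nat) :
  Csum (fun k => RtoC (u k)) n = RtoC (Rsum u n).
Proof.
  induction n; cbn [Csum Rsum]; [reflexivity|rewrite IHn, RtoC_plus; reflexivity].
Qed.

Lemma Rsum_scal (k : R) (u : nat -> R) (n : nat) :
  Rsum (fun i => k * u i)%R n = (k * Rsum u n)%R.
Proof. induction n; cbn [Rsum]; [ring|rewrite IHn; ring]. Qed.

Lemma Cmod_Csum_le (u : nat -> C) (v : nat -> R) (n : nat) :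
  (forall k, (k < n)%nat -> Cmod (u k) <= v k)%R ->
  (Cmod (Csum u n) <= Rsum v n)%R.
Proof.
  induction n; intros H; cbn [Csum Rsum]; [rewrite Cmod_0; lra|].
  eapply Rle_trans; [apply Cmod_triangle|].
  apply Rplus_le_compat; [apply IHn; auto|apply H; auto].
Qed.

Lemma C_eq_of_close (z w : C) :
  (forall eps, 0 < eps -> Cmod (z - w) <= eps)%R -> z = w.
Proof.
  intros H; apply Ceq_minus, Cmod_eq_0.
  apply Rle_antisym; [|apply Cmod_ge_0].
  apply Rnot_lt_le; intros Hp.
  specialize (H (Cmod (z - w) / 2)%R ltac:(lra)); lra.
Qed.

Lemma series_tail (u : nat -> R) (eps : R) : ex_series u -> (0 < eps)%R ->
  exists N, (Rabs (Series (fun k => u (N + k)%nat)) <= eps)%R.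
Proof.
  intros Hu He.
  destruct (Series_correct _ Hu (ball (Series u) (mkposreal _ He))
    (locally_ball _ _)) as [N HN].
  (* [sum_n u N] already contains [N + 1] terms, so the tail starts at [S N]. *)
  exists (S N); specialize (HN N (le_n _)).
  change (Rabs (sum_n u N - Series u) < eps)%R in HN.
  rewrite (Series_incr_n u (S N)) in HN by (auto; lia).
  rewrite sum_n_Reals in HN; simpl Init.Nat.pred in HN.
  match type of HN with (Rabs ?e < _)%R => rewrite <- (Rabs_Ropp e) in HN end.
  apply Rlt_le; eapply Rle_lt_trans; [|exact HN].
  apply Req_le; f_equal; ring.
Qed.

(** Fubini for a product majorant. The first [N] rows form a finite sum, which commutes with the
    other summation; on both sides the remaining rows contribute at most the tail of [u] times the
    sum of [v]. *)
Lemma CSeries_swap (a : nat -> nat -> C) (u v : nat -> R) :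
  (forall m n, Cmod (a m n) <= u m * v n)%R -> ex_series u -> ex_series v ->
  CSeries (fun m => CSeries (fun n => a m n)) =
  CSeries (fun n => CSeries (fun m => a m n)).
Proof.
  intros H Hu Hv.
  assert (Hrow : forall m, summable (fun n => a m n)).
  { intros m; apply (summable_le _ (fun n => u m * v n)%R); [auto|].
    now apply ex_series_mult_l. }
  assert (Hcol : forall n, summable (fun m => a m n)).
  { intros n; apply (summable_le _ (fun m => u m * v n)%R); [auto|].
    now apply ex_series_scal_r. }
  assert (HR : summable (fun m => CSeries (fun n => a m n))).
  { apply (summable_le _ (fun m => u m * Series v)%R).
    - intros m; rewrite <- Series_scal_l; apply CSeries_bound; [auto|].
      now apply ex_series_mult_l.
    - now apply ex_series_scal_r. }
  assert (Hun : forall n, ex_series (fun m => u (n + m)%nat)).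
  { intros n; now apply (ex_series_incr_n u n). }
  apply C_eq_of_close; intros eps He.
  (* The added 1 keeps the divisor nonzero when the sum of [v] vanishes. *)
  set (V := (Rabs (Series v) + 1)%R).
  assert (HV : (0 < V)%R) by (unfold V; pose proof (Rabs_pos (Series v)); lra).
  destruct (series_tail u (eps / (2 * V)) Hu) as [N HN].
  { apply Rdiv_lt_0_compat; lra. }
  set (t := (Series (fun k => u (N + k)%nat))) in *.
  destruct (Csum_CSeries a N (fun k _ => Hrow k)) as [HC HS].
  rewrite (CSeries_split _ N HR).
  change (Csum _ N) with (Csum (fun k => CSeries (a k)) N); rewrite <- HS.
  assert (Htl : forall n,
    (Cmod (CSeries (fun k => a (N + k)%nat n)) <= t * v n)%R).
  { intros n; unfold t; rewrite <- Series_scal_r; apply CSeries_bound; [auto|].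
    now apply ex_series_scal_r. }
  assert (HT : summable (fun n => CSeries (fun k => a (N + k)%nat n))).
  { apply (summable_le _ (fun n => t * v n)%R); [auto|].
    now apply ex_series_mult_l. }
  rewrite (CSeries_ext (fun n => CSeries (fun m => a m n))
    (fun n => Csum (fun k => a k n) N + CSeries (fun k => a (N + k)%nat n))).
  2: { intros n; now rewrite (CSeries_split _ N (Hcol n)). }
  rewrite CSeries_plus by assumption.
  match goal with |- (Cmod (?A + ?B - (?A + ?D)) <= _)%R =>
    replace (A + B - (A + D)) with (B - D) by ring end.
  eapply Rle_trans; [apply Cmod_sub_triangle|].
  assert (Ht : (t * Series v <= eps / 2)%R).
  { eapply Rle_trans; [apply Rle_abs|]; rewrite Rabs_mult.
    apply Rle_trans with (eps / (2 * V) * V)%R.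
    - apply Rmult_le_compat; try apply Rabs_pos; [exact HN|unfold V; lra].
    - apply Req_le; field; lra. }
  assert (H1 : (Cmod (CSeries (fun k => CSeries (fun n => a (N + k)%nat n)))
    <= t * Series v)%R).
  { unfold t; rewrite <- Series_scal_r; apply CSeries_bound.
    - intros m; rewrite <- Series_scal_l; apply CSeries_bound; [auto|].
      now apply ex_series_mult_l.
    - now apply ex_series_scal_r. }
  assert (H2 : (Cmod (CSeries (fun n => CSeries (fun k => a (N + k)%nat n)))
    <= t * Series v)%R).
  { rewrite <- Series_scal_l; apply CSeries_bound; [auto|].
    now apply ex_series_mult_l. }
  lra.
Qed.

(** The ratio test as an explicit geometric bound, valid from index 0 on. Induction on [n0] removes
    the initial terms one at a time. *)
Lemma geometric_bound (u : nat -> R) (q : R) (n0 : nat) : (0 < q)%R ->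
  (forall n, (n0 <= n)%nat -> Rabs (u (S n)) <= q * Rabs (u n))%R ->
  exists D, (0 <= D)%R /\ forall n, (Rabs (u n) <= D * q ^ n)%R.
Proof.
  intros Hq; revert u; induction n0 as [|n0 IH]; intros u H.
  - exists (Rabs (u O)); split; [apply Rabs_pos|].
    induction n as [|n IHn]; simpl; [lra|].
    eapply Rle_trans; [apply H; lia|].
    apply Rle_trans with (q * (Rabs (u O) * q ^ n))%R; [|lra].
    apply Rmult_le_compat_l; lra.
  - destruct (IH (fun n => u (S n))) as [D [HD HDn]].
    { intros n Hn; apply H; lia. }
    (* [Rabs (u O)] covers the index 0; [D / q] compensates for the shift, since
       [D * q ^ n = (D / q) * q ^ S n]. *)
    exists (Rabs (u O) + D / q)%R.
    assert (0 <= D / q)%R by (apply Rdiv_le_0_compat; lra).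
    pose proof (Rabs_pos (u O)).
    split; [lra|]; intros [|n]; simpl; [lra|].
    eapply Rle_trans; [apply HDn|].
    replace (D * q ^ n)%R with (D / q * (q * q ^ n))%R by (field; lra).
    apply Rmult_le_compat_r; [|lra].
    apply Rmult_le_pos; [lra|apply pow_le; lra].
Qed.

Lemma ex_series_geom_scal (D q : R) : (0 <= q < 1)%R ->
  ex_series (fun n => D * q ^ n)%R.
Proof.
  intros Hq; apply ex_series_mult_l, ex_series_geom.
  rewrite Rabs_pos_eq; lra.
Qed.

(** * Derivatives of complex functions of a real variable *)

(** Analytic functions are only differentiated along real lines and segments, so real derivatives of
    both components suffice. *)
Definition is_derC (f : R -> C) (s : R) (l : C) : Prop :=
  is_derive (fun t => Re (f t)) s (Re l) /\
  is_derive (fun t => Im (f t)) s (Im l).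

Lemma is_derC_ext (f g : R -> C) (s : R) (l m : C) :
  (forall t, f t = g t) -> l = m -> is_derC f s l -> is_derC g s m.
Proof.
  intros H <- [H1 H2]; split.
  - now apply is_derive_ext with (2 := H1); intros t; rewrite H.
  - now apply is_derive_ext with (2 := H2); intros t; rewrite H.
Qed.

Lemma is_derC_const (k : C) (s : R) : is_derC (fun _ => k) s 0.
Proof. split; apply (is_derive_const (V := R_NormedModule)). Qed.

Lemma is_derC_RtoC (f : R -> R) (s l : R) :
  is_derive f s l -> is_derC (fun t => RtoC (f t)) s (RtoC l).
Proof.
  intros H; split; [exact H|].
  exact (is_derive_const (K := R_AbsRing) (V := R_NormedModule) 0%R s).
Qed.

Lemma is_derC_plus (f g : R -> C) (s : R) (l m : C) :
  is_derC f s l -> is_derC g s m -> is_derC (fun t => f t + g t) s (l + m).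
Proof.
  intros [H1 H2] [H3 H4]; split; simpl;
    now apply (is_derive_plus (V := R_NormedModule)).
Qed.

Lemma is_derC_mult (f g : R -> C) (s : R) (l m : C) :
  is_derC f s l -> is_derC g s m ->
  is_derC (fun t => f t * g t) s (l * g s + f s * m).
Proof.
  intros [H1 H2] [H3 H4]; split; simpl.
  - evar_last; [apply (is_derive_minus (V := R_NormedModule));
      apply Derive.is_derive_mult; eassumption|].
    unfold minus, plus, opp, Re, Im in *; simpl; ring.
  - evar_last; [apply (is_derive_plus (V := R_NormedModule));
      apply Derive.is_derive_mult; eassumption|].
    unfold minus, plus, opp, Re, Im in *; simpl; ring.
Qed.

Lemma is_derC_scal (k : C) (f : R -> C) (s : R) (l : C) :
  is_derC f s l -> is_derC (fun t => k * f t) s (k * l).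
Proof.
  intros H; refine (is_derC_ext _ _ _ _ _ (fun t => eq_refl) _
    (is_derC_mult _ _ _ _ _ (is_derC_const k s) H)); ring.
Qed.

Lemma is_derC_line (p q : C) (s : R) : is_derC (fun t => p + RtoC t * q) s q.
Proof.
  refine (is_derC_ext _ _ _ _ _ (fun t => eq_refl) _
    (is_derC_plus _ _ _ _ _ (is_derC_const p s)
      (is_derC_mult _ _ _ _ _ (is_derC_RtoC _ s 1 _) (is_derC_const q s)))).
  - ring.
  - apply (is_derive_id (K := R_AbsRing)).
Qed.

Lemma is_derC_Cexp (f : R -> C) (s : R) (l : C) :
  is_derC f s l -> is_derC (fun t => Cexp (f t)) s (l * Cexp (f s)).
Proof.
  assert (H : forall (a b : R -> R) (la lb : R),
    is_derive a s la -> is_derive b s lb ->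
    is_derive (fun t => exp (a t) * cos (b t))%R s
      (la * (exp (a s) * cos (b s)) - lb * (exp (a s) * sin (b s)))%R /\
    is_derive (fun t => exp (a t) * sin (b t))%R s
      (la * (exp (a s) * sin (b s)) + lb * (exp (a s) * cos (b s)))%R).
  { intros a b la lb Ha Hb.
    assert (Da : Derive (fun x : R => a x) s = la)
      by exact (is_derive_unique _ _ _ Ha).
    assert (Db : Derive (fun x : R => b x) s = lb)
      by exact (is_derive_unique _ _ _ Hb).
    split; (auto_derive; [repeat split; eexists; eassumption|]);
      rewrite Da, Db; ring. }
  intros [H1 H2]; apply (H _ _ _ _ H1 H2).
Qed.

Lemma is_derC_inv (f : R -> C) (s : R) (l : C) : f s <> 0 ->
  is_derC f s l -> is_derC (fun t => / f t) s (- l / (f s * f s)).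
Proof.
  assert (H : forall (a b : R -> R) (la lb : R), (a s ^ 2 + b s ^ 2 <> 0)%R ->
    is_derive a s la -> is_derive b s lb ->
    is_derive (fun t => a t / (a t ^ 2 + b t ^ 2))%R s
      (la / (a s ^ 2 + b s ^ 2) - a s * (2 * a s * la + 2 * b s * lb) /
        (a s ^ 2 + b s ^ 2) ^ 2)%R /\
    is_derive (fun t => - b t / (a t ^ 2 + b t ^ 2))%R s
      (- lb / (a s ^ 2 + b s ^ 2) + b s * (2 * a s * la + 2 * b s * lb) /
        (a s ^ 2 + b s ^ 2) ^ 2)%R).
  { intros a b la lb Hn Ha Hb; simpl in Hn.
    assert (Da : Derive (fun x : R => a x) s = la)
      by exact (is_derive_unique _ _ _ Ha).
    assert (Db : Derive (fun x : R => b x) s = lb)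
      by exact (is_derive_unique _ _ _ Hb).
    split; (auto_derive; [repeat split; try (eexists; eassumption); auto|]);
      rewrite Da, Db;
      field; auto. }
  intros H0 [H1 H2].
  assert (Hn : (Re (f s) ^ 2 + Im (f s) ^ 2 <> 0)%R).
  { rewrite <- Cmod2_alt; apply pow_nonzero.
    apply Cmod_gt_0 in H0; lra. }
  destruct (H _ _ _ _ Hn H1 H2) as [H3 H4].
  replace (- l / (f s * f s)) with (- l * (/ f s * / f s))
    by (field; exact H0).
  unfold Re, Im in *; split; (evar_last; [eassumption|]);
    simpl in *; field;
    intros E; apply Hn; rewrite <- E; ring.
Qed.

(** On the right half-plane this form replaces the piecewise [acos], whose formula is singular at
    the positive axis, by a composition that can be differentiated. *)
Lemma Carg_atan (z : C) : (0 < Re z)%R -> Carg z = atan (Im z / Re z).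
Proof.
  intros H; set (A := atan (Im z / Re z)).
  assert (Hm : (Cmod z = Re z * sqrt (1 + (Im z / Re z) ^ 2))%R).
  { replace (Re z * sqrt (1 + (Im z / Re z) ^ 2))%R with
      (sqrt (Re z ^ 2) * sqrt (1 + (Im z / Re z) ^ 2))%R
      by (rewrite sqrt_pow2; lra).
    rewrite <- sqrt_mult_alt by apply pow2_ge_0.
    unfold Cmod; f_equal; unfold Re, Im in *; field; lra. }
  assert (Hs : (0 < sqrt (1 + (Im z / Re z) ^ 2))%R).
  { apply sqrt_lt_R0; pose proof (pow2_ge_0 (Im z / Re z)); lra. }
  assert (Hc : (Re z / Cmod z = cos A)%R).
  { unfold A; rewrite cos_atan, Hm.
    replace (1 + (Im z / Re z)²)%R with (1 + (Im z / Re z) ^ 2)%R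
      by (unfold Rsqr; ring).
    field; lra. }
  pose proof (atan_bound (Im z / Re z)) as Hb; fold A in Hb.
  pose proof PI_RGT_0.
  unfold Carg; rewrite Hc; destruct (Rlt_dec (Im z) 0) as [Hi|Hi].
  - assert (A < 0)%R.
    { unfold A; rewrite <- atan_0; apply atan_increasing.
      apply Rlt_div_l; lra. }
    rewrite <- cos_neg, acos_cos; lra.
  - assert (0 <= A)%R.
    { destruct (Req_dec (Im z) 0) as [E|E].
      - unfold A; rewrite E; unfold Rdiv; rewrite Rmult_0_l, atan_0; lra.
      - left; unfold A; rewrite <- atan_0; apply atan_increasing.
        apply Rdiv_lt_0_compat; lra. }
    rewrite acos_cos; lra.
Qed.

Lemma is_derC_Clog (f : R -> C) (s : R) (l : C) : (0 < Re (f s))%R ->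
  is_derC f s l -> is_derC (fun t => Clog (f t)) s (l / f s).
Proof.
  assert (H : forall (a b : R -> R) (la lb : R), (0 < a s)%R ->
    is_derive a s la -> is_derive b s lb ->
    is_derive (fun t => ln (sqrt (a t ^ 2 + b t ^ 2)))%R s
      ((a s * la + b s * lb) / (a s ^ 2 + b s ^ 2))%R /\
    is_derive (fun t => atan (b t / a t))%R s
      ((lb * a s - b s * la) / (a s ^ 2 + b s ^ 2))%R).
  { intros a b la lb H0 Ha Hb.
    assert (Hp : (0 < a s * (a s * 1) + b s * (b s * 1))%R) by nra.
    pose proof (sqrt_lt_R0 _ Hp) as Hs.
    assert (Da : Derive (fun x : R => a x) s = la)
      by exact (is_derive_unique _ _ _ Ha).
    assert (Db : Derive (fun x : R => b x) s = lb)
      by exact (is_derive_unique _ _ _ Hb).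
    split; (auto_derive; [repeat split; try (eexists; eassumption); auto; lra|]);
      rewrite Da, Db.
    - replace (/ (2 * sqrt (a s * (a s * 1) + b s * (b s * 1))) *
        / sqrt (a s * (a s * 1) + b s * (b s * 1)))%R with
        (/ (2 * (a s * (a s * 1) + b s * (b s * 1))))%R.
      2: { rewrite <- (sqrt_sqrt (a s * (a s * 1) + b s * (b s * 1))) at 1
             by lra; field; lra. }
      field_simplify; [|repeat split; lra|repeat split; lra].
      rewrite pow2_sqrt by lra; field; lra.
    - field; repeat split; nra. }
  intros H0 [H1 H2].
  destruct (H _ _ _ _ H0 H1 H2) as [H3 H4].
  assert (Hn : (Re (f s) ^ 2 + Im (f s) ^ 2 <> 0)%R).
  { pose proof (pow2_ge_0 (Im (f s))); pose proof (pow_lt _ 2 H0); lra. }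
  split.
  - evar_last; [exact H3|]; unfold Re, Im in *; simpl in *; field;
    intros E; apply Hn; rewrite <- E; ring.
  (* The arctangent form holds where the real part is positive, which by continuity is the case near
     [s]. *)
  - apply is_derive_ext_loc with (fun t => atan (Im (f t) / Re (f t))).
    + assert (Hc : continuous (fun t => Re (f t)) s)
        by (apply (ex_derive_continuous (V := R_NormedModule)); eexists; exact H1).
      assert (Hl : locally s (fun t => 0 < Re (f t))%R)
        by exact (Hc _ (open_gt 0 _ H0)).
      revert Hl; apply filter_imp; intros t Ht; symmetry; apply Carg_atan, Ht.
    + evar_last; [exact H4|]; unfold Re, Im in *; simpl in *; field;
    intros E; apply Hn; rewrite <- E; ring.
Qed.

Lemma is_derC_Cpower (f : R -> C) (w : C) (s : R) (l : C) : (0 < Re (f s))%R ->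
  is_derC f s l ->
  is_derC (fun t => Cpower (f t) w) s (w * l / f s * Cpower (f s) w).
Proof.
  intros H0 H; unfold Cpower.
  refine (is_derC_ext _ _ _ _ _ (fun t => eq_refl) _ (is_derC_Cexp _ _ _
    (is_derC_scal w _ _ _ (is_derC_Clog _ _ _ H0 H)))).
  unfold Cdiv; ring.
Qed.

(** The two components have no common mean value point, so the real theorem is applied to each of
    them; hence the factor 2. *)
Lemma is_derC_mvt (f df : R -> C) (a b B : R) : (a <= b)%R ->
  (forall s, a <= s <= b -> is_derC f s (df s))%R ->
  (forall s, a <= s <= b -> Cmod (df s) <= B)%R ->
  (Cmod (f b - f a) <= 2 * B * (b - a))%R.
Proof.
  intros Hab Hd HB.
  assert (Haux : forall (g dg : R -> R),
    (forall s, a <= s <= b -> is_derive g s (dg s))%R ->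
    (forall s, a <= s <= b -> Rabs (dg s) <= B)%R ->
    (Rabs (g b - g a) <= B * (b - a))%R).
  { intros g dg H1 H2.
    destruct (MVT_gen g a b dg) as [c [Hc ->]].
    - rewrite Rmin_left, Rmax_right by lra; intros; apply H1; lra.
    - rewrite Rmin_left, Rmax_right by lra; intros.
      apply derivable_continuous_pt; eexists; apply is_derive_Reals, H1; lra.
    - rewrite Rmin_left, Rmax_right in Hc by lra.
      rewrite Rabs_mult, (Rabs_pos_eq (b - a)) by lra.
      apply Rmult_le_compat_r; [lra|auto]. }
  eapply Rle_trans; [apply Cmod_le_add|].
  replace (2 * B * (b - a))%R with (B * (b - a) + B * (b - a))%R by ring.
  apply Rplus_le_compat.
  - apply (Haux (fun s => Re (f s)) (fun s => Re (df s))).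
    + intros s Hs; apply Hd, Hs.
    + intros s Hs; eapply Rle_trans; [apply re_le_Cmod|auto].
  - apply (Haux (fun s => Im (f s)) (fun s => Im (df s))).
    + intros s Hs; apply Hd, Hs.
    + intros s Hs; eapply Rle_trans; [apply im_le_Cmod|auto].
Qed.

Lemma is_derC_zero_eq (f : R -> C) (a b : R) : (a <= b)%R ->
  (forall s, a <= s <= b -> is_derC f s 0)%R -> f b = f a.
Proof.
  intros Hab H; apply C_eq_of_close; intros eps He.
  eapply Rle_trans; [apply (is_derC_mvt f (fun _ => 0) a b 0); auto|lra].
  intros; rewrite Cmod_0; lra.
Qed.

(** Power series naturally give a remainder that is quadratic in the increment, with an explicit
    constant; this turns such a bound into derivatives of both components. *)
Lemma is_derC_quadratic (f : R -> C) (s : R) (l : C) (delta D : R) :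
  (0 < delta)%R -> (0 <= D)%R ->
  (forall h, Rabs h < delta ->
     Cmod (f (s + h)%R - f s - RtoC h * l) <= D * h ^ 2)%R ->
  is_derC f s l.
Proof.
  intros Hd HD H.
  assert (Haux : forall (g : R -> R) (m : R),
    (forall h, Rabs h < delta -> Rabs (g (s + h) - g s - h * m) <= D * h ^ 2)%R
    -> is_derive g s m).
  { intros g m Hg; apply is_derive_Reals; intros eps He.
    assert (Hm : (0 < Rmin delta (eps / (D + 1)))%R).
    { apply Rmin_glb_lt; [lra|apply Rdiv_lt_0_compat; lra]. }
    exists (mkposreal _ Hm); intros h Hh Hlt; simpl in Hlt.
    pose proof (Rmin_l delta (eps / (D + 1))).
    pose proof (Rmin_r delta (eps / (D + 1))).
    specialize (Hg h ltac:(lra)).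
    pose proof (Rabs_pos_lt h Hh) as Hp.
    replace ((g (s + h) - g s) / h - m)%R
      with ((g (s + h) - g s - h * m) / h)%R by (field; auto).
    unfold Rdiv; rewrite Rabs_mult, Rabs_inv.
    apply Rle_lt_trans with (D * Rabs h)%R.
    - apply Rmult_le_reg_r with (Rabs h); [lra|].
      rewrite Rmult_assoc, Rinv_l, Rmult_1_r by lra.
      eapply Rle_trans; [exact Hg|].
      rewrite <- (pow2_abs h); apply Req_le; ring.
    - apply Rle_lt_trans with ((D + 1) * Rabs h)%R; [nra|].
      apply Rlt_le_trans with ((D + 1) * (eps / (D + 1)))%R.
      + apply Rmult_lt_compat_l; lra.
      + apply Req_le; field; lra. }
  split; apply Haux; intros h Hh; specialize (H h Hh).
  - eapply Rle_trans; [|exact H].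
    eapply Rle_trans; [|apply re_le_Cmod].
    apply Req_le; f_equal; unfold Re, Im; simpl; ring.
  - eapply Rle_trans; [|exact H].
    eapply Rle_trans; [|apply im_le_Cmod].
    apply Req_le; f_equal; unfold Re, Im; simpl; ring.
Qed.

(** * Complex power series *)

Definition CPS (u : nat -> C) (z : C) : C := CSeries (fun n => u n * z ^ n).

(** Bounded terms at radius [rho]: this encodes a radius of convergence at least [rho], and is
    preserved by sums, multiples and shifts of the coefficients. *)
Definition geo (u : nat -> C) (rho : R) : Prop :=
  exists D, forall n, (Cmod (u n) * rho ^ n <= D)%R.

Lemma geo_term (u : nat -> C) (rho : R) : (0 < rho)%R -> geo u rho ->
  exists D, (0 <= D)%R /\
    forall n r, (0 <= r)%R -> (Cmod (u n) * r ^ n <= D * (r / rho) ^ n)%R.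
Proof.
  intros Hr [D HD]; exists D.
  assert (HDn : (0 <= D)%R).
  { eapply Rle_trans; [|apply (HD O)]; simpl; rewrite Rmult_1_r.
    apply Cmod_ge_0. }
  split; [exact HDn|]; intros n r Hr0.
  replace (Cmod (u n) * r ^ n)%R with (Cmod (u n) * rho ^ n * (r / rho) ^ n)%R.
  - apply Rmult_le_compat_r; [|apply HD].
    apply pow_le, Rdiv_le_0_compat; lra.
  - rewrite Rmult_assoc, <- Rpow_mult_distr; do 2 f_equal; field; lra.
Qed.

Lemma CPS_ext (u v : nat -> C) (z : C) :
  (forall n, u n = v n) -> CPS u z = CPS v z.
Proof. intros H; apply CSeries_ext; intros n; now rewrite H. Qed.

Lemma geo_summable_R (u : nat -> C) (rho r : R) : (0 <= r < rho)%R ->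
  geo u rho -> ex_series (fun n => Cmod (u n) * r ^ n)%R.
Proof.
  intros Hr Hg; destruct (geo_term u rho ltac:(lra) Hg) as [D [HD Hn]].
  apply ex_series_dominated with (fun n => D * (r / rho) ^ n)%R.
  - intros n; rewrite Rabs_pos_eq; [apply Hn; lra|].
    apply Rmult_le_pos; [apply Cmod_ge_0|apply pow_le; lra].
  - apply ex_series_geom_scal; split; [apply Rdiv_le_0_compat; lra|].
    apply Rlt_div_l; lra.
Qed.

Lemma geo_summable (u : nat -> C) (rho : R) (z : C) : (Cmod z < rho)%R ->
  geo u rho -> summable (fun n => u n * z ^ n).
Proof.
  intros Hz Hg.
  apply (summable_le _ (fun n => Cmod (u n) * Cmod z ^ n)%R).
  - intros n; rewrite Cmod_mult, Cmod_pow; lra.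
  - apply geo_summable_R with rho; auto using Cmod_ge_0.
Qed.

Lemma CPS_plus (u v : nat -> C) (z : C) (rho : R) : (Cmod z < rho)%R ->
  geo u rho -> geo v rho -> CPS (fun n => u n + v n) z = CPS u z + CPS v z.
Proof.
  intros Hz Hu Hv; unfold CPS; rewrite <- CSeries_plus
    by (eapply geo_summable; eassumption).
  apply CSeries_ext; intros; ring.
Qed.

Lemma CPS_scal (k : C) (u : nat -> C) (z : C) (rho : R) : (Cmod z < rho)%R ->
  geo u rho -> CPS (fun n => k * u n) z = k * CPS u z.
Proof.
  intros Hz Hu; unfold CPS; rewrite <- CSeries_scal
    by (eapply geo_summable; eassumption).
  apply CSeries_ext; intros; ring.
Qed.

Definition cshift (u : nat -> C) (n : nat) : C :=
  match n with O => 0 | S k => u k end.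

Lemma CPS_cshift (u : nat -> C) (z : C) (rho : R) : (Cmod z < rho)%R ->
  geo u rho -> CPS (cshift u) z = z * CPS u z.
Proof.
  intros Hz Hu; unfold CPS.
  pose proof (geo_summable u rho z Hz Hu) as Hs.
  assert (E : forall n, cshift u (S n) * z ^ S n = z * (u n * z ^ n)).
  { intros n; rewrite Cpow_S; simpl; ring. }
  rewrite CSeries_shift.
  - rewrite (CSeries_ext _ _ E), CSeries_scal by exact Hs; simpl; ring.
  - apply summable_shift, summable_ext with (fun n => z * (u n * z ^ n)).
    + intros n; symmetry; apply E.
    + now apply summable_scal.
Qed.

Definition cderiv (u : nat -> C) (n : nat) : C := INR (S n) * u (S n).

Lemma INR_sqr_geometric (r : R) : (1 < r)%R ->
  exists D, (0 <= D)%R /\ forall n, (INR n ^ 2 <= D * r ^ n)%R.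
Proof.
  intros Hr.
  (* For [n >= 1] and [n >= 3 / (r - 1)] one has [(n + 1)^2 <= n^2 + 3 n <= r n^2], so the ratio
     test applies with ratio [r]. *)
  destruct (INR_unbounded (3 / (r - 1))) as [n0 Hn0].
  destruct (geometric_bound (fun n => INR n ^ 2)%R r (S n0)) as [D [HD H]];
    [lra| |].
  - intros n Hn.
    apply le_INR in Hn; rewrite S_INR in Hn.
    assert (H0 : (0 <= 3 / (r - 1))%R) by (apply Rdiv_le_0_compat; lra).
    assert (H1 : (3 <= (r - 1) * INR n)%R).
    { apply Rle_trans with ((r - 1) * (3 / (r - 1)))%R.
      - apply Req_le; field; lra.
      - apply Rmult_le_compat_l; lra. }
    rewrite S_INR, !Rabs_pos_eq by apply pow2_ge_0; simpl; nra.
  - exists D; split; [exact HD|].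
    intros n; eapply Rle_trans; [apply Rle_abs|apply H].
Qed.

(** The derivative [n z^(n-1)] of [z^n], written through [cshift] to avoid a predecessor at
    [n = 0]. *)
Definition pow_deriv (z : C) : nat -> C := cshift (fun k => INR (S k) * z ^ k).

(** First and second order Taylor remainders of [z^n] in one induction: if [d] and [e] are the two
    remainders at [n], those at [n + 1] are [(z + w) d + w z^n] and [z e + w d]. The factors [rho]
    and [rho^2] on the left avoid the exponents [n - 1] and [n - 2]. *)
Lemma pow_remainder (z w : C) (rho : R) (n : nat) : (0 < rho)%R ->
  (Cmod z + Cmod w <= rho)%R ->
  (rho * Cmod ((z + w) ^ n - z ^ n) <= INR n * Cmod w * rho ^ n)%R /\
  (rho ^ 2 * Cmod ((z + w) ^ n - z ^ n - w * pow_deriv z n)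
   <= INR n ^ 2 * Cmod w ^ 2 * rho ^ n)%R.
Proof.
  intros Hr Hzw.
  pose proof (Cmod_ge_0 z) as Hz; pose proof (Cmod_ge_0 w) as Hw.
  assert (Hs : (Cmod (z + w) <= rho)%R)
    by (eapply Rle_trans; [apply Cmod_triangle|lra]).
  pose proof (Cmod_ge_0 (z + w)) as Hs0.
  induction n as [|n [IH1 IH2]].
  - simpl; split.
    + replace (1 - 1) with (RtoC 0) by ring; rewrite Cmod_0; lra.
    + replace (1 - 1 - w * 0) with (RtoC 0) by ring; rewrite Cmod_0; lra.
  - set (d := (z + w) ^ n - z ^ n) in *.
    assert (Hzn : (Cmod (z ^ n) <= rho ^ n)%R).
    { rewrite Cmod_pow; apply pow_incr; lra. }
    pose proof (Cmod_ge_0 (z ^ n)) as Hzn0.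
    pose proof (Cmod_ge_0 d) as Hd0.
    pose proof (pow_lt rho n Hr) as Hrn.
    pose proof (pos_INR n) as Hn.
    split.
    + replace ((z + w) ^ S n - z ^ S n) with ((z + w) * d + w * z ^ n)
        by (unfold d; rewrite !Cpow_S; ring).
      rewrite S_INR; simpl.
      eapply Rle_trans; [apply Rmult_le_compat_l; [lra|apply Cmod_triangle]|].
      rewrite !Cmod_mult.
      assert (Cmod (z + w) * Cmod d <= rho * Cmod d)%R
        by (apply Rmult_le_compat_r; lra).
      assert (Cmod w * Cmod (z ^ n) <= Cmod w * rho ^ n)%R
        by (apply Rmult_le_compat_l; lra).
      assert (rho * (rho * Cmod d) <= rho * (INR n * Cmod w * rho ^ n))%R
        by (apply Rmult_le_compat_l; lra).
      assert (rho * (Cmod (z + w) * Cmod d + Cmod w * Cmod (z ^ n)) <=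
        rho * (rho * Cmod d + Cmod w * rho ^ n))%R
        by (apply Rmult_le_compat_l; lra).
      lra.
    + set (e := d - w * pow_deriv z n) in *.
      replace ((z + w) ^ S n - z ^ S n -
        w * pow_deriv z (S n)) with (z * e + w * d).
      2: { unfold e, d; destruct n as [|m].
           - simpl; ring.
           - unfold pow_deriv; cbn [cshift]; rewrite !Cpow_S, (S_INR (S m)), RtoC_plus; ring. }
      rewrite S_INR; cbn [pow].
      pose proof (Cmod_ge_0 e) as He0.
      assert (Cmod (z * e + w * d) <= rho * Cmod e + Cmod w * Cmod d)%R.
      { eapply Rle_trans; [apply Cmod_triangle|]; rewrite !Cmod_mult.
        apply Rplus_le_compat_r, Rmult_le_compat_r; lra. }
      assert (rho ^ 2 * Cmod (z * e + w * d) <=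
        rho ^ 2 * (rho * Cmod e + Cmod w * Cmod d))%R
        by (apply Rmult_le_compat_l; [apply pow2_ge_0|lra]).
      assert (rho * (rho ^ 2 * Cmod e) <=
        rho * (INR n ^ 2 * Cmod w ^ 2 * rho ^ n))%R
        by (apply Rmult_le_compat_l; lra).
      assert (rho * Cmod w * (rho * Cmod d) <=
        rho * Cmod w * (INR n * Cmod w * rho ^ n))%R
        by (apply Rmult_le_compat_l; [apply Rmult_le_pos; lra|lra]).
      assert (0 <= (INR n + 1) * (Cmod w * Cmod w * (rho * rho ^ n)))%R.
      { repeat apply Rmult_le_pos; lra. }
      simpl in *; nra.
Qed.

(** Termwise differentiation. The second order remainders of [z^n] are summed against the
    coefficients, and the sum of [|u_n| n^2 r^n] converges for [r < rho]; this gives a quadratic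
    remainder for the series. *)
Lemma is_derC_CPS (u : nat -> C) (rho : R) (p q : C) (s : R) : geo u rho ->
  (Cmod (p + RtoC s * q) < rho)%R ->
  is_derC (fun t => CPS u (p + RtoC t * q)) s
    (q * CPS (cderiv u) (p + RtoC s * q)).
Proof.
  intros Hg Hz; set (z := p + RtoC s * q) in *.
  pose proof (Cmod_ge_0 z) as Hz0; pose proof (Cmod_ge_0 q) as Hq0.
  (* The midpoint leaves room for the increment below [r] and for geometric decay between [r] and
     [rho]. *)
  set (r := ((Cmod z + rho) / 2)%R).
  destruct (geo_term u rho ltac:(lra) Hg) as [D [HD Hu]].
  (* This base exceeds 1 and so dominates [n^2], while its product with [r / rho] is
     [(r + rho) / (2 rho) < 1]. *)
  destruct (INR_sqr_geometric ((r + rho) / (2 * r))) as [D' [HD' Hn2]].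
  { apply Rlt_div_r; unfold r; lra. }
  set (v := fun n => (D * D' * ((r + rho) / (2 * rho)) ^ n)%R).
  assert (Hv : ex_series v).
  { apply ex_series_geom_scal; split.
    - apply Rdiv_le_0_compat; unfold r; lra.
    - apply Rlt_div_l; unfold r; lra. }
  assert (Huv : forall n, (Cmod (u n) * (INR n ^ 2 * r ^ n) <= v n)%R).
  { intros n; replace (Cmod (u n) * (INR n ^ 2 * r ^ n))%R
      with (INR n ^ 2 * (Cmod (u n) * r ^ n))%R by ring.
    eapply Rle_trans.
    - apply Rmult_le_compat; [apply pow2_ge_0| |apply Hn2|].
      + apply Rmult_le_pos; [apply Cmod_ge_0|apply pow_le; unfold r; lra].
      + apply (Hu n r); unfold r; lra.
    - unfold v; apply Req_le.
      replace ((r + rho) / (2 * rho))%R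
        with ((r + rho) / (2 * r) * (r / rho))%R by (field; unfold r; lra).
      rewrite Rpow_mult_distr; ring. }
  assert (Hr : (0 < r)%R) by (unfold r; lra).
  (* [delta] guarantees [|z| + |h q| <= r]; the 1 added to [|q|] covers [q = 0]. *)
  apply is_derC_quadratic with
    (delta := ((r - Cmod z) / (Cmod q + 1))%R)
    (D := (Cmod q ^ 2 / r ^ 2 * Rabs (Series v))%R).
  - apply Rdiv_lt_0_compat; unfold r; lra.
  - apply Rmult_le_pos; [|apply Rabs_pos].
    apply Rdiv_le_0_compat; [apply pow2_ge_0|apply pow_lt, Hr].
  - intros h Hh.
    set (w := RtoC h * q).
    assert (Hw : (Cmod w = Rabs h * Cmod q)%R)
      by (unfold w; now rewrite Cmod_mult, Cmod_R).
    assert (Hzw : (Cmod z + Cmod w <= r)%R).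
    { rewrite Hw.
      assert (Rabs h * (Cmod q + 1) <= r - Cmod z)%R.
      { apply Rle_trans with ((r - Cmod z) / (Cmod q + 1) * (Cmod q + 1))%R.
        - apply Rmult_le_compat_r; lra.
        - apply Req_le; field; lra. }
      pose proof (Rabs_pos h); lra. }
    assert (Hzr : (Cmod z < rho)%R) by exact Hz.
    assert (Hzwr : (Cmod (z + w) < rho)%R).
    { eapply Rle_lt_trans; [apply Cmod_triangle|]; unfold r in Hzw; lra. }
    replace (p + RtoC (s + h) * q) with (z + w)
      by (unfold z, w; rewrite RtoC_plus; ring).
    pose proof (geo_summable u rho z Hzr Hg) as S1.
    pose proof (geo_summable u rho (z + w) Hzwr Hg) as S2.
    set (T := pow_deriv z).
    assert (HT : forall n, (Cmod ((z + w) ^ n - z ^ n - w * T n) <=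
      Cmod w ^ 2 / r ^ 2 * (INR n ^ 2 * r ^ n))%R).
    { intros n; destruct (pow_remainder z w r n Hr Hzw) as [_ H].
      apply Rmult_le_reg_l with (r ^ 2)%R; [apply pow_lt, Hr|].
      eapply Rle_trans; [exact H|apply Req_le]; field; lra. }
    set (e := fun n => u n * ((z + w) ^ n - z ^ n - w * T n)).
    assert (He : forall n, (Cmod (e n) <= Cmod w ^ 2 / r ^ 2 * v n)%R).
    { intros n; unfold e; rewrite Cmod_mult.
      eapply Rle_trans; [apply Rmult_le_compat_l; [apply Cmod_ge_0|apply HT]|].
      replace (Cmod (u n) * (Cmod w ^ 2 / r ^ 2 * (INR n ^ 2 * r ^ n)))%R with
        (Cmod w ^ 2 / r ^ 2 * (Cmod (u n) * (INR n ^ 2 * r ^ n)))%R by ring.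
      apply Rmult_le_compat_l; [|apply Huv].
      apply Rdiv_le_0_compat; [apply pow2_ge_0|apply pow_lt, Hr]. }
    assert (Se : summable e).
    { eapply summable_le; [exact He|]; now apply ex_series_mult_l. }
    assert (HTs : summable (fun n => u n * T n)).
    { apply summable_shift.
      apply (summable_le _ (fun n => v (S n) * / r)%R).
      - intros n; unfold T, pow_deriv; cbn [cshift].
        rewrite !Cmod_mult, Cmod_pow, Cmod_R, Rabs_pos_eq by apply pos_INR.
        apply Rmult_le_reg_r with r; [exact Hr|].
        rewrite (Rmult_assoc (v (S n))), Rinv_l, Rmult_1_r by lra.
        eapply Rle_trans; [|apply (Huv (S n))].
        rewrite Rmult_assoc; apply Rmult_le_compat_l; [apply Cmod_ge_0|].
        assert (1 <= INR (S n))%R by (rewrite S_INR; pose proof (pos_INR n); lra).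
        assert (Cmod z ^ n <= r ^ n)%R
          by (apply pow_incr; pose proof (Cmod_ge_0 w); lra).
        pose proof (pow_le (Cmod z) n Hz0).
        replace (INR (S n) ^ 2 * r ^ S n)%R
          with (INR (S n) * INR (S n) * (r ^ n * r))%R by (simpl; ring).
        rewrite Rmult_assoc.
        apply Rmult_le_compat; [lra| |nra|].
        + apply Rmult_le_pos; lra.
        + apply Rmult_le_compat_r; lra.
      - apply ex_series_scal_r; now apply (ex_series_incr_1 v). }
    assert (E1 : CPS (cderiv u) z = CSeries (fun n => u n * T n)).
    { rewrite (CSeries_shift (fun n => u n * T n)) by exact HTs.
      unfold CPS, T, pow_deriv; cbn [cshift]; rewrite Cmult_0_r, Cplus_0_l.
      apply CSeries_ext; intros n; unfold cderiv; ring. }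
    assert (E2 : CPS u (z + w) - CPS u z - RtoC h * (q * CPS (cderiv u) z)
      = CSeries e).
    { rewrite E1; unfold CPS.
      rewrite <- CSeries_minus by assumption.
      rewrite Cmult_assoc; fold w.
      rewrite <- CSeries_scal by exact HTs.
      rewrite <- CSeries_minus by (try apply summable_scal;
        try apply summable_minus; assumption).
      apply CSeries_ext; intros n; unfold e; ring. }
    fold z; rewrite E2; eapply Rle_trans; [apply CSeries_bound; [exact He|]|].
    + now apply ex_series_mult_l.
    + rewrite Series_scal_l, Hw.
      apply Rle_trans with
        ((Rabs h * Cmod q) ^ 2 / r ^ 2 * Rabs (Series v))%R.
      * apply Rmult_le_compat_l; [|apply Rle_abs].
        apply Rdiv_le_0_compat; [apply pow2_ge_0|apply pow_lt, Hr].
      * rewrite Rpow_mult_distr, pow2_abs; apply Req_le; field; lra.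
Qed.

(** * Exponentials and powers *)

Lemma exp_le_compat (x y : R) : (x <= y)%R -> (exp x <= exp y)%R.
Proof.
  intros [H| ->]; [left; now apply exp_increasing|apply Rle_refl].
Qed.

Lemma Cexp_plus (z w : C) : Cexp (z + w) = Cexp z * Cexp w.
Proof.
  unfold Cexp, Re, Im; apply C_ext; simpl; rewrite exp_plus, ?cos_plus, ?sin_plus; ring.
Qed.

Lemma Cexp_0 : Cexp 0 = 1.
Proof. unfold Cexp, Re, Im; apply C_ext; simpl; rewrite exp_0, ?cos_0, ?sin_0; ring. Qed.

Lemma Cmod_Cexp (z : C) : Cmod (Cexp z) = exp (Re z).
Proof.
  unfold Cmod, Cexp; simpl fst; simpl snd.
  replace (_ + _)%R with (exp (Re z) ^ 2 * (sin (Im z) ^ 2 + cos (Im z) ^ 2))%R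
    by ring.
  rewrite <- !Rsqr_pow2, sin2_cos2, Rmult_1_r, Rsqr_pow2.
  apply sqrt_pow2, Rlt_le, exp_pos.
Qed.

Lemma Cexp_neq_0 (z : C) : Cexp z <> 0.
Proof. apply Cmod_gt_0; rewrite Cmod_Cexp; apply exp_pos. Qed.

Lemma Cexp_opp (z : C) : Cexp (- z) = / Cexp z.
Proof.
  assert (E : Cexp (- z) * Cexp z = 1).
  { rewrite <- Cexp_plus; replace (- z + z) with (RtoC 0) by ring. apply Cexp_0. }
  rewrite <- (Cmult_1_r (Cexp (- z))), <- (Cinv_r (Cexp z)), Cmult_assoc, E;
    [ring|apply Cexp_neq_0].
Qed.

Lemma Cexp_RtoC (r : R) : Cexp r = exp r.
Proof. unfold Cexp, Re, Im; apply C_ext; simpl; rewrite ?cos_0, ?sin_0; ring. Qed.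

Lemma Cpower_neq_0 (z w : C) : Cpower z w <> 0.
Proof. apply Cexp_neq_0. Qed.

Lemma Cpower_plus (z w w' : C) : Cpower z (w + w') = Cpower z w * Cpower z w'.
Proof. unfold Cpower; rewrite <- Cexp_plus; f_equal; ring. Qed.

Lemma Cpower_opp (z w : C) : Cpower z (- w) = / Cpower z w.
Proof. unfold Cpower; rewrite <- Cexp_opp; f_equal; ring. Qed.

Lemma Clog_RtoC (r : R) : (0 < r)%R -> Clog r = ln r.
Proof.
  intros H; unfold Clog, Carg; simpl; rewrite Cmod_RtoC_nonneg by lra.
  destruct (Rlt_dec 0 0); [lra|].
  unfold Rdiv; rewrite Rinv_r, acos_1 by lra; reflexivity.
Qed.

Lemma Cpower_RtoC (r : R) (w : C) : (0 < r)%R -> Cpower r w = Cexp (w * ln r).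
Proof. intros; unfold Cpower; now rewrite Clog_RtoC. Qed.

Lemma Clog_scal (r : R) (z : C) : (0 < r)%R -> z <> 0 ->
  Clog (r * z) = ln r + Clog z.
Proof.
  intros Hr Hz; pose proof (proj1 (Cmod_gt_0 z) Hz) as Hm.
  unfold Clog; rewrite Cmod_mult, Cmod_RtoC_nonneg, ln_mult by lra.
  apply C_ext; simpl; [reflexivity|].
  rewrite Rplus_0_l; unfold Carg.
  rewrite re_scal_l, im_scal_l, Cmod_mult, Cmod_RtoC_nonneg by lra.
  replace (r * Re z / (r * Cmod z))%R with (Re z / Cmod z)%R by (field; lra).
  destruct (Rlt_dec (r * Im z) 0), (Rlt_dec (Im z) 0); try reflexivity; nra.
Qed.

Lemma Cpower_scal (r : R) (z w : C) : (0 < r)%R -> z <> 0 ->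
  Cpower (r * z) w = Cpower r w * Cpower z w.
Proof.
  intros; unfold Cpower; rewrite Clog_scal, Clog_RtoC, <- Cexp_plus by auto.
  f_equal; ring.
Qed.

(** The argument enters only through [|Carg z| <= PI], so the bound is the same at all points of a
    circle. *)
Lemma Cmod_Cpower_le (z w : C) : z <> 0 ->
  (Cmod (Cpower z w) <= exp (Re w * ln (Cmod z) + Rabs (Im w) * PI))%R.
Proof.
  intros Hz; unfold Cpower; rewrite Cmod_Cexp; apply exp_le_compat; simpl.
  apply Rplus_le_compat_l.
  pose proof (Carg_bounds z Hz) as Hb.
  eapply Rle_trans; [apply Rle_abs|].
  rewrite Rabs_Ropp, Rabs_mult.
  apply Rmult_le_compat_l; [apply Rabs_pos|apply Rabs_le; lra].
Qed.

Lemma Cmod_Cpower_RtoC (r : R) (w : C) : (0 < r)%R ->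
  Cmod (Cpower r w) = exp (Re w * ln r).
Proof.
  intros; rewrite Cpower_RtoC, Cmod_Cexp by auto; f_equal; unfold Re, Im; simpl; ring.
Qed.

(** * The Kummer function *)

Lemma pochhammer_left (a : C) (n : nat) :
  pochhammer a (S n) = a * pochhammer (a + 1) n.
Proof.
  induction n as [|n IH].
  - simpl; ring.
  - change (pochhammer a (S (S n))) with (pochhammer a (S n) * (a + INR (S n))).
    rewrite IH; cbn [pochhammer]; rewrite S_INR, RtoC_plus; ring.
Qed.

Lemma pochhammer_add (a : C) (m n : nat) :
  pochhammer a (m + n) = pochhammer a n * pochhammer (a + INR n) m.
Proof.
  induction m as [|m IH]; simpl; [ring|].
  rewrite IH, plus_INR, RtoC_plus; ring.
Qed.

Lemma add_INR_neq_0 (c : C) (n : nat) : ~ nonpos_integer c -> c + INR n <> 0.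
Proof.
  intros Hc E; apply Hc; exists n.
  replace c with (c + INR n - INR n) by ring; rewrite E; ring.
Qed.

Lemma RtoC_fact_neq_0 (n : nat) : RtoC (INR (fact n)) <> 0.
Proof. apply RtoC_neq_0; pose proof (INR_fact_pos n); lra. Qed.

Lemma RtoC_INR_S_neq_0 (n : nat) : RtoC (INR n) + 1 <> 0.
Proof.
  rewrite <- RtoC_plus; apply RtoC_neq_0; pose proof (pos_INR n); lra.
Qed.

Lemma pochhammer_neq_0 (c : C) (n : nat) :
  ~ nonpos_integer c -> pochhammer c n <> 0.
Proof.
  intros Hc; induction n; simpl; [apply C1_nz|].
  apply Cmult_neq_0; [exact IHn|now apply add_INR_neq_0].
Qed.

(** The successive ratios [(a + n) / (c + n)] have modulus at most 2 once [n >= |a| + 2 |c|]. Any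
    geometric growth is harmless after division by [n!]. *)
Lemma pochhammer_quotient_geometric (a c : C) : ~ nonpos_integer c ->
  exists D, (0 <= D)%R /\
    forall n, (Cmod (pochhammer a n / pochhammer c n) <= D * 2 ^ n)%R.
Proof.
  intros Hc; destruct (INR_unbounded (Cmod a + 2 * Cmod c)) as [n0 Hn0].
  destruct (geometric_bound
    (fun n => Cmod (pochhammer a n / pochhammer c n)) 2 n0)
    as [D [HD H]]; [lra| |].
  - intros n Hn; rewrite !Rabs_pos_eq by apply Cmod_ge_0.
    simpl; pose proof (pochhammer_neq_0 c n Hc); pose proof (add_INR_neq_0 c n Hc).
    replace (pochhammer a n * (a + INR n) / (pochhammer c n * (c + INR n)))
      with ((a + INR n) / (c + INR n) * (pochhammer a n / pochhammer c n))
      by (field; auto).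
    rewrite Cmod_mult; apply Rmult_le_compat_r; [apply Cmod_ge_0|].
    rewrite Cmod_div by auto.
    pose proof (proj1 (Cmod_gt_0 _) H0).
    apply Rle_div_l; [lra|].
    apply le_INR in Hn.
    pose proof (Cmod_triangle a (INR n)).
    pose proof (Cmod_ge_sub (INR n) c).
    rewrite Cplus_comm in H3.
    rewrite Cmod_RtoC_nonneg in H2, H3 by apply pos_INR; lra.
  - exists D; split; [exact HD|]; intros n; specialize (H n).
    now rewrite Rabs_pos_eq in H by apply Cmod_ge_0.
Qed.

Lemma pow_div_fact_bounded (x : R) : (0 <= x)%R ->
  exists D, (0 <= D)%R /\ forall n, (x ^ n / INR (fact n) <= D)%R.
Proof.
  intros Hx; destruct (INR_unbounded x) as [n0 Hn0].
  destruct (geometric_bound (fun n => x ^ n / INR (fact n))%R 1 n0)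
    as [D [HD H]]; [lra| |].
  - intros n Hn; apply le_INR in Hn.
    pose proof (INR_fact_pos n); pose proof (pos_INR n).
    assert (0 <= x ^ n / INR (fact n))%R
      by (apply Rdiv_le_0_compat; [apply pow_le|]; lra).
    replace (x ^ S n / INR (fact (S n)))%R
      with (x / INR (S n) * (x ^ n / INR (fact n)))%R.
    2: { rewrite fact_simpl, mult_INR; simpl pow; field.
         rewrite S_INR; lra. }
    rewrite Rabs_mult; apply Rmult_le_compat_r; [apply Rabs_pos|].
    rewrite S_INR, Rabs_pos_eq by (apply Rdiv_le_0_compat; lra).
    apply Rle_div_l; lra.
  - exists D; split; [exact HD|]; intros n; specialize (H n).
    rewrite pow1 in H; eapply Rle_trans; [apply Rle_abs|lra].
Qed.

(** [CPS (egf d)] is the exponential generating function of [d]. The Kummer function, the binomial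
    series and the exponential are all treated in this form. *)
Definition egf (d : nat -> C) (n : nat) : C := d n / INR (fact n).

Lemma geo_egf (d : nat -> C) (D q rho : R) : (0 <= q)%R -> (0 <= rho)%R ->
  (forall n, Cmod (d n) <= D * q ^ n)%R -> geo (egf d) rho.
Proof.
  intros Hq Hr H.
  destruct (pow_div_fact_bounded (q * rho)) as [D' [HD' H']].
  { now apply Rmult_le_pos. }
  assert (HD : (0 <= D)%R).
  { specialize (H O); simpl in H; pose proof (Cmod_ge_0 (d O)); lra. }
  exists (D * D')%R; intros n; unfold egf.
  pose proof (INR_fact_pos n).
  rewrite Cmod_div_R by auto.
  apply Rle_trans with (D * ((q * rho) ^ n / INR (fact n)))%R.
  - rewrite Rpow_mult_distr.
    replace (D * (q ^ n * rho ^ n / INR (fact n)))%R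
      with (D * q ^ n / INR (fact n) * rho ^ n)%R by (field; lra).
    apply Rmult_le_compat_r; [now apply pow_le|].
    apply Rmult_le_compat_r; [|apply H].
    apply Rlt_le, Rinv_0_lt_compat; lra.
  - apply Rmult_le_compat_l; auto.
Qed.

Definition kcoef (a c : C) : nat -> C :=
  egf (fun n => pochhammer a n / pochhammer c n).

Definition kummer (a c z : C) : C := CPS (kcoef a c) z.

Lemma geo_kcoef (a c : C) (rho : R) : ~ nonpos_integer c -> (0 <= rho)%R ->
  geo (kcoef a c) rho.
Proof.
  intros Hc Hr; destruct (pochhammer_quotient_geometric a c Hc) as [D [HD H]].
  apply geo_egf with D 2%R; auto; lra.
Qed.

(** The factor [n + 1] produced by differentiation is absorbed by a larger radius, since
    [(n + 1) rho^n <= (2 rho + 1)^n]; this is why the hypothesis concerns all radii. *)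
Lemma geo_cderiv (u : nat -> C) :
  (forall rho, (0 <= rho)%R -> geo u rho) ->
  forall rho, (0 <= rho)%R -> geo (cderiv u) rho.
Proof.
  intros H rho Hr.
  destruct (H (2 * rho + 1)%R ltac:(lra)) as [D HD].
  exists D; intros n; unfold cderiv; eapply Rle_trans; [|apply (HD (S n))].
  rewrite Cmod_mult, Cmod_RtoC_nonneg by apply pos_INR.
  replace (INR (S n) * Cmod (u (S n)) * rho ^ n)%R
    with (Cmod (u (S n)) * (INR (S n) * rho ^ n))%R by ring.
  apply Rmult_le_compat_l; [apply Cmod_ge_0|].
  assert (Hn : forall m, (INR (S m) * rho ^ m <= (2 * rho + 1) ^ m)%R).
  { induction m as [|m IH]; [simpl; lra|].
    assert (0 <= rho ^ m)%R by (apply pow_le; lra).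
    assert (1 <= INR (S m))%R by (rewrite S_INR; pose proof (pos_INR m); lra).
    rewrite (S_INR (S m)).
    replace ((2 * rho + 1) ^ S m)%R
      with ((2 * rho + 1) * (2 * rho + 1) ^ m)%R by reflexivity.
    replace (rho ^ S m)%R with (rho * rho ^ m)%R by reflexivity.
    apply Rle_trans with ((2 * rho + 1) * (INR (S m) * rho ^ m))%R.
    - assert (0 <= rho * rho ^ m)%R by (apply Rmult_le_pos; lra).
      assert (0 <= INR (S m) * rho ^ m)%R by (apply Rmult_le_pos; lra).
      assert (rho * rho ^ m <= INR (S m) * (rho * rho ^ m))%R by nra.
      nra.
    - apply Rmult_le_compat_l; lra. }
  eapply Rle_trans; [apply Hn|].
  simpl; rewrite <- (Rmult_1_l ((2 * rho + 1) ^ n)) at 1.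
  apply Rmult_le_compat_r; [apply pow_le|]; lra.
Qed.

Lemma geo_cshift (u : nat -> C) (rho : R) : (0 <= rho)%R ->
  geo u rho -> geo (cshift u) rho.
Proof.
  intros Hr [D HD]; exists (rho * D)%R.
  assert (0 <= D)%R.
  { eapply Rle_trans; [|apply (HD O)]; simpl; rewrite Rmult_1_r.
    apply Cmod_ge_0. }
  intros [|n]; simpl.
  - rewrite Cmod_0, Rmult_0_l; now apply Rmult_le_pos.
  - replace (Cmod (u n) * (rho * rho ^ n))%R
      with (rho * (Cmod (u n) * rho ^ n))%R by ring.
    now apply Rmult_le_compat_l.
Qed.

Lemma geo_plus (u v : nat -> C) (rho : R) : (0 <= rho)%R ->
  geo u rho -> geo v rho -> geo (fun n => u n + v n) rho.
Proof.
  intros Hr [D HD] [D' HD']; exists (D + D')%R; intros n.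
  specialize (HD n); specialize (HD' n).
  pose proof (pow_le rho n Hr); pose proof (Cmod_triangle (u n) (v n)); nra.
Qed.

Lemma geo_scal (k : C) (u : nat -> C) (rho : R) :
  geo u rho -> geo (fun n => k * u n) rho.
Proof.
  intros [D HD]; exists (Cmod k * D)%R; intros n.
  rewrite Cmod_mult, Rmult_assoc.
  apply Rmult_le_compat_l; [apply Cmod_ge_0|auto].
Qed.

Lemma kcoef_S (a c : C) (n : nat) : ~ nonpos_integer c ->
  kcoef a c (S n) = (a + INR n) / ((c + INR n) * (INR n + 1)) * kcoef a c n.
Proof.
  intros Hc; unfold kcoef, egf; cbn [pochhammer].
  rewrite fact_simpl, mult_INR, S_INR, RtoC_mult, RtoC_plus.
  field; repeat split; auto using RtoC_fact_neq_0, RtoC_INR_S_neq_0,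
    add_INR_neq_0, pochhammer_neq_0.
Qed.

Lemma kcoef_pred_S (a c : C) (n : nat) : ~ nonpos_integer c ->
  kcoef (a - 1) c (S n) =
  (a - 1) / ((c + INR n) * (INR n + 1)) * kcoef a c n.
Proof.
  intros Hc; unfold kcoef, egf; rewrite pochhammer_left.
  replace (a - 1 + 1) with a by ring; cbn [pochhammer].
  rewrite fact_simpl, mult_INR, S_INR, RtoC_mult, RtoC_plus.
  field; repeat split; auto using RtoC_fact_neq_0, RtoC_INR_S_neq_0,
    add_INR_neq_0, pochhammer_neq_0.
Qed.

Lemma kcoef_0 (a c : C) : kcoef a c O = 1.
Proof. unfold kcoef, egf; simpl; field; apply C1_nz. Qed.

(** A contiguous relation, checked coefficient by coefficient. With [kummer_pred_deriv_identity] it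
    closes a first order system on [M(a)] and [M(a - 1)], which replaces Kummer's second order
    equation. *)
Lemma kummer_deriv_identity (a c z : C) : ~ nonpos_integer c ->
  z * CPS (cderiv (kcoef a c)) z =
  (c - a) * kummer (a - 1) c z + (z + a - c) * kummer a c z.
Proof.
  intros Hc; set (rho := (Cmod z + 1)%R).
  assert (Hr : (0 <= rho)%R) by (unfold rho; pose proof (Cmod_ge_0 z); lra).
  assert (Hz : (Cmod z < rho)%R) by (unfold rho; lra).
  assert (G : forall a', geo (kcoef a' c) rho)
    by (intros; now apply geo_kcoef).
  transitivity (CPS (fun n => ((c - a) * kcoef (a - 1) c n
    + cshift (kcoef a c) n) + (a - c) * kcoef a c n) z).
  - rewrite <- (CPS_cshift _ _ rho Hz)
      by (apply geo_cderiv; auto; intros; now apply geo_kcoef).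
    apply CPS_ext; intros [|n]; unfold cderiv; cbn [cshift].
    + rewrite !kcoef_0; ring.
    + rewrite (kcoef_S a c), kcoef_pred_S by exact Hc.
      rewrite S_INR, RtoC_plus; field;
        auto using RtoC_INR_S_neq_0, add_INR_neq_0.
  - rewrite (CPS_plus _ _ z rho Hz), (CPS_plus _ _ z rho Hz),
      !(CPS_scal _ _ z rho Hz), (CPS_cshift _ z rho Hz);
      auto using geo_plus, geo_scal, geo_cshift.
    unfold kummer; ring.
Qed.

Lemma kummer_pred_deriv_identity (a c z : C) : ~ nonpos_integer c ->
  z * CPS (cderiv (kcoef (a - 1) c)) z =
  (a - 1) * (kummer a c z - kummer (a - 1) c z).
Proof.
  intros Hc; set (rho := (Cmod z + 1)%R).
  assert (Hr : (0 <= rho)%R) by (unfold rho; pose proof (Cmod_ge_0 z); lra).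
  assert (Hz : (Cmod z < rho)%R) by (unfold rho; lra).
  assert (G : forall a', geo (kcoef a' c) rho)
    by (intros; now apply geo_kcoef).
  transitivity (CPS (fun n => (a - 1) * kcoef a c n
    + - (a - 1) * kcoef (a - 1) c n) z).
  - rewrite <- (CPS_cshift _ _ rho Hz)
      by (apply geo_cderiv; auto; intros; now apply geo_kcoef).
    apply CPS_ext; intros [|n]; unfold cderiv; cbn [cshift].
    + rewrite !kcoef_0; ring.
    + rewrite (kcoef_S a c), kcoef_pred_S by exact Hc.
      rewrite S_INR, RtoC_plus; field;
        auto using RtoC_INR_S_neq_0, add_INR_neq_0.
  - rewrite (CPS_plus _ _ z rho Hz), !(CPS_scal _ _ z rho Hz);
      auto using geo_scal.
    unfold kummer; ring.
Qed.

(* [knorm (c - a) a c] tends to [CGamma c / CGamma a] at infinity in the cones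
   below, while [knorm (c - a) (a - 1) c] tends to 0. *)
Definition knorm (al a c z : C) : C := Cpower z al * Cexp (- z) * kummer a c z.

Lemma is_derC_knorm (al a c p q : C) (s : R) : ~ nonpos_integer c ->
  (0 < Re (p + RtoC s * q))%R ->
  is_derC (fun t => knorm al a c (p + RtoC t * q)) s
    (q * (al / (p + RtoC s * q) - 1) * knorm al a c (p + RtoC s * q)
     + q * (Cpower (p + RtoC s * q) al * Cexp (- (p + RtoC s * q))
       * CPS (cderiv (kcoef a c)) (p + RtoC s * q))).
Proof.
  intros Hc Hz; unfold knorm, kummer.
  pose proof (is_derC_line p q s) as HL.
  assert (HL' : is_derC (fun t => - (p + RtoC t * q)) s (- q)).
  { refine (is_derC_ext _ _ _ _ _ _ _ (is_derC_scal (- (1)) _ _ _ HL));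
      intros; ring. }
  assert (G : geo (kcoef a c) (Cmod (p + RtoC s * q) + 1)).
  { apply geo_kcoef; auto; pose proof (Cmod_ge_0 (p + RtoC s * q)); lra. }
  refine (is_derC_ext _ _ _ _ _ (fun t => eq_refl) _ (is_derC_mult _ _ _ _ _
    (is_derC_mult _ _ _ _ _ (is_derC_Cpower _ al s _ Hz HL)
      (is_derC_Cexp _ _ _ HL')) (is_derC_CPS _ _ p q s G ltac:(lra)))).
  field; intros E; rewrite E in Hz; simpl in Hz; lra.
Qed.

(** The exponent [c - a] and the factor [exp (- z)] are chosen to cancel the term [(z + a - c) M(a)]
    of [kummer_deriv_identity]. What remains is the coupling with [M(a - 1)], divided by [z]. *)
Lemma is_derC_knorm_top (a c p q : C) (s : R) : ~ nonpos_integer c ->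
  (0 < Re (p + RtoC s * q))%R ->
  is_derC (fun t => knorm (c - a) a c (p + RtoC t * q)) s
    (q * ((c - a) * knorm (c - a) (a - 1) c (p + RtoC s * q)
      / (p + RtoC s * q))).
Proof.
  intros Hc Hz.
  refine (is_derC_ext _ _ _ _ _ (fun t => eq_refl) _
    (is_derC_knorm _ _ _ _ _ _ Hc Hz)).
  set (z := p + RtoC s * q) in *.
  assert (Hz0 : z <> 0) by (intros E; rewrite E in Hz; simpl in Hz; lra).
  replace (CPS (cderiv (kcoef a c)) z) with
    (/ z * (z * CPS (cderiv (kcoef a c)) z)) by (field; auto).
  rewrite kummer_deriv_identity by exact Hc.
  unfold knorm; field; auto.
Qed.

(** Here the derivative of [exp (- z)] is not compensated: it leaves the undivided term with
    coefficient -1, which is the damping used by the energy estimate. *)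
Lemma is_derC_knorm_sub (a c p q : C) (s : R) : ~ nonpos_integer c ->
  (0 < Re (p + RtoC s * q))%R ->
  is_derC (fun t => knorm (c - a) (a - 1) c (p + RtoC t * q)) s
    (q * (- knorm (c - a) (a - 1) c (p + RtoC s * q) +
      ((c - a - a + 1) * knorm (c - a) (a - 1) c (p + RtoC s * q)
       + (a - 1) * knorm (c - a) a c (p + RtoC s * q)) / (p + RtoC s * q))).
Proof.
  intros Hc Hz.
  refine (is_derC_ext _ _ _ _ _ (fun t => eq_refl) _
    (is_derC_knorm _ _ _ _ _ _ Hc Hz)).
  set (z := p + RtoC s * q) in *.
  assert (Hz0 : z <> 0) by (intros E; rewrite E in Hz; simpl in Hz; lra).
  replace (CPS (cderiv (kcoef (a - 1) c)) z) with
    (/ z * (z * CPS (cderiv (kcoef (a - 1) c)) z)) by (field; auto).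
  rewrite kummer_pred_deriv_identity by exact Hc.
  unfold knorm; field; auto.
Qed.

(** * Boundedness and variation of the normalised Kummer functions in cones *)

Lemma is_derC_Cmod_sqr (f : R -> C) (s : R) (l : C) : is_derC f s l ->
  is_derive (fun t => Cmod (f t) ^ 2)%R s (2 * Re (Cconj (f s) * l))%R.
Proof.
  intros [H1 H2].
  assert (E : forall t : R, (Re (f t) * Re (f t) + Im (f t) * Im (f t)
    = Cmod (f t) ^ 2)%R) by (intros t; rewrite Cmod2_alt; ring).
  apply (is_derive_ext _ _ _ _ E).
  evar_last; [apply (is_derive_plus (V := R_NormedModule));
    apply Derive.is_derive_mult; eassumption|].
  unfold plus, Re, Im in *; simpl; ring.
Qed.

Lemma Re_Cconj_mult_le (z w : C) : (Re (Cconj z * w) <= Cmod z * Cmod w)%R.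
Proof.
  rewrite <- (Cmod_conj z), <- Cmod_mult.
  eapply Rle_trans; [apply Rle_abs|apply re_le_Cmod].
Qed.

(* [Q] is damped by [- e], so that [V' = al Q / r] is integrable: the energy
   [E = |V|^2 + |Q|^2] satisfies [E' <= Gamma E / r^2]. *)
Lemma damped_system_energy (V Q : R -> C) (e al la mu : C) (kappa r0 : R) :
  (0 < kappa)%R -> (kappa <= Re e)%R -> (0 < r0)%R ->
  (2 * Cmod la <= kappa * r0)%R ->
  (forall r, r0 <= r -> is_derC V r (al * Q r / r))%R ->
  (forall r, r0 <= r ->
     is_derC Q r (- e * Q r + (la * Q r + mu * V r) / r))%R ->
  forall r, (r0 <= r)%R ->
    (Cmod (V r) ^ 2 + Cmod (Q r) ^ 2 <=
     (Cmod (V r0) ^ 2 + Cmod (Q r0) ^ 2)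
       * exp ((Cmod al + Cmod mu) ^ 2 / kappa / r0))%R.
Proof.
  intros Hk He Hr0 Hla HV HQ r Hr.
  set (Gam := ((Cmod al + Cmod mu) ^ 2 / kappa)%R).
  assert (HG : (0 <= Gam)%R)
    by (apply Rdiv_le_0_compat; [apply pow2_ge_0|lra]).
  set (E := fun t => (Cmod (V t) ^ 2 + Cmod (Q t) ^ 2)%R).
  set (E' := fun t => (2 * Re (Cconj (V t) * (al * Q t / t)) +
    2 * Re (Cconj (Q t) * (- e * Q t + (la * Q t + mu * V t) / t)))%R).
  assert (HE : forall t, (r0 <= t)%R -> is_derive E t (E' t)).
  { intros t Ht; apply (is_derive_plus (V := R_NormedModule));
      apply is_derC_Cmod_sqr; [apply HV|apply HQ]; exact Ht. }
  assert (HEb : forall t, (r0 <= t)%R -> (E' t <= Gam * E t / t ^ 2)%R).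
  { intros t Ht; unfold E', E.
    set (i := (/ t)%R); assert (Hi : (0 < i)%R) by (apply Rinv_0_lt_compat; lra).
    assert (Hit : (i * t = 1)%R) by (unfold i; apply Rinv_l; lra).
    pose proof (Cmod_ge_0 (V t)) as Hx; pose proof (Cmod_ge_0 (Q t)) as Hy.
    set (x := Cmod (V t)) in *; set (y := Cmod (Q t)) in *.
    assert (H1 : (Re (Cconj (V t) * (al * Q t / t)) <= x * (Cmod al * y * i))%R).
    { eapply Rle_trans; [apply Re_Cconj_mult_le|].
      rewrite Cmod_div_R, Cmod_mult by lra; apply Rle_refl. }
    assert (H2 : (Re (Cconj (Q t) * (- e * Q t + (la * Q t + mu * V t) / t))
      <= - kappa * y ^ 2 + y * ((Cmod la * y + Cmod mu * x) * i))%R).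
    { replace (Cconj (Q t) * (- e * Q t + (la * Q t + mu * V t) / t)) with
        (- (e * (Cconj (Q t) * Q t)) + Cconj (Q t) * ((la * Q t + mu * V t) / t))
        by ring.
      rewrite (Cmult_comm (Cconj (Q t)) (Q t)), <- Cmod2_conj.
      replace (Re (- (e * RtoC (Cmod (Q t) ^ 2)) +
        Cconj (Q t) * ((la * Q t + mu * V t) / t))) with
        (- Re e * y ^ 2 + Re (Cconj (Q t) * ((la * Q t + mu * V t) / t)))%R.
      2: { unfold y; generalize (Cconj (Q t) * ((la * Q t + mu * V t) / t));
           generalize (Cmod (Q t) ^ 2)%R; intros; unfold Re; simpl; ring. }
      apply Rplus_le_compat.
      - pose proof (pow2_ge_0 y); nra.
      - eapply Rle_trans; [apply Re_Cconj_mult_le|].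
        apply Rmult_le_compat_l; [exact Hy|].
        rewrite Cmod_div_R by lra; apply Rmult_le_compat_r; [exact (Rlt_le _ _ Hi)|].
        eapply Rle_trans; [apply Cmod_triangle|]; rewrite !Cmod_mult; apply Rle_refl. }
    (* The damping contributes [- 2 kappa y^2] to [E']: one half absorbs the [la] term through this
       inequality, the other half absorbs the cross term in [H4]. *)
    assert (H3 : (2 * Cmod la * i <= kappa)%R).
    { apply Rmult_le_reg_r with t; [lra|].
      rewrite Rmult_assoc, Hit; nra. }
    set (B := (Cmod al + Cmod mu)%R).
    (* Twice the product of [kappa y] and [B x i] is at most the sum of their squares;
       [Gam = B^2 / kappa] is the constant that results. *)
    assert (H4 : (2 * B * x * y * i <= kappa * y ^ 2 + Gam * x ^ 2 * i ^ 2)%R).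
    { apply Rmult_le_reg_l with kappa; [exact Hk|].
      replace (kappa * (kappa * y ^ 2 + Gam * x ^ 2 * i ^ 2))%R with
        ((kappa * y) ^ 2 + (B * x * i) ^ 2)%R by (unfold Gam, B; field; lra).
      pose proof (pow2_ge_0 (kappa * y - B * x * i)); nra. }
    replace (Gam * (x ^ 2 + y ^ 2) / t ^ 2)%R with
      (Gam * x ^ 2 * i ^ 2 + Gam * y ^ 2 * i ^ 2)%R by (unfold i; field; lra).
    assert (0 <= Gam * y ^ 2 * i ^ 2)%R
      by (apply Rmult_le_pos; [apply Rmult_le_pos; [exact HG|]|];
          apply pow2_ge_0).
    assert (2 * Cmod la * i * y ^ 2 <= kappa * y ^ 2)%R
      by (apply Rmult_le_compat_r; [apply pow2_ge_0|lra]).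
    unfold B in H4; nra. }
  (* Gronwall's argument with the integrable weight [Gam / t^2]: multiplication by [exp (Gam / t)]
     makes the energy nonincreasing. *)
  set (G := fun t => (E t * exp (Gam / t))%R).
  assert (HGd : forall t, (r0 <= t)%R -> is_derive G t
    (E' t * exp (Gam / t) + E t * (- Gam / t ^ 2 * exp (Gam / t)))%R).
  { intros t Ht; apply (Derive.is_derive_mult E (fun t => exp (Gam / t)));
      [now apply HE|].
    auto_derive; [lra|]; change (Gam * / t)%R with (Gam / t)%R; field; lra. }
  assert (HGr : (G r <= G r0)%R).
  { destruct (MVT_gen G r0 r (fun t => E' t * exp (Gam / t)
      + E t * (- Gam / t ^ 2 * exp (Gam / t)))%R) as [t [Ht Heq]].
    - rewrite Rmin_left, Rmax_right by lra; intros; apply HGd; lra.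
    - rewrite Rmin_left, Rmax_right by lra; intros t Ht.
      apply derivable_continuous_pt; eexists; apply is_derive_Reals, HGd; lra.
    - rewrite Rmin_left, Rmax_right in Ht by lra.
      specialize (HEb t ltac:(lra)).
      replace (E' t * exp (Gam / t) + E t * (- Gam / t ^ 2 * exp (Gam / t)))%R
        with (- ((Gam * E t / t ^ 2 - E' t) * exp (Gam / t)))%R in Heq
        by (field; lra).
      pose proof (exp_pos (Gam / t)).
      assert (0 <= (Gam * E t / t ^ 2 - E' t) * exp (Gam / t))%R
        by (apply Rmult_le_pos; lra).
      nra. }
  unfold G in HGr; eapply Rle_trans; [|exact HGr].
  fold (E r); rewrite <- (Rmult_1_r (E r)) at 1.
  apply Rmult_le_compat_l.
  - unfold E; pose proof (pow2_ge_0 (Cmod (V r)));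
      pose proof (pow2_ge_0 (Cmod (Q r))); lra.
  - rewrite <- exp_0; apply exp_le_compat, Rdiv_le_0_compat; lra.
Qed.

Definition cone (kappa : R) (z : C) : Prop := (kappa * Cmod z <= Re z)%R.

Lemma cone_Re_pos (kappa : R) (z : C) : (0 < kappa)%R -> cone kappa z ->
  (0 < Cmod z)%R -> (0 < Re z)%R.
Proof.
  unfold cone; intros Hk Hz Hm.
  apply Rlt_le_trans with (kappa * Cmod z)%R; [now apply Rmult_lt_0_compat|lra].
Qed.

(** A termwise majorant is good enough on a single circle. It provides starting values for the
    energy estimate that are uniform in the direction of the ray. *)
Lemma knorm_circle_bound (al a c : C) (kappa r : R) : ~ nonpos_integer c ->
  (0 < kappa)%R -> (0 < r)%R ->
  exists D, (0 <= D)%R /\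
    forall z, cone kappa z -> Cmod z = r -> (Cmod (knorm al a c z) <= D)%R.
Proof.
  intros Hc Hk Hr.
  set (S := Series (fun n => Cmod (kcoef a c n) * r ^ n)%R).
  assert (HS : ex_series (fun n => Cmod (kcoef a c n) * r ^ n)%R).
  { apply geo_summable_R with (r + 1)%R; [lra|apply geo_kcoef; auto; lra]. }
  exists (exp (Re al * ln r + Rabs (Im al) * PI) * 1 * Rabs S)%R.
  split.
  { repeat apply Rmult_le_pos; try apply Rabs_pos; try lra.
    apply Rlt_le, exp_pos. }
  intros z Hz Hm; unfold knorm; rewrite !Cmod_mult.
  assert (z <> 0) by (apply Cmod_gt_0; lra).
  apply Rmult_le_compat; [|apply Cmod_ge_0| |].
  - apply Rmult_le_pos; apply Cmod_ge_0.
  - apply Rmult_le_compat; try apply Cmod_ge_0.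
    + rewrite <- Hm; now apply Cmod_Cpower_le.
    + rewrite Cmod_Cexp, <- exp_0; apply exp_le_compat.
      pose proof (cone_Re_pos kappa z Hk Hz ltac:(lra)).
      unfold Re in *; simpl; lra.
  - eapply Rle_trans; [|apply Rle_abs]; apply CSeries_bound; [|exact HS].
    intros n; rewrite Cmod_mult, Cmod_pow, Hm; lra.
Qed.

Lemma knorm_bounded (a c : C) (kappa : R) : ~ nonpos_integer c ->
  (0 < kappa)%R ->
  exists r0 K, (0 < r0)%R /\ (0 <= K)%R /\
    forall z, cone kappa z -> (r0 <= Cmod z)%R ->
      (Cmod (knorm (c - a) a c z) <= K)%R /\
      (Cmod (knorm (c - a) (a - 1) c z) <= K)%R.
Proof.
  intros Hc Hk.
  set (al := c - a); set (la := al - a + 1); set (mu := a - 1).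
  (* Chosen so that [2 |la| <= kappa r0], the condition under which the damping dominates. *)
  set (r0 := (2 * Cmod la / kappa + 1)%R).
  assert (Hr0 : (0 < r0)%R).
  { unfold r0; pose proof (Cmod_ge_0 la).
    assert (0 <= 2 * Cmod la / kappa)%R by (apply Rdiv_le_0_compat; lra); lra. }
  destruct (knorm_circle_bound al a c kappa r0 Hc Hk Hr0) as [D1 [HD1 H1]].
  destruct (knorm_circle_bound al (a - 1) c kappa r0 Hc Hk Hr0) as [D2 [HD2 H2]].
  set (X := ((D1 ^ 2 + D2 ^ 2) * exp ((Cmod al + Cmod mu) ^ 2 / kappa / r0))%R).
  assert (HX : (0 <= X)%R).
  { apply Rmult_le_pos; [|apply Rlt_le, exp_pos].
    pose proof (pow2_ge_0 D1); pose proof (pow2_ge_0 D2); lra. }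
  exists r0, (sqrt X); split; [exact Hr0|]; split; [apply sqrt_pos|].
  intros z Hz Hm.
  set (r := Cmod z) in *.
  assert (Hr : (0 < r)%R) by lra.
  assert (Hrc : RtoC r <> 0) by (apply RtoC_neq_0; lra).
  set (e := z / r).
  assert (Ez : z = 0 + RtoC r * e) by (unfold e; field; auto).
  assert (Hem : Cmod e = 1%R)
    by (unfold e; rewrite Cmod_div_R by lra; fold r; field; lra).
  assert (He0 : e <> 0) by (apply Cmod_gt_0; lra).
  assert (Hek : (kappa <= Re e)%R).
  { unfold cone in Hz; fold r in Hz; rewrite Ez, Cplus_0_l, re_scal_l in Hz; nra. }
  assert (Hray : forall t, (0 < t)%R -> (0 < Re (0 + RtoC t * e))%R).
  { intros t Ht; rewrite Cplus_0_l, re_scal_l; apply Rmult_lt_0_compat; lra. }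
  pose proof (damped_system_energy
    (fun t => knorm al a c (0 + RtoC t * e))
    (fun t => knorm al (a - 1) c (0 + RtoC t * e)) e al la mu kappa r0
    Hk Hek Hr0) as HE.
  assert (HX' : (Cmod (knorm al a c z) ^ 2 + Cmod (knorm al (a - 1) c z) ^ 2
    <= X)%R).
  { rewrite Ez.
    eapply Rle_trans; [apply HE; [| | |exact Hm]|].
    - unfold r0; rewrite Rmult_plus_distr_l.
      replace (kappa * (2 * Cmod la / kappa))%R with (2 * Cmod la)%R
        by (field; lra); lra.
    - intros t Ht.
      assert (RtoC t <> 0) by (apply RtoC_neq_0; lra).
      refine (is_derC_ext _ _ _ _ _ (fun t => eq_refl) _
        (is_derC_knorm_top a c 0 e t Hc (Hray t ltac:(lra)))).
      fold al; rewrite Cplus_0_l; field; auto using Cmult_neq_0.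
    - intros t Ht.
      assert (RtoC t <> 0) by (apply RtoC_neq_0; lra).
      refine (is_derC_ext _ _ _ _ _ (fun t => eq_refl) _
        (is_derC_knorm_sub a c 0 e t Hc (Hray t ltac:(lra)))).
      fold al; fold la; fold mu; rewrite Cplus_0_l; field;
        auto using Cmult_neq_0.
    - apply Rmult_le_compat_r; [apply Rlt_le, exp_pos|].
      assert (Hc0 : cone kappa (0 + RtoC r0 * e) /\ Cmod (0 + RtoC r0 * e) = r0).
      { unfold cone; rewrite Cplus_0_l, Cmod_mult, re_scal_l,
          Cmod_RtoC_nonneg, Hem by lra; split; [nra|lra]. }
      destruct Hc0 as [Hc1 Hc2].
      pose proof (Cmod_ge_0 (knorm al a c (0 + RtoC r0 * e))).
      pose proof (Cmod_ge_0 (knorm al (a - 1) c (0 + RtoC r0 * e))).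
      apply Rplus_le_compat; apply pow_incr; auto. }
  pose proof (pow2_ge_0 (Cmod (knorm al a c z))).
  pose proof (pow2_ge_0 (Cmod (knorm al (a - 1) c z))).
  unfold mu; split; (rewrite <- (sqrt_pow2 (Cmod _)) by apply Cmod_ge_0);
    apply sqrt_le_1_alt; lra.
Qed.

(** The segment from [|z|] to [z] stays in the cone, which is convex, and at distance at least
    [kappa |z|] from 0. The function [Q] is only known to be bounded and the segment may have length
    of order [|z|], so integrating [al Q / z] along it directly would give [O (1)]; the correction
    in [W] gains one order. *)
Lemma knorm_chord (a c : C) (kappa : R) : ~ nonpos_integer c ->
  (0 < kappa <= 1)%R ->
  exists r1 K, (0 < r1)%R /\ (0 <= K)%R /\
    forall z, cone kappa z -> (r1 <= Cmod z)%R ->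
      (Cmod (knorm (c - a) a c z - knorm (c - a) a c (RtoC (Cmod z)))
       <= K / Cmod z)%R.
Proof.
  intros Hc [Hk Hk1].
  destruct (knorm_bounded a c kappa Hc Hk) as [r0 [K [Hr0 [HK Hb]]]].
  set (al := c - a) in *; set (la := al - a + 1); set (mu := a - 1).
  set (A := (Cmod al * ((Cmod (la - 1) + Cmod mu) * K))%R).
  assert (HA : (0 <= A)%R).
  { repeat apply Rmult_le_pos; try apply Cmod_ge_0; auto.
    pose proof (Cmod_ge_0 (la - 1)); pose proof (Cmod_ge_0 mu); lra. }
  (* The chord may come as close to 0 as [kappa |z|], which must still be at least [r0]. In the
     bound, [4 A / kappa^2] comes from the variation of [W] and [2 |al| K] from the corrections at
     both ends. *)
  exists (r0 / kappa)%R, (4 * A / kappa ^ 2 + 2 * Cmod al * K)%R.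
  assert (Hk2 : (0 < kappa ^ 2)%R) by (apply pow_lt; lra).
  split; [apply Rdiv_lt_0_compat; lra|]; split.
  { apply Rplus_le_le_0_compat; [apply Rdiv_le_0_compat; lra|].
    pose proof (Cmod_ge_0 al); repeat apply Rmult_le_pos; lra. }
  intros z Hz Hm; set (r := Cmod z) in *.
  assert (Hrr : (r0 <= kappa * r)%R).
  { apply Rmult_le_compat_l with (r := kappa) in Hm; [|lra].
    replace (kappa * (r0 / kappa))%R with r0 in Hm by (field; lra); lra. }
  assert (Hr : (0 < r)%R) by nra.
  assert (Hr01 : (r0 <= r)%R) by nra.
  set (q := z - RtoC r).
  set (l := fun s : R => RtoC r + RtoC s * q).
  assert (Hl0 : l 0%R = RtoC r) by (unfold l; ring).
  assert (Hl1 : l 1%R = z) by (unfold l, q; ring).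
  assert (Hq : (Cmod q <= 2 * r)%R).
  { unfold q; eapply Rle_trans; [apply Cmod_sub_triangle|].
    rewrite Cmod_RtoC_nonneg by lra; fold r; lra. }
  unfold cone in Hz; fold r in Hz.
  assert (Hl : forall s, (0 <= s <= 1)%R ->
    cone kappa (l s) /\ (kappa * r <= Re (l s))%R).
  { intros s Hs.
    assert (E : l s = RtoC (1 - s) * RtoC r + RtoC s * z)
      by (unfold l, q; rewrite RtoC_minus; ring).
    assert (Ere : Re (l s) = ((1 - s) * r + s * Re z)%R).
    { rewrite E; unfold Re; simpl; ring. }
    assert (Em : (Cmod (l s) <= r)%R).
    { rewrite E; eapply Rle_trans; [apply Cmod_triangle|].
      rewrite !Cmod_mult, !Cmod_RtoC_nonneg by lra; fold r; nra. }
    assert (Hx : (kappa * r <= (1 - s) * r + s * Re z)%R).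
    { assert (s * (kappa * r) <= s * Re z)%R by (apply Rmult_le_compat_l; lra).
      assert ((1 - s) * (kappa * r) <= (1 - s) * r)%R
        by (apply Rmult_le_compat_l; nra).
      lra. }
    unfold cone; rewrite Ere; split; [nra|exact Hx]. }
  assert (Hlm : forall s, (0 <= s <= 1)%R -> (kappa * r <= Cmod (l s))%R).
  { intros s Hs; destruct (Hl s Hs) as [_ H].
    eapply Rle_trans; [exact H|]; eapply Rle_trans; [apply Rle_abs|].
    apply re_le_Cmod. }
  assert (Hl_pos : forall s, (0 <= s <= 1)%R -> (0 < Re (l s))%R).
  { intros s Hs; destruct (Hl s Hs) as [_ H]; nra. }
  assert (Hl_nz : forall s, (0 <= s <= 1)%R -> l s <> 0).
  { intros s Hs; apply Cmod_gt_0; specialize (Hlm s Hs); nra. }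
  set (V := fun s => knorm al a c (l s)).
  set (Q := fun s => knorm al (a - 1) c (l s)).
  assert (HVQ : forall s, (0 <= s <= 1)%R -> (Cmod (V s) <= K /\ Cmod (Q s) <= K)%R).
  { intros s Hs; apply Hb; [apply Hl, Hs|].
    specialize (Hlm s Hs); lra. }
  (* The correction [al Q / z] cancels the leading part of [V' = al Q / z]. *)
  set (W := fun s => V s + al * (Q s * / l s)).
  set (W' := fun s => q * (al * ((la - 1) * Q s + mu * V s) / (l s * l s))).
  assert (HW : forall s, (0 <= s <= 1)%R -> is_derC W s (W' s)).
  { intros s Hs; specialize (Hl_pos s Hs); specialize (Hl_nz s Hs).
    assert (D1 : is_derC V s (q * (al * Q s / l s)))
      by exact (is_derC_knorm_top a c r q s Hc Hl_pos).
    assert (D2 : is_derC Q s (q * (- Q s + (la * Q s + mu * V s) / l s)))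
      by exact (is_derC_knorm_sub a c r q s Hc Hl_pos).
    assert (D3 : is_derC (fun t => / l t) s (- q / (l s * l s)))
      by exact (is_derC_inv _ _ _ Hl_nz (is_derC_line r q s)).
    refine (is_derC_ext _ _ _ _ _ (fun t => eq_refl) _ (is_derC_plus _ _ _ _ _
      D1 (is_derC_scal al _ _ _ (is_derC_mult _ _ _ _ _ D2 D3)))).
    unfold W'; field; exact Hl_nz. }
  assert (HWb : (Cmod (W 1%R - W 0%R) <= 2 * (2 * A / (kappa ^ 2 * r)) * (1 - 0))%R).
  { apply is_derC_mvt with W'; [lra|exact HW|].
    intros s Hs; destruct (HVQ s Hs) as [H1 H2]; specialize (Hlm s Hs).
    assert (H3 : (Cmod (al * ((la - 1) * Q s + mu * V s)) <= A)%R).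
    { rewrite Cmod_mult; apply Rmult_le_compat_l; [apply Cmod_ge_0|].
      eapply Rle_trans; [apply Cmod_triangle|]; rewrite !Cmod_mult.
      pose proof (Cmod_ge_0 (la - 1)); pose proof (Cmod_ge_0 mu); nra. }
    assert (Hkr : (0 < kappa * r)%R) by (apply Rmult_lt_0_compat; lra).
    unfold W'; rewrite Cmod_mult, Cmod_div by
      (apply Cmult_neq_0; apply Hl_nz, Hs).
    rewrite Cmod_mult with (x := l s).
    apply Rle_trans with (2 * r * (A / ((kappa * r) * (kappa * r))))%R.
    - apply Rmult_le_compat; [apply Cmod_ge_0| |exact Hq|].
      + apply Rdiv_le_0_compat; [apply Cmod_ge_0|nra].
      + apply Rmult_le_compat; [apply Cmod_ge_0| |exact H3|].
        * apply Rlt_le, Rinv_0_lt_compat; nra.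
        * apply Rinv_le_contravar; nra.
    - apply Req_le; field; lra. }
  assert (HQ : forall s, (0 <= s <= 1)%R -> (r <= Cmod (l s))%R ->
    (Cmod (al * (Q s * / l s)) <= Cmod al * K / r)%R).
  { intros s Hs Hrs; rewrite !Cmod_mult, Cmod_inv by now apply Hl_nz.
    destruct (HVQ s Hs) as [_ H].
    unfold Rdiv; rewrite Rmult_assoc.
    apply Rmult_le_compat_l; [apply Cmod_ge_0|].
    apply Rmult_le_compat; [apply Cmod_ge_0| |exact H|].
    - apply Rlt_le, Rinv_0_lt_compat; lra.
    - apply Rinv_le_contravar; lra. }
  pose proof (HQ 0%R ltac:(lra)) as HQ0; pose proof (HQ 1%R ltac:(lra)) as HQ1.
  rewrite Hl0, Cmod_RtoC_nonneg in HQ0 by lra.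
  rewrite Hl1 in HQ1; fold r in HQ1.
  specialize (HQ0 ltac:(lra)); specialize (HQ1 ltac:(lra)).
  replace (knorm al a c z - knorm al a c r) with
    (W 1%R - W 0%R - (al * (Q 1%R * / z) - al * (Q 0%R * / RtoC r))).
  2: { unfold W; rewrite Hl0, Hl1; unfold V; rewrite Hl0, Hl1; ring. }
  eapply Rle_trans; [apply Cmod_sub_triangle|].
  eapply Rle_trans; [apply Rplus_le_compat;
    [exact HWb|apply Cmod_sub_triangle]|].
  replace ((4 * A / kappa ^ 2 + 2 * Cmod al * K) / r)%R with
    (2 * (2 * A / (kappa ^ 2 * r)) * (1 - 0) +
      (Cmod al * K / r + Cmod al * K / r))%R by (field; lra).
  apply Rplus_le_compat_l, Rplus_le_compat; assumption.
Qed.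

(** * Limits *)

(** Convergence in modulus along a filter, shared by sequences and by functions of a real variable
    at infinity. *)
Definition tends {T : Type} (F : (T -> Prop) -> Prop) (f : T -> C) (l : C) :=
  forall eps, (0 < eps)%R -> F (fun x => (Cmod (f x - l) < eps)%R).

Lemma tends_squeeze {T} (F : (T -> Prop) -> Prop) {FF : Filter F}
  (f g : T -> C) (l : C) :
  F (fun x => (Cmod (f x - l) <= Cmod (g x))%R) -> tends F g 0 -> tends F f l.
Proof.
  intros H Hg eps He; generalize (filter_and (F := F) _ _ H (Hg eps He)).
  apply filter_imp; intros x [H1 H2].
  replace (g x - 0) with (g x) in H2 by ring; lra.
Qed.

Lemma tends_ext_loc {T} (F : (T -> Prop) -> Prop) {FF : Filter F}
  (f g : T -> C) (l : C) :
  F (fun x => f x = g x) -> tends F f l -> tends F g l.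
Proof.
  intros H Hf eps He; generalize (filter_and (F := F) _ _ H (Hf eps He)).
  apply filter_imp; intros x [<- H2]; exact H2.
Qed.

Lemma tends_const {T} (F : (T -> Prop) -> Prop) {FF : Filter F} (l : C) :
  tends F (fun _ => l) l.
Proof.
  intros eps He; apply filter_forall; intros x.
  replace (l - l) with (RtoC 0) by ring; now rewrite Cmod_0.
Qed.

Lemma tends_plus {T} (F : (T -> Prop) -> Prop) {FF : Filter F}
  (f g : T -> C) (l m : C) :
  tends F f l -> tends F g m -> tends F (fun x => f x + g x) (l + m).
Proof.
  intros Hf Hg eps He.
  generalize (filter_and (F := F) _ _ (Hf (eps / 2)%R ltac:(lra))
    (Hg (eps / 2)%R ltac:(lra))).
  apply filter_imp; intros x [H1 H2].
  replace (f x + g x - (l + m)) with ((f x - l) + (g x - m)) by ring.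
  eapply Rle_lt_trans; [apply Cmod_triangle|lra].
Qed.

Lemma tends_mult {T} (F : (T -> Prop) -> Prop) {FF : Filter F}
  (f g : T -> C) (l m : C) :
  tends F f l -> tends F g m -> tends F (fun x => f x * g x) (l * m).
Proof.
  intros Hf Hg eps He.
  pose proof (Cmod_ge_0 l); pose proof (Cmod_ge_0 m).
  set (d := Rmin 1 (eps / (Cmod l + Cmod m + 2))).
  assert (Hd : (0 < d)%R).
  { apply Rmin_glb_lt; [lra|apply Rdiv_lt_0_compat; lra]. }
  assert (Hd1 : (d <= 1)%R) by apply Rmin_l.
  assert (Hd2 : (d * (Cmod l + Cmod m + 2) <= eps)%R).
  { apply Rle_trans with (eps / (Cmod l + Cmod m + 2) *
      (Cmod l + Cmod m + 2))%R.
    - apply Rmult_le_compat_r; [lra|apply Rmin_r].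
    - apply Req_le; field; lra. }
  generalize (filter_and (F := F) _ _ (Hf d Hd) (Hg d Hd)).
  apply filter_imp; intros x [H1 H2].
  replace (f x * g x - l * m) with
    ((f x - l) * (g x - m) + (l * (g x - m) + m * (f x - l))) by ring.
  eapply Rle_lt_trans; [apply Cmod_triangle|].
  eapply Rle_lt_trans; [apply Rplus_le_compat_l, Cmod_triangle|].
  rewrite !Cmod_mult.
  pose proof (Cmod_ge_0 (f x - l)); pose proof (Cmod_ge_0 (g x - m)).
  assert (Cmod (f x - l) * Cmod (g x - m) <= d * 1)%R
    by (apply Rmult_le_compat; lra).
  assert (Cmod l * Cmod (g x - m) <= Cmod l * d)%R
    by (apply Rmult_le_compat_l; lra).
  assert (Cmod m * Cmod (f x - l) <= Cmod m * d)%R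
    by (apply Rmult_le_compat_l; lra).
  lra.
Qed.

Lemma tends_scal {T} (F : (T -> Prop) -> Prop) {FF : Filter F}
  (k : C) (f : T -> C) (l : C) :
  tends F f l -> tends F (fun x => k * f x) (k * l).
Proof. intros H; apply tends_mult; auto using tends_const. Qed.

Lemma tends_inv {T} (F : (T -> Prop) -> Prop) {FF : Filter F}
  (f : T -> C) (l : C) : l <> 0 -> tends F f l -> tends F (fun x => / f x) (/ l).
Proof.
  intros Hl Hf eps He.
  pose proof (proj1 (Cmod_gt_0 l) Hl) as Hm.
  set (d := Rmin (Cmod l / 2) (eps * (Cmod l * (Cmod l / 2)))).
  assert (Hd : (0 < d)%R).
  { apply Rmin_glb_lt; [lra|]; repeat apply Rmult_lt_0_compat; lra. }
  generalize (Hf d Hd); apply filter_imp; intros x H1.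
  assert (Hd1 : (d <= Cmod l / 2)%R) by apply Rmin_l.
  assert (Hd2 : (d <= eps * (Cmod l * (Cmod l / 2)))%R) by apply Rmin_r.
  assert (Hx : (Cmod l / 2 < Cmod (f x))%R).
  { pose proof (Cmod_ge_sub l (f x - l)).
    replace (l + (f x - l)) with (f x) in H by ring; lra. }
  assert (Hx0 : f x <> 0) by (apply Cmod_gt_0; lra).
  replace (/ f x - / l) with (- (f x - l) / (l * f x)) by (field; auto).
  rewrite Cmod_div, Cmod_opp, Cmod_mult by now apply Cmult_neq_0.
  assert (Hp : (0 < Cmod l * Cmod (f x))%R) by (apply Rmult_lt_0_compat; lra).
  apply Rlt_div_l; [exact Hp|].
  eapply Rlt_le_trans; [exact H1|]; eapply Rle_trans; [exact Hd2|].
  apply Rmult_le_compat_l; [lra|]; apply Rmult_le_compat_l; lra.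
Qed.

Lemma tends_shift (u : nat -> C) (l : C) :
  tends eventually (fun n => u (S n)) l <-> tends eventually u l.
Proof.
  split; intros H eps He; destruct (H eps He) as [N HN].
  - exists (S N); intros [|n] Hn; [lia|apply HN; lia].
  - exists N; intros n Hn; apply HN; lia.
Qed.

Lemma tends_inv_INR : tends eventually (fun n => RtoC (/ INR (S n))) 0.
Proof.
  intros eps He; destruct (INR_unbounded (/ eps)) as [N HN].
  exists N; intros n Hn; apply le_INR in Hn.
  replace (RtoC (/ INR (S n)) - 0) with (RtoC (/ INR (S n))) by ring.
  rewrite S_INR.
  assert (0 < / eps)%R by now apply Rinv_0_lt_compat.
  rewrite Cmod_RtoC_nonneg by (apply Rlt_le, Rinv_0_lt_compat; lra).
  rewrite <- (Rinv_inv eps); apply Rinv_lt_contravar; [|lra].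
  apply Rmult_lt_0_compat; lra.
Qed.

(** * Estimates for the exponential *)

(** A mean value bound along the segment from 0 to [w]. Keeping [Rmax 0 (Re w)] gives a bound
    without exponential growth when [Re w <= 0]. *)
Lemma Cexp_sub_1 (w : C) :
  (Cmod (Cexp w - 1) <= 2 * Cmod w * exp (Rmax 0 (Re w)))%R.
Proof.
  pose proof (is_derC_mvt (fun t => Cexp (0 + RtoC t * w))
    (fun t => w * Cexp (0 + RtoC t * w)) 0 1
    (Cmod w * exp (Rmax 0 (Re w)))) as H.
  cbv beta in H.
  replace (0 + 1 * w) with w in H by ring.
  replace (0 + 0 * w) with (RtoC 0) in H by ring; rewrite Cexp_0 in H.
  replace (2 * Cmod w * exp (Rmax 0 (Re w)))%R with
    (2 * (Cmod w * exp (Rmax 0 (Re w))) * (1 - 0))%R by ring.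
  apply H; [lra| |].
  - intros s _; apply (is_derC_Cexp (fun t => 0 + RtoC t * w)), is_derC_line.
  - intros s Hs; rewrite Cmod_mult, Cmod_Cexp.
    apply Rmult_le_compat_l; [apply Cmod_ge_0|].
    apply exp_le_compat; rewrite Cplus_0_l, re_scal_l.
    destruct (Rle_dec 0 (Re w)).
    + rewrite Rmax_right by lra; nra.
    + rewrite Rmax_left by lra; nra.
Qed.

Lemma Cexp_sub_1_abs (w : C) :
  (Cmod (Cexp w - 1) <= 2 * Cmod w * exp (Cmod w))%R.
Proof.
  eapply Rle_trans; [apply Cexp_sub_1|].
  apply Rmult_le_compat_l; [pose proof (Cmod_ge_0 w); lra|].
  apply exp_le_compat, Rmax_lub; [apply Cmod_ge_0|].
  eapply Rle_trans; [apply Rle_abs|apply re_le_Cmod].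
Qed.

Lemma Cexp_sub_1_sub (w : C) :
  (Cmod (Cexp w - 1 - w) <= 4 * Cmod w ^ 2 * exp (Cmod w))%R.
Proof.
  pose proof (is_derC_mvt (fun t => Cexp (0 + RtoC t * w) + (- (1)) * (0 + RtoC t * w))
    (fun t => w * Cexp (0 + RtoC t * w) + (- (1)) * w) 0 1
    (2 * Cmod w ^ 2 * exp (Cmod w))) as H.
  cbv beta in H.
  replace (0 + 1 * w) with w in H by ring.
  replace (0 + 0 * w) with (RtoC 0) in H by ring; rewrite Cexp_0 in H.
  replace (Cexp w - 1 - w) with (Cexp w + - (1) * w - (1 + - (1) * 0)) by ring.
  replace (4 * Cmod w ^ 2 * exp (Cmod w))%R with
    (2 * (2 * Cmod w ^ 2 * exp (Cmod w)) * (1 - 0))%R by ring.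
  apply H; [lra| |].
  - intros s _; apply is_derC_plus.
    + apply (is_derC_Cexp (fun t => 0 + RtoC t * w)), is_derC_line.
    + apply is_derC_scal, is_derC_line.
  - intros s Hs.
    replace (w * Cexp (0 + s * w) + - (1) * w)
      with (w * (Cexp (0 + s * w) - 1)) by ring.
    rewrite Cmod_mult.
    replace (2 * Cmod w ^ 2 * exp (Cmod w))%R
      with (Cmod w * (2 * Cmod w * exp (Cmod w)))%R by ring.
    apply Rmult_le_compat_l; [apply Cmod_ge_0|].
    eapply Rle_trans; [apply Cexp_sub_1_abs|].
    rewrite Cplus_0_l, Cmod_mult, Cmod_RtoC_nonneg by lra.
    pose proof (Cmod_ge_0 w).
    assert (s * Cmod w <= Cmod w)%R by nra.
    apply Rmult_le_compat; [nra|apply Rlt_le, exp_pos|lra|].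
    now apply exp_le_compat.
Qed.

Lemma ln_le_sub_1 (s : R) : (0 < s)%R -> (ln s <= s - 1)%R.
Proof.
  intros Hs; pose proof (exp_ineq1_le (ln s)); rewrite exp_ln in H; lra.
Qed.

Lemma Rabs_ln_le (s : R) : (1 / 2 <= s)%R -> (Rabs (ln s) <= 2 * Rabs (s - 1))%R.
Proof.
  intros Hs; pose proof (ln_le_sub_1 s ltac:(lra)) as H1.
  pose proof (ln_le_sub_1 (/ s) ltac:(apply Rinv_0_lt_compat; lra)) as H2.
  rewrite ln_Rinv in H2 by lra.
  assert (H3 : (/ s * s = 1)%R) by (apply Rinv_l; lra).
  assert (H4 : (0 < / s)%R) by (apply Rinv_0_lt_compat; lra).
  destruct (Rle_dec 1 s).
  - rewrite (Rabs_pos_eq (s - 1)) by lra; apply Rabs_le; split; [|lra].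
    assert (/ s <= 1)%R by nra; lra.
  - rewrite (Rabs_left (s - 1)) by lra; apply Rabs_le.
    assert (/ s <= 2)%R by nra.
    assert (/ s - 1 <= 2 * (1 - s))%R by nra.
    split; lra.
Qed.

(** Here [s] plays the part of [n / r] under a Poisson law, and [Cexp (- al * ln s)] is [s^(-al)]. A
    deviation linear in [|s - 1|] is traded for [eps] plus a multiple of [(s - 1)^2], so that the
    mean and the variance are all that is needed. *)
Lemma Cexp_ln_near_1 (al : C) (eps : R) : (0 < eps)%R ->
  exists D, (0 <= D)%R /\ forall s, (0 < s)%R -> (-1 <= Re al <= 0)%R ->
    (Cmod (Cexp (- al * ln s)) <= 1 + s)%R /\
    (Cmod (Cexp (- al * ln s) - 1) <= eps + D * (s - 1) ^ 2)%R.
Proof.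
  intros He; set (A := (4 * Cmod al * exp (Cmod al))%R).
  assert (HA : (0 <= A)%R).
  { unfold A; pose proof (Cmod_ge_0 al); pose proof (exp_pos (Cmod al)); nra. }
  assert (HD : (0 <= A ^ 2 / eps)%R)
    by (apply Rdiv_le_0_compat; [apply pow2_ge_0|lra]).
  (* [A^2 / eps] comes from [A x <= eps + (A x)^2 / eps]; 14 is the least constant with
     [3 + x <= 14 x^2] for [x >= 1/2]. *)
  exists (A ^ 2 / eps + 14)%R; split; [lra|].
  intros s Hs Hal.
  assert (H1 : (Cmod (Cexp (- al * ln s)) <= 1 + s)%R).
  { rewrite Cmod_Cexp, re_scal_r.
    replace (Re (- al)) with (- Re al)%R by reflexivity.
    destruct (Rle_dec 1 s) as [H|H].
    - assert (0 <= ln s)%R by (rewrite <- ln_1; apply ln_le; lra).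
      apply Rle_trans with (exp (ln s)); [apply exp_le_compat; nra|].
      rewrite exp_ln; lra.
    - assert (ln s < 0)%R by (rewrite <- ln_1; apply ln_increasing; lra).
      apply Rle_trans with (exp 0); [apply exp_le_compat; nra|].
      rewrite exp_0; lra. }
  split; [exact H1|].
  pose proof (pow2_ge_0 (s - 1)) as Hs2.
  destruct (Rle_dec (Rabs (s - 1)) (1 / 2)) as [H|H].
  - pose proof (proj1 (Rabs_le_between _ _) H) as Hb.
    pose proof (Rabs_ln_le s ltac:(lra)) as Hl.
    pose proof (Cmod_ge_0 al) as Ha.
    assert (E : (Cmod (Cexp (- al * ln s) - 1) <= A * Rabs (s - 1))%R).
    { eapply Rle_trans; [apply Cexp_sub_1_abs|].
      rewrite Cmod_mult, Cmod_opp, Cmod_R.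
      assert (Cmod al * Rabs (ln s) <= Cmod al * (2 * Rabs (s - 1)))%R
        by (apply Rmult_le_compat_l; lra).
      assert (exp (Cmod al * Rabs (ln s)) <= exp (Cmod al))%R
        by (apply exp_le_compat; nra).
      pose proof (exp_pos (Cmod al * Rabs (ln s))).
      pose proof (Rabs_pos (ln s)).
      replace (A * Rabs (s - 1))%R with
        (2 * (Cmod al * (2 * Rabs (s - 1))) * exp (Cmod al))%R
        by (unfold A; ring).
      apply Rmult_le_compat; try lra; nra. }
    eapply Rle_trans; [exact E|].
    rewrite <- (pow2_abs (s - 1)) in *; set (x := Rabs (s - 1)) in *.
    assert (A * x <= eps + A ^ 2 / eps * x ^ 2)%R.
    { apply Rmult_le_reg_l with eps; [exact He|].
      replace (eps * (eps + A ^ 2 / eps * x ^ 2))%R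
        with (eps ^ 2 + (A * x) ^ 2)%R by (field; lra).
      pose proof (pow2_ge_0 (eps - A * x)); pose proof (pow2_ge_0 (A * x)).
      nra. }
    lra.
  - eapply Rle_trans; [apply Cmod_sub_triangle|]; rewrite Cmod_1.
    assert (Hx : (1 / 2 <= Rabs (s - 1))%R) by lra.
    pose proof (Rle_abs (s - 1)).
    rewrite <- (pow2_abs (s - 1)) in *; set (x := Rabs (s - 1)) in *.
    assert (0 <= A ^ 2 / eps * x ^ 2)%R by (apply Rmult_le_pos; lra).
    assert (3 + x <= 14 * x ^ 2)%R by nra.
    lra.
Qed.

(** * An Abelian theorem for exponential generating functions *)

Lemma is_series_exp (r : R) : is_series (fun n => r ^ n / INR (fact n))%R (exp r).
Proof.
  apply (is_series_ext (fun n => scal (pow_n r n) (/ INR (fact n))%R)).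
  - intros n; rewrite pow_n_pow; reflexivity.
  - apply is_exp_Reals.
Qed.

(** From [n r^n / n! = r r^(n-1) / (n-1)!]. Used once and twice, it yields the first two Poisson
    moments. *)
Lemma is_series_exp_step (f : nat -> R) (r l : R) :
  is_series (fun n => f (S n) * (r ^ n / INR (fact n)))%R l ->
  is_series (fun n => INR n * f n * (r ^ n / INR (fact n)))%R (r * l)%R.
Proof.
  intros H; apply is_series_decr_1.
  replace (plus (r * l)%R _) with (scal r l).
  - apply (is_series_ext (fun n => scal r (f (S n) * (r ^ n / INR (fact n)))%R)).
    + intros n; rewrite fact_simpl, mult_INR.
      pose proof (INR_fact_pos n); pose proof (not_0_INR (S n) ltac:(lia)).
      change (r * (f (S n) * (r ^ n / INR (fact n))) = INR (S n) * f (S n) *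
        (r * r ^ n / (INR (S n) * INR (fact n))))%R.
      field; split; lra.
    + now apply (is_series_scal (V := R_NormedModule)).
  - change (r * l = r * l + - (0 * f O * (r ^ 0 / INR (fact 0))))%R; ring.
Qed.

(* Mean and variance of the Poisson distribution of parameter [r]. *)
Lemma is_series_poisson (A B D r : R) : (0 < r)%R ->
  is_series (fun n => (A + B * (INR n / r) + D * (INR n / r - 1) ^ 2)
      * (r ^ n / INR (fact n)))%R
    ((A + B + D / r) * exp r)%R.
Proof.
  intros Hr; pose proof (is_series_exp r) as H0.
  assert (H1 : is_series (fun n => INR n * 1 * (r ^ n / INR (fact n)))%R
    (r * exp r)%R).
  { apply (is_series_exp_step (fun _ => 1%R)).
    apply (is_series_ext (fun n => r ^ n / INR (fact n))%R); [|exact H0].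
    intros n; simpl; ring. }
  assert (H2 : is_series (fun n => INR n * INR n * (r ^ n / INR (fact n)))%R
    (r * (r * exp r + exp r))%R).
  { apply is_series_exp_step.
    apply (is_series_ext (fun n => plus
      (INR n * 1 * (r ^ n / INR (fact n)))%R (r ^ n / INR (fact n))%R)).
    - intros n; rewrite S_INR; set (p := (r ^ n / INR (fact n))%R).
      change (INR n * 1 * p + p = (INR n + 1) * p)%R; ring.
    - now apply (is_series_plus (V := R_NormedModule)). }
  apply (is_series_ext (fun n => plus (scal (A + D)%R (r ^ n / INR (fact n))%R)
    (plus (scal (B / r - 2 * D / r)%R (INR n * 1 * (r ^ n / INR (fact n)))%R)
      (scal (D / r ^ 2)%R (INR n * INR n * (r ^ n / INR (fact n)))%R)))).
  - intros n; set (p := (r ^ n / INR (fact n))%R).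
    change ((A + D) * p + ((B / r - 2 * D / r) * (INR n * 1 * p) +
      D / r ^ 2 * (INR n * INR n * p)) =
      (A + B * (INR n / r) + D * (INR n / r - 1) ^ 2) * p)%R.
    field; lra.
  - evar_last.
    + apply (is_series_plus (V := R_NormedModule));
        [|apply (is_series_plus (V := R_NormedModule))];
        apply (is_series_scal (V := R_NormedModule)); eassumption.
    + change ((A + D) * exp r + ((B / r - 2 * D / r) * (r * exp r) +
        D / r ^ 2 * (r * (r * exp r + exp r))) = (A + B + D / r) * exp r)%R.
      field; lra.
Qed.

(** At most geometric growth, so that the exponential generating function is entire. *)
Definition exp_bounded (d : nat -> C) : Prop :=
  exists D q, (0 <= q)%R /\ forall n, (Cmod (d n) <= D * q ^ n)%R.

Lemma exp_bounded_geo (d : nat -> C) (rho : R) : (0 <= rho)%R ->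
  exp_bounded d -> geo (egf d) rho.
Proof. intros Hr [D [q [Hq H]]]; now apply geo_egf with D q. Qed.

Lemma exp_bounded_summable (d : nat -> C) (r : R) : (0 < r)%R ->
  exp_bounded d -> summable (fun n => egf d n * RtoC r ^ n).
Proof.
  intros Hr Hd; apply (geo_summable _ (r + 1)).
  - rewrite Cmod_RtoC_nonneg; lra.
  - apply exp_bounded_geo; [lra|exact Hd].
Qed.

(** For large [n], [r^al d_n] is the product of [(n / r)^(-al)] and [n^al d_n], and both factors are
    controlled. For the finitely many small [n], [n / r <= 1/2], so [(n / r - 1)^2 >= 1/4] and a
    large multiple of it absorbs the bounded error. *)
Lemma abel_weights (d : nat -> C) (al K : C) (eps : R) : (-1 <= Re al <= 0)%R ->
  exp_bounded d -> tends eventually (fun n => d n * Cpower (INR n) al) K ->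
  (0 < eps)%R ->
  exists D r0, (0 <= D)%R /\ (0 < r0)%R /\ forall r n, (r0 <= r)%R ->
    (Cmod (Cpower r al * d n - K) <=
      (eps + Cmod K * eps) + eps * (INR n / r) + D * (INR n / r - 1) ^ 2)%R.
Proof.
  intros Hal [D0 [q [Hq Hd]]] Hlim He.
  destruct (Hlim eps He) as [N0 HN0].
  destruct (Cexp_ln_near_1 al eps He) as [D1 [HD1 H1]].
  (* The successor ensures that [N <= n] implies [n >= 1], as the logarithm of [INR n] requires. *)
  set (N := S N0).
  set (q' := Rmax 1 q).
  assert (Hq' : (1 <= q')%R) by apply Rmax_l.
  assert (Hqq : (q <= q')%R) by apply Rmax_r.
  assert (HD0 : (0 <= D0)%R).
  { specialize (Hd O); simpl in Hd; pose proof (Cmod_ge_0 (d O)); lra. }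
  (* The factor 4 compensates for [(s - 1)^2 >= 1/4], valid for [n < N] once [r >= 2 N + 1]. *)
  set (D2 := (4 * (D0 * q' ^ N + Cmod K))%R).
  pose proof (Cmod_ge_0 K) as HK.
  assert (Hpos : (0 <= D0 * q' ^ N)%R)
    by (apply Rmult_le_pos; [exact HD0|apply pow_le; lra]).
  assert (HD2 : (0 <= D2)%R) by (unfold D2; lra).
  assert (HKD : (0 <= Cmod K * D1)%R) by now apply Rmult_le_pos.
  exists (Cmod K * D1 + D2)%R, (2 * INR N + 1)%R; split; [lra|].
  pose proof (pos_INR N) as HN; split; [lra|].
  intros r n Hr.
  pose proof (pos_INR n) as Hn0.
  assert (Hs0 : (0 <= INR n / r)%R) by (apply Rdiv_le_0_compat; lra).
  pose proof (pow2_ge_0 (INR n / r - 1)) as Hsq.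
  assert (Hes : (0 <= eps * (INR n / r))%R) by (apply Rmult_le_pos; lra).
  destruct (Nat.le_gt_cases N n) as [Hn|Hn].
  - assert (Hn1 : (1 <= INR n)%R)
      by (apply (le_INR 1); unfold N in Hn; lia).
    set (s := (INR n / r)%R) in *.
    assert (Hs : (0 < s)%R) by (apply Rdiv_lt_0_compat; lra).
    destruct (H1 s Hs Hal) as [Ha Hb].
    set (w := Cexp (- al * ln s)) in *.
    assert (E : Cpower r al = w * Cpower (INR n) al).
    { rewrite !Cpower_RtoC by lra; unfold w; rewrite <- Cexp_plus; f_equal.
      unfold s; rewrite ln_div, RtoC_minus by lra; ring. }
    replace (Cpower r al * d n - K) with
      (w * (d n * Cpower (INR n) al - K) + K * (w - 1)) by (rewrite E; ring).
    eapply Rle_trans; [apply Cmod_triangle|]; rewrite !Cmod_mult.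
    specialize (HN0 n ltac:(unfold N in Hn; lia)).
    assert (Cmod w * Cmod (d n * Cpower (INR n) al - K) <= (1 + s) * eps)%R
      by (apply Rmult_le_compat; try apply Cmod_ge_0; lra).
    assert (Cmod K * Cmod (w - 1) <= Cmod K * (eps + D1 * (s - 1) ^ 2))%R
      by (apply Rmult_le_compat_l; lra).
    assert (0 <= D2 * (s - 1) ^ 2)%R by now apply Rmult_le_pos.
    lra.
  - assert (Hn1 : (INR n <= INR N)%R) by (apply le_INR; lia).
    assert (Hs : (INR n / r <= 1 / 2)%R).
    { apply Rle_div_l; lra. }
    set (s := (INR n / r)%R) in *.
    assert (Hc : (Cmod (Cpower r al) <= 1)%R).
    { rewrite Cmod_Cpower_RtoC, <- exp_0 by lra; apply exp_le_compat.
      assert (0 <= ln r)%R by (rewrite <- ln_1; apply ln_le; lra); nra. }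
    assert (Hdn : (Cmod (d n) <= D0 * q' ^ N)%R).
    { eapply Rle_trans; [apply Hd|]; apply Rmult_le_compat_l; [exact HD0|].
      apply Rle_trans with (q' ^ n)%R; [apply pow_incr; lra|].
      apply Rle_pow; [lra|lia]. }
    eapply Rle_trans; [apply Cmod_sub_triangle|]; rewrite Cmod_mult.
    assert (Cmod (Cpower r al) * Cmod (d n) <= 1 * (D0 * q' ^ N))%R
      by (apply Rmult_le_compat; try apply Cmod_ge_0; lra).
    assert (1 / 4 <= (s - 1) ^ 2)%R by nra.
    assert (D2 * (1 / 4) <= D2 * (s - 1) ^ 2)%R
      by (apply Rmult_le_compat_l; lra).
    assert (0 <= Cmod K * D1 * (s - 1) ^ 2)%R by (apply Rmult_le_pos; lra).
    assert (0 <= Cmod K * eps)%R by (apply Rmult_le_pos; lra).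
    unfold D2 in *; lra.
Qed.

(** The numbers [exp (- r) r^n / n!] are the Poisson weights, so the difference with [K] is the mean
    of [r^al d_n - K]. The bound of [abel_weights] is averaged exactly: [n / r] has mean 1 and
    variance [1 / r]. *)
Lemma abel_base (d : nat -> C) (al K : C) : (-1 <= Re al <= 0)%R ->
  exp_bounded d -> tends eventually (fun n => d n * Cpower (INR n) al) K ->
  tends (Rbar_locally p_infty)
    (fun r : R => Cpower r al * Cexp (- RtoC r) * CPS (egf d) r) K.
Proof.
  intros Hal Hd Hlim eps He.
  pose proof (Cmod_ge_0 K) as HK.
  (* [e (2 + |K|)] takes half of [eps]; the variance term [D / r] will take at most a quarter. *)
  set (e := (eps / (2 * (2 + Cmod K)))%R).
  assert (He' : (0 < e)%R) by (apply Rdiv_lt_0_compat; lra).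
  assert (Hee : (e * (2 + Cmod K) = eps / 2)%R) by (unfold e; field; lra).
  destruct (abel_weights d al K e Hal Hd Hlim He') as [D [r0 [HD [Hr0 H]]]].
  exists (Rmax r0 (4 * D / eps))%R; intros r Hr.
  pose proof (Rmax_l r0 (4 * D / eps)); pose proof (Rmax_r r0 (4 * D / eps)).
  assert (Hr' : (r0 <= r)%R) by lra.
  assert (HDr : (D / r <= eps / 4)%R).
  { apply Rle_div_l; [lra|].
    assert (4 * D / eps * eps <= r * eps)%R by (apply Rmult_le_compat_r; lra).
    replace (4 * D / eps * eps)%R with (4 * D)%R in H2 by (field; lra); lra. }
  pose proof (is_series_poisson (e + Cmod K * e) e D r ltac:(lra)) as HP.
  set (P := fun n => (r ^ n / INR (fact n))%R) in *.
  assert (HPp : forall n, (0 <= P n)%R).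
  { intros n; apply Rdiv_le_0_compat; [apply pow_le; lra|apply INR_fact_pos]. }
  assert (HT : forall n, (Cmod ((Cpower r al * d n - K) * P n) <=
    (e + Cmod K * e + e * (INR n / r) + D * (INR n / r - 1) ^ 2) * P n)%R).
  { intros n; rewrite Cmod_mult, (Cmod_RtoC_nonneg (P n)) by apply HPp.
    apply Rmult_le_compat_r; [apply HPp|now apply H]. }
  assert (HPs : summable (fun n => RtoC (P n))).
  { apply (summable_le _ P).
    - intros n; rewrite Cmod_RtoC_nonneg by apply HPp; lra.
    - eexists; apply is_series_exp. }
  pose proof (exp_bounded_summable d r ltac:(lra) Hd) as Hds.
  assert (HE : CSeries (fun n => RtoC (P n)) = Cexp r).
  { rewrite CSeries_RtoC, Cexp_RtoC; f_equal.
    apply is_series_unique, is_series_exp. }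
  assert (HS : CSeries (fun n => (Cpower r al * d n - K) * P n) =
    Cpower r al * CPS (egf d) r - K * Cexp r).
  { rewrite <- HE; unfold CPS.
    rewrite <- !CSeries_scal, <- CSeries_minus by auto using summable_scal.
    apply CSeries_ext; intros n; unfold egf, P.
    rewrite RtoC_div, RtoC_pow by (pose proof (INR_fact_pos n); lra).
    field; apply RtoC_fact_neq_0. }
  assert (HB : (Cmod (Cpower r al * CPS (egf d) r - K * Cexp r) <=
    (e + Cmod K * e + e + D / r) * exp r)%R).
  { rewrite <- HS, <- (is_series_unique _ _ HP).
    apply CSeries_bound; [exact HT|]; eexists; exact HP. }
  replace (Cpower r al * Cexp (- r) * CPS (egf d) r - K) with
    (Cexp (- r) * (Cpower r al * CPS (egf d) r - K * Cexp r))
    by (rewrite Cexp_opp; field; apply Cexp_neq_0).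
  rewrite Cmod_mult, Cmod_Cexp.
  replace (Re (- RtoC r)) with (- r)%R by reflexivity.
  apply Rle_lt_trans with (e + Cmod K * e + e + D / r)%R; [|lra].
  replace (e + Cmod K * e + e + D / r)%R with
    (exp (- r) * ((e + Cmod K * e + e + D / r) * exp r))%R.
  - apply Rmult_le_compat_l; [apply Rlt_le, exp_pos|exact HB].
  - rewrite exp_Ropp; field; pose proof (exp_pos r); lra.
Qed.

Lemma INR_S_pos (n : nat) : (0 < INR (S n))%R.
Proof. apply lt_0_INR; lia. Qed.

Lemma RtoC_INR_S (n : nat) : RtoC (INR (S n)) <> 0.
Proof. apply RtoC_neq_0; pose proof (INR_S_pos n); lra. Qed.

Lemma ln_INR_ratio (n : nat) :
  (/ INR (S (S n)) <= ln (INR (S (S n))) - ln (INR (S n)) <= / INR (S n))%R.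
Proof.
  pose proof (INR_S_pos n) as H1; pose proof (INR_S_pos (S n)) as H2.
  rewrite <- ln_div by lra; split.
  - pose proof (ln_le_sub_1 (INR (S n) / INR (S (S n)))
      ltac:(apply Rdiv_lt_0_compat; lra)) as H.
    rewrite ln_div in H by lra; rewrite ln_div by lra.
    replace (INR (S n) / INR (S (S n)) - 1)%R with (- / INR (S (S n)))%R in H
      by (rewrite (S_INR (S n)) in *; field; lra).
    lra.
  - eapply Rle_trans; [apply ln_le_sub_1, Rdiv_lt_0_compat; lra|].
    apply Req_le; rewrite (S_INR (S n)) in *; field; lra.
Qed.

Lemma Cpower_INR_S (n : nat) (al : C) :
  Cpower (INR (S (S n))) al = Cpower (INR (S n)) al *
    Cexp (al * RtoC (ln (INR (S (S n))) - ln (INR (S n)))).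
Proof.
  rewrite !Cpower_RtoC, <- Cexp_plus by apply INR_S_pos.
  f_equal; rewrite RtoC_minus; ring.
Qed.

Lemma Cpower_ratio_tends (al : C) :
  tends eventually
    (fun n => Cexp (al * RtoC (ln (INR (S (S n))) - ln (INR (S n))))) 1.
Proof.
  apply tends_squeeze with
    (fun n => RtoC (2 * Cmod al * exp (Cmod al)) * RtoC (/ INR (S n))).
  - apply _.
  - apply filter_forall; intros n.
    destruct (ln_INR_ratio n) as [H1 H2].
    set (L := (ln (INR (S (S n))) - ln (INR (S n)))%R) in *.
    pose proof (INR_S_pos n) as Hn.
    assert (0 < / INR (S (S n)))%R by apply Rinv_0_lt_compat, INR_S_pos.
    assert (/ INR (S n) <= 1)%R.
    { rewrite <- Rinv_1; apply Rinv_le_contravar; [lra|].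
      rewrite S_INR; pose proof (pos_INR n); lra. }
    pose proof (Cmod_ge_0 al); pose proof (exp_pos (Cmod al)).
    eapply Rle_trans; [apply Cexp_sub_1_abs|].
    rewrite !Cmod_mult, !Cmod_R, !(Rabs_pos_eq L), (Rabs_pos_eq (/ _)) by lra.
    rewrite Rabs_pos_eq by (repeat apply Rmult_le_pos; lra).
    assert (Cmod al * L <= Cmod al * / INR (S n))%R
      by (apply Rmult_le_compat_l; lra).
    assert (exp (Cmod al * L) <= exp (Cmod al))%R
      by (apply exp_le_compat; nra).
    pose proof (exp_pos (Cmod al * L)).
    replace (2 * Cmod al * exp (Cmod al) * / INR (S n))%R with
      (2 * (Cmod al * / INR (S n)) * exp (Cmod al))%R by ring.
    apply Rmult_le_compat; try lra.
    assert (0 <= Cmod al * L)%R by (apply Rmult_le_pos; lra); lra.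
  - replace (RtoC 0) with (RtoC (2 * Cmod al * exp (Cmod al)) * 0) by ring.
    apply tends_scal, tends_inv_INR; apply _.
Qed.

Lemma Cpower_1 (r : R) : (0 < r)%R -> Cpower r 1 = r.
Proof.
  intros; rewrite Cpower_RtoC, Cmult_1_l, Cexp_RtoC, exp_ln; auto.
Qed.

Lemma Cpower_succ (r : R) (al : C) : (0 < r)%R ->
  Cpower r (al + 1) = r * Cpower r al.
Proof. intros; rewrite Cpower_plus, Cpower_1 by auto; ring. Qed.

(** The Abelian theorem for one exponent, quantified over all sequences because a translation of
    [al] by 1 changes the sequence. *)
Definition abel_at (al : C) : Prop := forall d K, exp_bounded d ->
  tends eventually (fun n => d n * Cpower (INR n) al) K ->
  tends (Rbar_locally p_infty)
    (fun r : R => Cpower r al * Cexp (- RtoC r) * CPS (egf d) r) K.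

Lemma eventually_pos (P : R -> Prop) : (forall r, (0 < r)%R -> P r) ->
  Rbar_locally p_infty P.
Proof. intros H; exists 0%R; exact H. Qed.

Lemma CPS_egf_shift (d : nat -> C) (r : R) : (0 < r)%R -> exp_bounded d ->
  CPS (cshift (egf d)) r = r * CPS (egf d) r.
Proof.
  intros Hr Hd; apply CPS_cshift with (r + 1)%R.
  - rewrite Cmod_RtoC_nonneg; lra.
  - apply exp_bounded_geo; [lra|exact Hd].
Qed.

(** The additional factor [r] moves into the series: [r * CPS (egf d) r] is the exponential
    generating function of [n d_(n-1)]. *)
Lemma abel_up (al : C) : abel_at al -> abel_at (al + 1).
Proof.
  intros IH d K Hd Hlim.
  set (d' := cshift (fun k => INR (S k) * d k)).
  assert (E : forall n, egf d' n = cshift (egf d) n).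
  { intros [|n]; unfold egf, d'; cbn [cshift].
    - field; apply (RtoC_fact_neq_0 0).
    - rewrite fact_simpl, mult_INR, RtoC_mult; field; split.
      + apply RtoC_fact_neq_0.
      + apply RtoC_INR_S. }
  assert (Hd' : exp_bounded d').
  { destruct Hd as [D [q [Hq Hd]]].
    assert (HD : (0 <= D)%R).
    { specialize (Hd O); simpl in Hd; pose proof (Cmod_ge_0 (d O)); lra. }
    exists D, (2 * (q + 1))%R; split; [lra|].
    intros [|n]; unfold d'; cbn [cshift].
    - rewrite Cmod_0; simpl; lra.
    - rewrite Cmod_mult, Cmod_RtoC_nonneg by apply pos_INR.
      assert (Hn : forall m, (INR (S m) <= 2 ^ S m)%R).
      { induction m as [|m IHm]; [simpl; lra|].
        rewrite S_INR; replace (2 ^ S (S m))%R with (2 * 2 ^ S m)%R by reflexivity.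
        assert (1 <= 2 ^ S m)%R by (apply pow_R1_Rle; lra); lra. }
      rewrite Rpow_mult_distr.
      replace (D * (2 ^ S n * (q + 1) ^ S n))%R
        with (2 ^ S n * (D * (q + 1) ^ S n))%R by ring.
      apply Rmult_le_compat; [apply pos_INR|apply Cmod_ge_0|apply Hn|].
      eapply Rle_trans; [apply Hd|]; apply Rmult_le_compat_l; [exact HD|].
      apply Rle_trans with ((q + 1) ^ n)%R; [apply pow_incr; lra|].
      apply Rle_pow; [lra|lia]. }
  apply tends_ext_loc with
    (fun r : R => Cpower r al * Cexp (- RtoC r) * CPS (egf d') r).
  - apply _.
  - apply eventually_pos; intros r Hr.
    rewrite (CPS_ext _ _ _ E), CPS_egf_shift, Cpower_succ by auto; ring.
  - apply IH; [exact Hd'|].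
    apply tends_shift, tends_shift.
    apply tends_shift in Hlim.
    replace K with (K * 1) by ring.
    eapply tends_ext_loc; [apply _| |apply (tends_mult _ _ _ _ _ Hlim
      (Cpower_ratio_tends (al + 1)))].
    apply filter_forall; intros n; unfold d'; cbn [cshift].
    rewrite <- Cmult_assoc, <- Cpower_INR_S, Cpower_succ by apply INR_S_pos.
    ring.
Qed.

Lemma Cexp_opp_tends_0 (al : C) : (Re al <= 0)%R ->
  tends (Rbar_locally p_infty) (fun r : R => Cpower r al * Cexp (- RtoC r)) 0.
Proof.
  intros Hal eps He; exists (Rmax 1 (/ eps))%R; intros r Hr.
  pose proof (Rmax_l 1 (/ eps)); pose proof (Rmax_r 1 (/ eps)).
  replace (Cpower r al * Cexp (- r) - 0) with (Cpower r al * Cexp (- r)) by ring.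
  rewrite Cmod_mult, Cmod_Cpower_RtoC, Cmod_Cexp by lra.
  replace (Re (- RtoC r)) with (- r)%R by reflexivity.
  assert (0 <= ln r)%R by (rewrite <- ln_1; apply ln_le; lra).
  assert (exp (Re al * ln r) <= 1)%R
    by (rewrite <- exp_0; apply exp_le_compat; nra).
  assert (exp (- r) < eps)%R.
  { rewrite exp_Ropp, <- (Rinv_inv eps).
    assert (0 < / eps)%R by now apply Rinv_0_lt_compat.
    pose proof (exp_ineq1_le r).
    apply Rinv_lt_contravar; [|lra].
    apply Rmult_lt_0_compat; lra. }
  pose proof (exp_pos (- r)); pose proof (exp_pos (Re al * ln r)); nra.
Qed.

(** The inverse move: [CPS (egf d) r = d_0 + r * CPS (egf d') r] with [d'_n = d_(n+1) / (n + 1)].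
    The constant term disappears in the limit because [r^al exp (- r)] tends to 0. *)
Lemma abel_down (al : C) : (Re al <= 0)%R -> abel_at (al + 1) -> abel_at al.
Proof.
  intros Hal IH d K Hd Hlim.
  set (d' := fun n => d (S n) / INR (S n)).
  assert (Hd' : exp_bounded d').
  { destruct Hd as [D [q [Hq Hd]]]; exists (D * q)%R, q; split; [exact Hq|].
    intros n; unfold d'; rewrite Cmod_div_R by apply INR_S_pos.
    specialize (Hd (S n)); simpl in Hd.
    apply Rle_trans with (Cmod (d (S n))); [|lra].
    apply Rle_div_l; [apply INR_S_pos|].
    pose proof (Cmod_ge_0 (d (S n))); rewrite S_INR; pose proof (pos_INR n); nra. }
  assert (E : forall r : R, (0 < r)%R ->
    CPS (egf d) r = d O + r * CPS (egf d') r).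
  { intros r Hr; rewrite <- CPS_egf_shift by auto; unfold CPS.
    pose proof (exp_bounded_summable d r Hr Hd) as S1.
    assert (S2 : summable (fun n => cshift (egf d') n * RtoC r ^ n)).
    { apply (geo_summable _ (r + 1)).
      - rewrite Cmod_RtoC_nonneg; lra.
      - apply geo_cshift, exp_bounded_geo; try lra; exact Hd'. }
    rewrite (CSeries_shift _ S1), (CSeries_shift _ S2); cbn [cshift].
    assert (E0 : egf d 0 * RtoC r ^ 0 = d O)
      by (unfold egf; simpl; field; apply C1_nz).
    rewrite E0; replace (d O + (0 * RtoC r ^ 0 + CSeries
      (fun n => egf d' n * RtoC r ^ S n))) with
      (d O + CSeries (fun n => egf d' n * RtoC r ^ S n)) by ring.
    f_equal; apply CSeries_ext; intros n; f_equal.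
    unfold egf, d'; rewrite fact_simpl, mult_INR, RtoC_mult; field; split.
    - apply RtoC_INR_S.
    - apply RtoC_fact_neq_0. }
  assert (Hlim' : tends eventually
    (fun n => d' n * Cpower (INR n) (al + 1)) K).
  { apply tends_shift; apply tends_shift, tends_shift in Hlim.
    replace K with (K * / 1) by (field; apply C1_nz).
    eapply tends_ext_loc; [apply _| |apply (tends_mult _ _ _ _ _ Hlim
      (tends_inv _ _ _ C1_nz (Cpower_ratio_tends (al + 1))))].
    apply filter_forall; intros n; unfold d'.
    pose proof (Cpower_INR_S n (al + 1)) as HC.
    rewrite Cpower_succ in HC by apply INR_S_pos.
    set (X := Cexp _) in *.
    assert (X <> 0) by apply Cexp_neq_0.
    assert (RtoC (INR (S (S n))) <> 0)
      by (apply RtoC_INR_S).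
    replace (Cpower (INR (S (S n))) al) with
      (Cpower (INR (S n)) (al + 1) * X / INR (S (S n)))
      by (rewrite <- HC; field; auto).
    field; auto. }
  specialize (IH d' K Hd' Hlim').
  replace K with (d O * 0 + K) by ring.
  eapply tends_ext_loc; [apply _| |apply (tends_plus _ _ _ _ _
    (tends_scal _ (d O) _ _ (Cexp_opp_tends_0 al Hal)) IH)].
  apply eventually_pos; intros r Hr.
  rewrite E, Cpower_succ by auto; ring.
Qed.

(** Every exponent is an integer translate of a point of the strip [-1 <= Re al <= 0], where the
    Poisson argument works. *)
Lemma abel (al : C) : abel_at al.
Proof.
  assert (Hup : forall n al, (-1 <= Re al - INR n <= 0)%R -> abel_at al).
  { induction n as [|n IH]; intros z Hz.
    - intros d K; apply abel_base; simpl in Hz; lra.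
    - replace z with (z - 1 + 1) by ring; apply abel_up, IH.
      rewrite S_INR in Hz; simpl; unfold Re in Hz; lra. }
  assert (Hdn : forall n al, (-1 <= Re al + INR n <= 0)%R -> abel_at al).
  { induction n as [|n IH]; intros z Hz.
    - intros d K; apply abel_base; simpl in Hz; lra.
    - rewrite S_INR in Hz; apply abel_down.
      + pose proof (pos_INR n); lra.
      + apply IH; simpl; unfold Re in Hz; lra. }
  destruct (Rle_dec 0 (Re al)) as [H|H].
  - destruct (nfloor_ex (Re al) H) as [n Hn].
    apply (Hup (S n)); rewrite S_INR; lra.
  - destruct (nfloor_ex (- Re al) ltac:(lra)) as [n Hn].
    apply (Hdn n); lra.
Qed.

(** * The Gamma function *)

Lemma tends_cauchy (u : nat -> C) :
  (forall eps, (0 < eps)%R -> exists N, forall n m, (N <= n)%nat -> (N <= m)%nat ->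
     (Cmod (u n - u m) < eps)%R) ->
  exists l, tends eventually u l.
Proof.
  intros H.
  assert (H1 : ex_finite_lim_seq (fun n => Re (u n))).
  { apply ex_lim_seq_cauchy_corr; intros eps.
    destruct (H eps (cond_pos eps)) as [N HN]; exists N; intros n m Hn Hm.
    eapply Rle_lt_trans; [|apply (HN n m Hn Hm)].
    eapply Rle_trans; [|apply re_le_Cmod]; apply Req_le; reflexivity. }
  assert (H2 : ex_finite_lim_seq (fun n => Im (u n))).
  { apply ex_lim_seq_cauchy_corr; intros eps.
    destruct (H eps (cond_pos eps)) as [N HN]; exists N; intros n m Hn Hm.
    eapply Rle_lt_trans; [|apply (HN n m Hn Hm)].
    eapply Rle_trans; [|apply im_le_Cmod]; apply Req_le; reflexivity. }
  destruct H1 as [l1 H1], H2 as [l2 H2]; exists (l1, l2).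
  apply is_lim_seq_spec in H1; apply is_lim_seq_spec in H2.
  intros eps He.
  generalize (filter_and (F := eventually) _ _
    (H1 (mkposreal (eps / 2) ltac:(lra))) (H2 (mkposreal (eps / 2) ltac:(lra)))).
  apply filter_imp; intros n [G1 G2]; simpl in G1, G2.
  eapply Rle_lt_trans; [apply Cmod_le_add|].
  change (Rabs (Re (u n) - l1) + Rabs (Im (u n) - l2) < eps)%R; lra.
Qed.

Lemma CLim_seq_tends (u : nat -> C) (l : C) :
  tends eventually u l -> CLim_seq u = l.
Proof.
  intros H; unfold CLim_seq.
  assert (H1 : is_lim_seq (fun n => Re (u n)) (Re l)).
  { apply is_lim_seq_spec; intros eps; generalize (H eps (cond_pos eps)).
    apply filter_imp; intros n Hn; eapply Rle_lt_trans; [|exact Hn].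
    eapply Rle_trans; [|apply re_le_Cmod]; apply Req_le; reflexivity. }
  assert (H2 : is_lim_seq (fun n => Im (u n)) (Im l)).
  { apply is_lim_seq_spec; intros eps; generalize (H eps (cond_pos eps)).
    apply filter_imp; intros n Hn; eapply Rle_lt_trans; [|exact Hn].
    eapply Rle_trans; [|apply im_le_Cmod]; apply Req_le; reflexivity. }
  rewrite (is_lim_seq_unique _ _ H1), (is_lim_seq_unique _ _ H2).
  symmetry; apply C_eta.
Qed.

(* [|u n| exp (D / n)] decreases and [|u n| exp (-2 D / n)] increases. *)
Lemma product_converges (u : nat -> C) (D : R) (n0 : nat) : (0 <= D)%R ->
  (forall n, (n0 <= n)%nat -> u n <> 0) ->
  (forall n, (n0 <= n)%nat ->
     Cmod (u (S n) - u n) <= D * (/ INR (S n)) ^ 2 * Cmod (u n))%R ->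
  exists l : C, l <> 0 /\ tends eventually u l.
Proof.
  intros HD Hnz Hu.
  destruct (INR_unbounded (2 * D)) as [n1 Hn1].
  set (N := S (Nat.max n0 n1)).
  assert (HN0 : forall n, (N <= n)%nat -> (n0 <= n)%nat /\ (1 <= INR n)%R /\
    (2 * D <= INR n)%R).
  { intros n Hn; unfold N in Hn; split; [lia|]; split.
    - apply (le_INR 1); lia.
    - assert (INR n1 <= INR n)%R by (apply le_INR; lia); lra. }
  (* The telescoping difference on the right makes the two exponential corrections monotone and,
     later, the sequence Cauchy. *)
  assert (Hstep : forall n, (N <= n)%nat ->
    (0 <= / INR (S n) ^ 2 <= / INR n - / INR (S n))%R).
  { intros n Hn; destruct (HN0 n Hn) as [_ [H1 _]]; rewrite S_INR; split.
    - apply Rlt_le, Rinv_0_lt_compat, pow_lt; lra.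
    - replace (/ INR n - / (INR n + 1))%R with (/ (INR n * (INR n + 1)))%R
        by (field; lra).
      apply Rinv_le_contravar; nra. }
  assert (Hup : forall n, (N <= n)%nat ->
    (Cmod (u n) * exp (D * / INR n) <= Cmod (u N) * exp (D * / INR N))%R).
  { intros n Hn; induction Hn as [|n Hn IH]; [lra|].
    eapply Rle_trans; [|exact IH].
    destruct (HN0 n Hn) as [Ha [Hb _]]; destruct (Hstep n Hn) as [Hc Hd].
    pose proof (Hu n Ha) as He; rewrite pow_inv in He.
    pose proof (Cmod_ge_0 (u n)) as Hp.
    assert (Hm : (Cmod (u (S n)) <= Cmod (u n) * (1 + D * / INR (S n) ^ 2))%R).
    { replace (u (S n)) with (u n + (u (S n) - u n)) by ring.
      eapply Rle_trans; [apply Cmod_triangle|].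
      replace (u n + (u (S n) - u n)) with (u (S n)) in * by ring; lra. }
    pose proof (exp_ineq1_le (D * / INR (S n) ^ 2)) as Hx.
    assert (Hm' : (Cmod (u (S n)) <= Cmod (u n) * exp (D * / INR (S n) ^ 2))%R).
    { eapply Rle_trans; [exact Hm|]; apply Rmult_le_compat_l; lra. }
    apply Rle_trans with
      (Cmod (u n) * exp (D * / INR (S n) ^ 2) * exp (D * / INR (S n)))%R.
    - apply Rmult_le_compat_r; [apply Rlt_le, exp_pos|exact Hm'].
    - rewrite Rmult_assoc, <- exp_plus; apply Rmult_le_compat_l; [exact Hp|].
      apply exp_le_compat; nra. }
  assert (Hdown : forall n, (N <= n)%nat ->
    (Cmod (u N) * exp (- (2 * D) * / INR N) <=
     Cmod (u n) * exp (- (2 * D) * / INR n))%R).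
  { intros n Hn; induction Hn as [|n Hn IH]; [lra|].
    eapply Rle_trans; [exact IH|].
    destruct (HN0 n Hn) as [Ha [Hb Hb2]]; destruct (Hstep n Hn) as [Hc Hd].
    pose proof (Hu n Ha) as He; rewrite pow_inv in He.
    pose proof (Cmod_ge_0 (u n)) as Hp.
    set (x := (D * / INR (S n) ^ 2)%R) in *.
    assert (Hx0 : (0 <= x)%R) by (apply Rmult_le_pos; lra).
    assert (Hx1 : (2 * x <= 1)%R).
    { assert (0 < INR (S n) ^ 2)%R by (apply pow_lt; rewrite S_INR; lra).
      apply Rmult_le_reg_r with (INR (S n) ^ 2)%R; [lra|].
      unfold x; rewrite !Rmult_assoc, Rinv_l, Rmult_1_l, Rmult_1_r by lra.
      rewrite S_INR; nra. }
    assert (Hm : (Cmod (u n) * (1 - x) <= Cmod (u (S n)))%R).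
    { pose proof (Cmod_ge_sub (u n) (u (S n) - u n)) as Hg.
      replace (u n + (u (S n) - u n)) with (u (S n)) in Hg by ring; lra. }
    (* From [exp (2 x) >= 1 + 2 x] and [(1 + 2 x) (1 - x) >= 1], the latter for [0 <= x <= 1/2]. *)
    assert (Hex : (exp (- (2 * x)) <= 1 - x)%R).
    { pose proof (exp_ineq1_le (2 * x)) as Hy.
      rewrite exp_Ropp; apply Rmult_le_reg_r with (exp (2 * x));
        [apply exp_pos|].
      rewrite Rinv_l by (pose proof (exp_pos (2 * x)); lra); nra. }
    apply Rle_trans with
      (Cmod (u n) * exp (- (2 * x)) * exp (- (2 * D) * / INR (S n)))%R.
    - rewrite Rmult_assoc, <- exp_plus; apply Rmult_le_compat_l; [exact Hp|].
      apply exp_le_compat; unfold x; nra.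
    - apply Rmult_le_compat_r; [apply Rlt_le, exp_pos|].
      eapply Rle_trans; [|exact Hm]; apply Rmult_le_compat_l; lra. }
  set (B := (Cmod (u N) * exp (D * / INR N))%R) in *.
  set (b := (Cmod (u N) * exp (- (2 * D) * / INR N))%R) in *.
  assert (Hb : (0 < b)%R).
  { apply Rmult_lt_0_compat; [|apply exp_pos].
    apply Cmod_gt_0, Hnz, HN0; lia. }
  assert (HB : forall n, (N <= n)%nat -> (Cmod (u n) <= B)%R).
  { intros n Hn; eapply Rle_trans; [|exact (Hup n Hn)].
    apply Rle_trans with (Cmod (u n) * 1)%R; [lra|].
    apply Rmult_le_compat_l; [apply Cmod_ge_0|].
    rewrite <- exp_0; apply exp_le_compat, Rmult_le_pos; [exact HD|].
    destruct (HN0 n Hn) as [_ [H1 _]]; apply Rlt_le, Rinv_0_lt_compat; lra. }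
  assert (Hlow : forall n, (N <= n)%nat -> (b <= Cmod (u n))%R).
  { intros n Hn; eapply Rle_trans; [exact (Hdown n Hn)|].
    apply Rle_trans with (Cmod (u n) * 1)%R; [|lra].
    apply Rmult_le_compat_l; [apply Cmod_ge_0|].
    destruct (HN0 n Hn) as [_ [H1 _]].
    assert (0 < / INR n)%R by (apply Rinv_0_lt_compat; lra).
    rewrite <- exp_0; apply exp_le_compat; nra. }
  assert (HBp : (0 <= B)%R)
    by (eapply Rle_trans; [apply Cmod_ge_0|apply (HB N); lia]).
  assert (HDB : (0 <= D * B)%R) by now apply Rmult_le_pos.
  assert (Hdiff : forall n m, (N <= n)%nat -> (n <= m)%nat ->
    (Cmod (u m - u n) <= D * B * (/ INR n - / INR m))%R).
  { intros n m Hn Hm; induction Hm as [|m Hm IH].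
    - replace (u n - u n) with (RtoC 0) by ring; rewrite Cmod_0; lra.
    - assert (HNm : (N <= m)%nat) by lia.
      destruct (HN0 m HNm) as [Ha _]; destruct (Hstep m HNm) as [Hc Hd].
      pose proof (Hu m Ha) as He; rewrite pow_inv in He.
      replace (u (S m) - u n) with ((u (S m) - u m) + (u m - u n)) by ring.
      eapply Rle_trans; [apply Cmod_triangle|].
      assert (D * / INR (S m) ^ 2 * Cmod (u m) <= D * / INR (S m) ^ 2 * B)%R.
      { apply Rmult_le_compat_l; [apply Rmult_le_pos; lra|now apply HB]. }
      assert (D * B * / INR (S m) ^ 2 <= D * B * (/ INR m - / INR (S m)))%R
        by (apply Rmult_le_compat_l; lra).
      lra. }
  destruct (tends_cauchy u) as [l Hl].
  { intros eps He.
    destruct (INR_unbounded (D * B / eps)) as [n2 Hn2].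
    exists (N + n2)%nat.
    assert (Haux : forall n m, (N + n2 <= n)%nat -> (n <= m)%nat ->
      (Cmod (u m - u n) < eps)%R).
    { intros n m Hn Hm.
      destruct (HN0 n ltac:(lia)) as [_ [H1 _]].
      destruct (HN0 m ltac:(lia)) as [_ [H2 _]].
      assert (H3 : (INR n2 <= INR n)%R) by (apply le_INR; lia).
      eapply Rle_lt_trans; [apply Hdiff; lia|].
      assert (0 < / INR m)%R by (apply Rinv_0_lt_compat; lra).
      apply Rle_lt_trans with (D * B * / INR n)%R.
      - apply Rmult_le_compat_l; lra.
      - apply Rmult_lt_reg_r with (INR n); [lra|].
        rewrite Rmult_assoc, Rinv_l, Rmult_1_r by lra.
        replace (D * B)%R with (D * B / eps * eps)%R by (field; lra).
        rewrite (Rmult_comm eps); apply Rmult_lt_compat_r; lra. }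
    intros n m Hn Hm; destruct (Nat.le_ge_cases n m).
    - rewrite <- Cmod_opp; replace (- (u n - u m)) with (u m - u n) by ring.
      apply Haux; lia.
    - apply Haux; lia. }
  exists l; split; [|exact Hl].
  (* The lower bound [b] on the moduli excludes the limit 0. *)
  intros E; destruct (Hl b Hb) as [n2 H2].
  specialize (H2 (N + n2)%nat ltac:(lia)); specialize (Hlow (N + n2)%nat ltac:(lia)).
  rewrite E in H2; replace (u (N + n2)%nat - 0) with (u (N + n2)%nat) in H2 by ring.
  lra.
Qed.

Definition euler_seq (z : C) (n : nat) : C :=
  INR (fact n) * Cpower (INR n) z / pochhammer z (S n).

Lemma euler_seq_S (z : C) (n : nat) : ~ nonpos_integer z ->
  euler_seq z (S (S n)) = euler_seq z (S n) *
   (Cexp (z * RtoC (ln (INR (S (S n))) - ln (INR (S n))))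
     / (1 + z * RtoC (/ INR (S (S n))))).
Proof.
  intros Hz; unfold euler_seq.
  assert (HS : RtoC (INR (S (S n))) <> 0)
    by (apply RtoC_INR_S).
  rewrite Cpower_INR_S, (fact_simpl (S n)), mult_INR, RtoC_mult, RtoC_inv
    by (pose proof (INR_S_pos (S n)); lra).
  change (pochhammer z (S (S (S n)))) with
    (pochhammer z (S (S n)) * (z + INR (S (S n)))).
  pose proof (add_INR_neq_0 z (S (S n)) Hz).
  assert (1 + z * / INR (S (S n)) <> 0).
  { replace (1 + z * / INR (S (S n))) with ((z + INR (S (S n))) / INR (S (S n)))
      by (field; auto).
    apply Cmult_neq_0; [auto|]; intros E; apply C1_nz.
    rewrite <- (Cinv_r (INR (S (S n)))), E by auto; ring. }
  pose proof (pochhammer_neq_0 z (S (S n)) Hz).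
  field; repeat split; auto.
  intros E; apply H; rewrite <- E; ring.
Qed.

(** The ratio of consecutive Euler terms is [exp (z L) / (1 + z h)] with [L = h + O (h^2)], hence
    [1 + O (h^2)] with [h] of order [1 / n]: the infinite product converges to a nonzero limit.
    Nonvanishing is what permits division by [CGamma] later. *)
Lemma CGamma_spec (z : C) : ~ nonpos_integer z ->
  CGamma z <> 0 /\ tends eventually (euler_seq z) (CGamma z).
Proof.
  intros Hz.
  assert (H : exists l : C, l <> 0 /\ tends eventually (euler_seq z) l).
  2: { destruct H as [l [H1 H2]].
       assert (E : CGamma z = l) by exact (CLim_seq_tends _ _ H2).
       now rewrite E. }
  pose proof (Cmod_ge_0 z) as Hm0.
  destruct (INR_unbounded (2 * Cmod z)) as [n0 Hn0].
  (* A bound for [exp (z L) - 1 - z h] divided by [h^2]: the first term is the second order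
     remainder with [L <= 2 h], and [2 |z|] comes from [L - h <= 2 h^2]. Doubling [A] below pays for
     [|1 + z h| >= 1/2]. *)
  set (A := (16 * Cmod z ^ 2 * exp (Cmod z) + 2 * Cmod z)%R).
  assert (HA : (0 <= A)%R).
  { unfold A; pose proof (pow2_ge_0 (Cmod z)); pose proof (exp_pos (Cmod z)); nra. }
  apply (product_converges _ (2 * A) (S n0)); [lra| |].
  - intros n Hn; unfold euler_seq, Cdiv; repeat apply Cmult_neq_0.
    + apply RtoC_fact_neq_0.
    + apply Cpower_neq_0.
    + intros E; apply C1_nz.
      rewrite <- (Cinv_r (pochhammer z (S n))), E by now apply pochhammer_neq_0.
      ring.
  - intros [|n] Hn; [lia|].
    rewrite euler_seq_S by exact Hz.
    set (L := (ln (INR (S (S n))) - ln (INR (S n)))%R).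
    set (h := (/ INR (S (S n)))%R).
    set (U := euler_seq z (S n)).
    assert (Hh : (0 < h)%R) by apply Rinv_0_lt_compat, INR_S_pos.
    assert (Hh1 : (h * INR (S (S n)) = 1)%R)
      by (apply Rinv_l; pose proof (INR_S_pos (S n)); lra).
    assert (Hn1 : (1 <= INR (S n))%R) by (apply (le_INR 1); lia).
    assert (HL : (h <= L <= h + 2 * h ^ 2)%R).
    { destruct (ln_INR_ratio n) as [H1 H2]; fold h in H1; fold L in H1, H2.
      split; [exact H1|]; eapply Rle_trans; [exact H2|].
      apply Rmult_le_reg_r with (INR (S n)); [lra|].
      rewrite Rinv_l by lra.
      rewrite (S_INR (S n)) in Hh1.
      assert (h <= 1 / 2)%R by nra.
      replace (INR (S n)) with ((1 - h) / h)%R.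
      2: { apply Rmult_eq_reg_r with h; [|lra].
           unfold Rdiv; rewrite Rmult_assoc, Rinv_l; lra. }
      replace ((h + 2 * h ^ 2) * ((1 - h) / h))%R
        with ((1 + 2 * h) * (1 - h))%R by (field; lra).
      nra. }
    assert (Hhz : (Cmod z * h <= 1 / 2)%R).
    { assert (INR n0 <= INR (S (S n)))%R by (apply le_INR; lia).
      assert (2 * Cmod z * h <= INR (S (S n)) * h)%R
        by (apply Rmult_le_compat_r; lra).
      lra. }
    assert (Hh2 : (h <= 1 / 2)%R) by (rewrite (S_INR (S n)) in Hh1; nra).
    assert (HL1 : (L <= 1)%R) by nra.
    assert (HL2 : (L <= 2 * h)%R) by nra.
    assert (Hden : (1 / 2 <= Cmod (1 + z * h))%R).
    { pose proof (Cmod_ge_sub 1 (z * h)) as Hg.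
      rewrite Cmod_1, Cmod_mult, (Cmod_RtoC_nonneg h) in Hg by lra; lra. }
    assert (Hd0 : 1 + z * h <> 0) by (apply Cmod_gt_0; lra).
    assert (Hnum : (Cmod (Cexp (z * L) - 1 - z * h) <= A * h ^ 2)%R).
    { replace (Cexp (z * L) - 1 - z * h) with
        ((Cexp (z * L) - 1 - z * L) + z * RtoC (L - h))
        by (rewrite RtoC_minus; ring).
      eapply Rle_trans; [apply Cmod_triangle|].
      pose proof (Cexp_sub_1_sub (z * L)) as He.
      rewrite !Cmod_mult, !(Cmod_RtoC_nonneg L) in He by lra.
      rewrite Cmod_mult, (Cmod_RtoC_nonneg (L - h)) by lra.
      assert (exp (Cmod z * L) <= exp (Cmod z))%R
        by (apply exp_le_compat; nra).
      assert ((Cmod z * L) ^ 2 <= (Cmod z * (2 * h)) ^ 2)%R.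
      { apply pow_incr; split; [apply Rmult_le_pos; lra|].
        apply Rmult_le_compat_l; lra. }
      assert (4 * (Cmod z * L) ^ 2 * exp (Cmod z * L) <=
        4 * (Cmod z * (2 * h)) ^ 2 * exp (Cmod z))%R.
      { apply Rmult_le_compat; try lra.
        - pose proof (pow2_ge_0 (Cmod z * L)); lra.
        - apply Rlt_le, exp_pos. }
      assert (Cmod z * (L - h) <= Cmod z * (2 * h ^ 2))%R
        by (apply Rmult_le_compat_l; lra).
      unfold A; nra. }
    replace (U * (Cexp (z * L) / (1 + z * h)) - U) with
      ((Cexp (z * L) - 1 - z * h) / (1 + z * h) * U) by (field; auto).
    rewrite Cmod_mult, Cmod_div by auto.
    apply Rmult_le_compat_r; [apply Cmod_ge_0|].
    apply Rle_div_l; [lra|].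
    eapply Rle_trans; [exact Hnum|].
    assert (0 <= A * h ^ 2)%R by (apply Rmult_le_pos; [lra|apply pow2_ge_0]).
    nra.
Qed.

(** The quotient of the Euler sequences of [c] and [a]: the factorials cancel and leave
    [n^(c - a) (a)_(n+1) / (c)_(n+1)]. The power ratio then corrects [n^(c - a)] to
    [(n + 1)^(c - a)]. *)
Lemma pochhammer_quotient_tends (a c : C) :
  ~ nonpos_integer a -> ~ nonpos_integer c ->
  tends eventually (fun n => pochhammer a n / pochhammer c n
    * Cpower (INR n) (c - a)) (CGamma c / CGamma a).
Proof.
  intros Ha Hc.
  destruct (CGamma_spec a Ha) as [Ga La]; destruct (CGamma_spec c Hc) as [Gc Lc].
  apply tends_shift, tends_shift.
  apply tends_shift in La; apply tends_shift in Lc.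
  replace (CGamma c / CGamma a) with (CGamma c * / CGamma a * 1)
    by (field; auto).
  eapply tends_ext_loc; [apply _| |apply (tends_mult _ _ _ _ _
    (tends_mult _ _ _ _ _ Lc (tends_inv _ _ _ Ga La))
    (Cpower_ratio_tends (c - a)))].
  apply filter_forall; intros n; unfold euler_seq.
  rewrite (Cpower_INR_S n (c - a)).
  set (X := Cexp _); unfold Cminus; rewrite Cpower_plus, Cpower_opp.
  pose proof (Cpower_neq_0 (INR (S n)) a); pose proof (Cpower_neq_0 (INR (S n)) c).
  pose proof (pochhammer_neq_0 a (S (S n)) Ha).
  pose proof (pochhammer_neq_0 c (S (S n)) Hc).
  pose proof (RtoC_fact_neq_0 (S n)).
  field; repeat split; auto.
Qed.

(** [abel] gives the limit on the positive axis and [knorm_chord] transports it to the cone. The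
    threshold concerns [|z|] only, so the limit is uniform in the direction. *)
Lemma knorm_tends (a c : C) (kappa : R) :
  ~ nonpos_integer a -> ~ nonpos_integer c -> (0 < kappa <= 1)%R ->
  forall eps, (0 < eps)%R -> exists r0, (0 < r0)%R /\
    forall z, cone kappa z -> (r0 <= Cmod z)%R ->
      (Cmod (knorm (c - a) a c z - CGamma c / CGamma a) <= eps)%R.
Proof.
  intros Ha Hc Hk eps He.
  destruct (knorm_chord a c kappa Hc Hk) as [r1 [K [Hr1 [HK H1]]]].
  assert (H2 : tends (Rbar_locally p_infty)
    (fun r : R => Cpower r (c - a) * Cexp (- RtoC r) * CPS (kcoef a c) r)
    (CGamma c / CGamma a)).
  { apply abel; [|now apply pochhammer_quotient_tends].
    destruct (pochhammer_quotient_geometric a c Hc) as [D [HD H]].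
    exists D, 2%R; split; [lra|exact H]. }
  destruct (H2 (eps / 2)%R ltac:(lra)) as [r2 Hr2].
  exists (r1 + Rabs r2 + 2 * K / eps + 1)%R.
  pose proof (Rabs_pos r2); pose proof (Rle_abs r2).
  assert (0 <= 2 * K / eps)%R by (apply Rdiv_le_0_compat; lra).
  split; [lra|]; intros z Hz Hm.
  specialize (H1 z Hz ltac:(lra)); specialize (Hr2 (Cmod z) ltac:(lra)).
  assert (K / Cmod z <= eps / 2)%R.
  { apply Rle_div_l; [lra|].
    assert (H5 : (2 * K / eps * eps <= Cmod z * eps)%R)
      by (apply Rmult_le_compat_r; lra).
    replace (2 * K / eps * eps)%R with (2 * K)%R in H5 by (field; lra); lra. }
  replace (knorm (c - a) a c z - CGamma c / CGamma a) with
    ((knorm (c - a) a c z - knorm (c - a) a c (Cmod z)) +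
     (knorm (c - a) a c (Cmod z) - CGamma c / CGamma a)) by ring.
  eapply Rle_trans; [apply Cmod_triangle|].
  unfold knorm at 3, kummer; lra.
Qed.

(** * The binomial series *)

Lemma egf_pochhammer_geo (A : C) (rho : R) : (0 < rho < 1)%R ->
  geo (egf (pochhammer A)) rho.
Proof.
  intros Hr.
  (* From this rank on [|A| + n <= n / rho], so the ratio [(A + n) / (n + 1)] has modulus at most
     [1 / rho]. *)
  destruct (INR_unbounded (Cmod A / (/ rho - 1))) as [n0 Hn0].
  assert (H1 : (1 < / rho)%R)
    by (rewrite <- Rinv_1; apply Rinv_lt_contravar; lra).
  destruct (geometric_bound (fun n => Cmod (egf (pochhammer A) n)) (/ rho) n0)
    as [D [HD H]]; [lra| |].
  - intros n Hn; apply le_INR in Hn; rewrite !Rabs_pos_eq by apply Cmod_ge_0.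
    assert (E : egf (pochhammer A) (S n) =
      (A + INR n) / INR (S n) * egf (pochhammer A) n).
    { unfold egf; cbn [pochhammer]; rewrite fact_simpl, mult_INR, RtoC_mult.
      field; auto using RtoC_fact_neq_0, RtoC_INR_S. }
    rewrite E, Cmod_mult; apply Rmult_le_compat_r; [apply Cmod_ge_0|].
    rewrite Cmod_div_R by apply INR_S_pos.
    apply Rle_div_l; [apply INR_S_pos|].
    eapply Rle_trans; [apply Cmod_triangle|].
    rewrite (Cmod_RtoC_nonneg (INR n)), S_INR by apply pos_INR.
    assert (H2 : (Cmod A / (/ rho - 1) * (/ rho - 1) <= INR n * (/ rho - 1))%R)
      by (apply Rmult_le_compat_r; lra).
    replace (Cmod A / (/ rho - 1) * (/ rho - 1))%R with (Cmod A) in H2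
      by (field; split; nra).
    nra.
  - exists D; intros n; specialize (H n).
    rewrite Rabs_pos_eq in H by apply Cmod_ge_0.
    rewrite pow_inv in H.
    assert (Hp : (0 < rho ^ n)%R) by (apply pow_lt; lra).
    apply Rmult_le_compat_r with (r := (rho ^ n)%R) in H; [|lra].
    rewrite Rmult_assoc, Rinv_l in H; lra.
Qed.

Lemma cderiv_egf_pochhammer (A : C) (n : nat) :
  cderiv (egf (pochhammer A)) n = A * egf (pochhammer (A + 1)) n.
Proof.
  unfold cderiv, egf; rewrite pochhammer_left, fact_simpl, mult_INR, RtoC_mult.
  field; auto using RtoC_fact_neq_0, RtoC_INR_S.
Qed.

(** Coefficientwise this is Pascal's rule. Together with [cderiv_egf_pochhammer] it becomes the
    equation [(1 - s) F' = A F] satisfied by [(1 - s)^(-A)]. *)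
Lemma CPS_pochhammer_succ (A : C) (s : R) : (0 <= s < 1)%R ->
  (1 - s) * CPS (egf (pochhammer (A + 1))) s = CPS (egf (pochhammer A)) s.
Proof.
  intros Hs; set (rho := ((1 + s) / 2)%R).
  assert (Hz : (Cmod s < rho)%R)
    by (rewrite Cmod_RtoC_nonneg by lra; unfold rho; lra).
  pose proof (egf_pochhammer_geo (A + 1) rho ltac:(unfold rho; lra)) as G.
  replace ((1 - s) * CPS (egf (pochhammer (A + 1))) s) with
    (CPS (egf (pochhammer (A + 1))) s +
      (- (1)) * (s * CPS (egf (pochhammer (A + 1))) s)) by ring.
  assert (G' : geo (cshift (egf (pochhammer (A + 1)))) rho)
    by (apply geo_cshift; [unfold rho; lra|exact G]).
  rewrite <- (CPS_cshift _ _ rho Hz G), <- (CPS_scal _ _ _ rho Hz G'),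
    <- (CPS_plus _ _ _ rho Hz G) by now apply geo_scal.
  apply CPS_ext; intros [|n]; unfold egf; cbn [cshift].
  - simpl; ring.
  - rewrite (pochhammer_left A); cbn [pochhammer].
    rewrite fact_simpl, mult_INR, S_INR, RtoC_mult, RtoC_plus.
    field; split; [apply RtoC_fact_neq_0|apply RtoC_INR_S_neq_0].
Qed.

Lemma CPS_0 (u : nat -> C) (rho : R) : (0 < rho)%R -> geo u rho ->
  CPS u 0 = u O.
Proof.
  intros Hr Hu; assert (Hz : (Cmod 0 < rho)%R) by (rewrite Cmod_0; exact Hr).
  pose proof (geo_summable u rho 0 Hz Hu) as Hs.
  unfold CPS; rewrite CSeries_shift by exact Hs.
  rewrite (CSeries_ext (fun n => u (S n) * 0 ^ S n)
    (fun n => 0 * (u n * 0 ^ n))) by (intros n; rewrite Cpow_S; ring).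
  rewrite CSeries_scal by exact Hs; simpl; ring.
Qed.

(** The product of the series with [(1 - t)^A] has derivative 0 on the segment from 0 to [u], and
    value 1 at 0. *)
Lemma binomial_series (A : C) (u : R) : (0 <= u < 1)%R ->
  CPS (egf (pochhammer A)) u = Cpower (RtoC (1 - u)) (- A).
Proof.
  intros Hu.
  set (f := fun t : R =>
    CPS (egf (pochhammer A)) (0 + RtoC t * 1) * Cpower (1 + RtoC t * (- (1))) A).
  assert (Hf : f u = f 0%R).
  { apply is_derC_zero_eq; [lra|]; intros s Hs.
    assert (Hz : (Cmod (0 + RtoC s * 1) < (1 + s) / 2)%R).
    { replace (0 + RtoC s * 1) with (RtoC s) by ring.
      rewrite Cmod_RtoC_nonneg; lra. }
    assert (Hre : (0 < Re (1 + RtoC s * (- (1))))%R) by (simpl; lra).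
    refine (is_derC_ext _ _ _ _ _ (fun t => eq_refl) _ (is_derC_mult _ _ _ _ _
      (is_derC_CPS _ _ 0 1 s
        (egf_pochhammer_geo A ((1 + s) / 2) ltac:(lra)) Hz)
      (is_derC_Cpower _ A _ _ Hre (is_derC_line 1 (- (1)) s)))).
    rewrite (CPS_ext _ _ _ (cderiv_egf_pochhammer A)).
    rewrite (CPS_scal _ _ _ _ Hz 
      (egf_pochhammer_geo (A + 1) ((1 + s) / 2) ltac:(lra))).
    replace (0 + RtoC s * 1) with (RtoC s) by ring.
    replace (1 + RtoC s * (- (1))) with (1 - RtoC s) in * by ring.
    rewrite <- (CPS_pochhammer_succ A s) by lra.
    field; intros E; rewrite E in Hre; simpl in Hre; lra. }
  unfold f in Hf.
  replace (0 + RtoC u * 1) with (RtoC u) in Hf by ring.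
  replace (1 + RtoC u * (- (1))) with (RtoC (1 - u)) in Hf
    by (rewrite RtoC_minus; ring).
  replace (0 + RtoC 0 * 1) with (RtoC 0) in Hf by ring.
  replace (1 + RtoC 0 * (- (1))) with (RtoC 1) in Hf by ring.
  assert (E1 : Cpower 1 A = 1).
  { rewrite Cpower_RtoC, ln_1, Cmult_0_r by lra; apply Cexp_0. }
  assert (E2 : CPS (egf (pochhammer A)) 0 = 1).
  { rewrite (CPS_0 _ (1 / 2)) by (try apply egf_pochhammer_geo; lra).
    unfold egf; simpl; field; apply C1_nz. }
  rewrite E1, E2, Cmult_1_l in Hf.
  rewrite Cpower_opp, <- (Cmult_1_l (/ _)), <- Hf; field; apply Cpower_neq_0.
Qed.

(** * Domination for the moments of the beta distribution *)

(** The coefficient [(p)_k / k!] of [u^k] in [(1 - u)^(-p)]. *)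
Definition ecoef (p : C) (k : nat) : C := egf (pochhammer p) k.

Lemma ecoef_S (p : C) (k : nat) :
  INR (S k) * ecoef p (S k) = (p + INR k) * ecoef p k.
Proof.
  unfold ecoef, egf; cbn [pochhammer]; rewrite fact_simpl, mult_INR, RtoC_mult.
  field; auto using RtoC_fact_neq_0, RtoC_INR_S.
Qed.

Lemma ecoef_S_shift (p : C) (k : nat) :
  INR (S k) * ecoef p (S k) = p * ecoef (p + 1) k.
Proof.
  exact (cderiv_egf_pochhammer p k).
Qed.

(** The sum times [N + 1] is split by [N + 1 = k + (N + 1 - k)]. Each part lowers one index through
    [ecoef_S], and the factors [p + k] and [q + N - k] add up to [p + q + N]. *)
Lemma vandermonde (p q : C) (N : nat) :
  Csum (fun k => ecoef p k * ecoef q (N - k)) (S N) = ecoef (p + q) N.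
Proof.
  induction N as [|N IH].
  - cbn [Csum]; unfold ecoef, egf; simpl; field; apply C1_nz.
  - assert (HS : RtoC (INR (S N)) <> 0)
      by (apply RtoC_INR_S).
    assert (E1 : Csum (fun k => INR k * ecoef p k * ecoef q (S N - k)) (S (S N))
      = Csum (fun k => (p + INR k) * ecoef p k * ecoef q (N - k)) (S N)).
    { rewrite Csum_first; simpl (INR 0).
      replace (0 * ecoef p 0 * ecoef q (S N - 0)) with (RtoC 0) by ring.
      rewrite Cplus_0_l; apply Csum_ext; intros k Hk.
      now rewrite ecoef_S. }
    assert (E2 : Csum (fun k => INR (S N - k) * ecoef p k * ecoef q (S N - k))
      (S (S N)) = Csum (fun k => (q + INR (N - k)) * ecoef p k * ecoef q (N - k))
      (S N)).
    { change (Csum ?f (S (S N))) with (Csum f (S N) + f (S N)).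
      cbv beta; rewrite Nat.sub_diag; simpl (INR 0).
      replace (0 * ecoef p (S N) * ecoef q 0) with (RtoC 0) by ring.
      rewrite Cplus_0_r; apply Csum_ext; intros k Hk.
      rewrite Nat.sub_succ_l by lia.
      replace (INR (S (N - k)) * ecoef p k * ecoef q (S (N - k))) with
        (ecoef p k * (INR (S (N - k)) * ecoef q (S (N - k)))) by ring.
      rewrite ecoef_S; ring. }
    assert (E3 : INR (S N) *
        Csum (fun k => ecoef p k * ecoef q (S N - k)) (S (S N)) =
      INR (S N) * ecoef (p + q) (S N)).
    { rewrite ecoef_S, <- IH, <- !Csum_scal.
      transitivity (Csum (fun k => INR k * ecoef p k * ecoef q (S N - k)) (S (S N))
        + Csum (fun k => INR (S N - k) * ecoef p k * ecoef q (S N - k)) (S (S N))).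
      - rewrite <- Csum_plus; apply Csum_ext; intros k Hk.
        rewrite minus_INR, RtoC_minus by lia; ring.
      - rewrite E1, E2, <- Csum_plus; apply Csum_ext; intros k Hk.
        rewrite minus_INR, RtoC_minus by lia; ring. }
    apply (f_equal (Cmult (/ INR (S N)))) in E3.
    rewrite !Cmult_assoc, Cinv_l, !Cmult_1_l in E3 by auto; exact E3.
Qed.

(* The beta-binomial weights, i.e. the beta integrals of Bernstein's basis. *)
Definition beta_weight (b c : C) (N k : nat) : C :=
  INR (fact N) / pochhammer c N * (ecoef b k * ecoef (c - b) (N - k)).

(* [C(N - m, k - m) / C(N, k)]; the value is 0 for [N < m], because the factor
   of index [j = N] is [0 / 0 = 0]. *)
Fixpoint falling_ratio (N k m : nat) : R :=
  match m with
  | O => 1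
  | S j => falling_ratio N k j * (INR (k - j) / INR (N - j))
  end%R.

Lemma falling_ratio_S (N k m : nat) :
  falling_ratio (S N) (S k) (S m) =
  (INR (S k) / INR (S N) * falling_ratio N k m)%R.
Proof.
  induction m as [|m IH].
  - simpl; ring.
  - change (falling_ratio (S N) (S k) (S (S m))) with
      (falling_ratio (S N) (S k) (S m) * (INR (S k - S m) / INR (S N - S m)))%R.
    rewrite IH; simpl Nat.sub; cbn [falling_ratio]; ring.
Qed.

Lemma falling_ratio_0 (N m : nat) : falling_ratio N O (S m) = 0%R.
Proof.
  induction m as [|m IH].
  - simpl; unfold Rdiv; ring.
  - change (falling_ratio N 0 (S (S m))) with
      (falling_ratio N 0 (S m) * (INR (0 - S m) / INR (N - S m)))%R.
    rewrite IH; ring.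
Qed.

Lemma falling_ratio_N0 (k m : nat) : falling_ratio O k (S m) = 0%R.
Proof.
  induction m as [|m IH].
  - simpl; unfold Rdiv; rewrite Rinv_0; ring.
  - change (falling_ratio 0 k (S (S m))) with
      (falling_ratio 0 k (S m) * (INR (k - S m) / INR (0 - S m)))%R.
    rewrite IH; ring.
Qed.

Lemma falling_ratio_factor (N k j : nat) : (0 < N)%nat -> (k <= N)%nat ->
  (0 <= INR (k - j) / INR (N - j) <= 1)%R /\
  (Rabs (INR (k - j) / INR (N - j) - INR k / INR N) <= INR j / INR N)%R.
Proof.
  intros HN Hk.
  assert (HN' : (0 < INR N)%R) by (apply lt_0_INR; lia).
  assert (Hk' : (INR k <= INR N)%R) by now apply le_INR.
  pose proof (pos_INR k); pose proof (pos_INR j).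
  destruct (Nat.le_gt_cases k j) as [Hkj|Hkj].
  (* Truncated subtraction gives 0 here. The case [N <= j], where the denominator vanishes, is
     included since [k <= N]. *)
  - replace (k - j)%nat with O by lia; simpl (INR 0).
    unfold Rdiv; rewrite !Rmult_0_l.
    assert (INR k <= INR j)%R by now apply le_INR.
    split; [lra|].
    rewrite Rminus_0_l, Rabs_Ropp, Rabs_pos_eq
      by (apply Rmult_le_pos; [lra|apply Rlt_le, Rinv_0_lt_compat; lra]).
    apply Rmult_le_compat_r; [apply Rlt_le, Rinv_0_lt_compat|]; lra.
  - rewrite !minus_INR by lia.
    assert (INR j < INR k)%R by now apply lt_INR.
    assert (Hd : (0 < INR N - INR j)%R) by lra.
    split; [split|].
    + apply Rdiv_le_0_compat; lra.
    + apply Rle_div_l; lra.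
    + replace ((INR k - INR j) / (INR N - INR j) - INR k / INR N)%R with
        (- (INR j / INR N * ((INR N - INR k) / (INR N - INR j))))%R
        by (field; lra).
      assert (0 <= INR j / INR N)%R by (apply Rdiv_le_0_compat; lra).
      assert (0 <= (INR N - INR k) / (INR N - INR j) <= 1)%R.
      { split; [apply Rdiv_le_0_compat; lra|].
        apply Rle_div_l; lra. }
      rewrite Rabs_Ropp, Rabs_pos_eq by (apply Rmult_le_pos; lra); nra.
Qed.

Lemma INR_ratio_bounds (N k : nat) : (0 < N)%nat -> (k <= N)%nat ->
  (0 <= INR k / INR N <= 1)%R.
Proof.
  intros HN Hk; apply lt_INR in HN; apply le_INR in Hk; simpl in HN.
  pose proof (pos_INR k); split; [apply Rdiv_le_0_compat|apply Rle_div_l]; lra.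
Qed.

(** The factors are replaced by [k / N] one at a time, and the errors [j / N] for [j < m] add up to
    at most [m^2 / N]. This links the exact moments of the weights to powers of the points
    [k / N]. *)
Lemma falling_ratio_close (N k m : nat) : (0 < N)%nat -> (k <= N)%nat ->
  (0 <= falling_ratio N k m <= 1)%R /\
  (Rabs (falling_ratio N k m - (INR k / INR N) ^ m) <= INR m ^ 2 / INR N)%R.
Proof.
  intros HN Hk.
  assert (HN' : (0 < INR N)%R) by (apply lt_0_INR; lia).
  pose proof (INR_ratio_bounds N k HN Hk) as Hs.
  set (s := (INR k / INR N)%R) in *.
  induction m as [|m [IH1 IH2]].
  - simpl; split; [lra|].
    replace (1 - 1)%R with 0%R by ring; rewrite Rabs_R0.
    unfold Rdiv; lra.
  - destruct (falling_ratio_factor N k m HN Hk) as [H1 H2]; fold s in H2.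
    cbn [falling_ratio]; set (x := (INR (k - m) / INR (N - m))%R) in *.
    set (f := falling_ratio N k m) in *.
    split; [nra|].
    replace (f * x - s ^ S m)%R with (f * (x - s) + s * (f - s ^ m))%R
      by (simpl; ring).
    eapply Rle_trans; [apply Rabs_triang|]; rewrite !Rabs_mult.
    rewrite (Rabs_pos_eq f), (Rabs_pos_eq s) by lra.
    rewrite S_INR; pose proof (pos_INR m).
    replace ((INR m + 1) ^ 2 / INR N)%R with
      (INR m / INR N + INR m ^ 2 / INR N + (INR m + 1) / INR N)%R
      by (field; lra).
    assert (0 <= (INR m + 1) / INR N)%R by (apply Rdiv_le_0_compat; lra).
    pose proof (Rabs_pos (x - s)); pose proof (Rabs_pos (f - s ^ m)).
    nra.
Qed.

(** Size biasing: multiplication by [k / N] turns the weights of [(b, c)] into those of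
    [(b + 1, c + 1)], times the first moment [b / c], just as multiplication by [t] does for the
    beta density. *)
Lemma beta_weight_S (b c : C) (N k : nat) : ~ nonpos_integer c ->
  beta_weight b c (S N) (S k) * RtoC (INR (S k) / INR (S N)) =
  b / c * beta_weight (b + 1) (c + 1) N k.
Proof.
  intros Hc; unfold beta_weight.
  pose proof (INR_S_pos N) as HN.
  assert (HN0 : RtoC (INR (S N)) <> 0) by (apply RtoC_neq_0; lra).
  rewrite RtoC_div by lra; rewrite fact_simpl, mult_INR, RtoC_mult.
  rewrite (pochhammer_left c).
  replace (c + 1 - (b + 1)) with (c - b) by ring.
  simpl (S N - S k)%nat.
  pose proof (pochhammer_neq_0 c (S N) Hc) as Hp; rewrite pochhammer_left in Hp.
  assert (Hc0 : c <> 0) by (intros E; apply Hp; rewrite E; ring).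
  assert (Hp' : pochhammer (c + 1) N <> 0)
    by (intros E; apply Hp; rewrite E; ring).
  transitivity (INR (fact N) / (c * pochhammer (c + 1) N) *
    ((INR (S k) * ecoef b (S k)) * ecoef (c - b) (N - k))).
  - field; auto.
  - rewrite ecoef_S_shift; field; auto.
Qed.

Lemma nonpos_integer_succ (c : C) : ~ nonpos_integer c -> ~ nonpos_integer (c + 1).
Proof.
  intros Hc [k Hk]; apply Hc; exists (S k).
  rewrite S_INR, RtoC_plus; replace c with (c + 1 - 1) by ring; rewrite Hk; ring.
Qed.

(** Each size biasing step produces one factor [(b + j) / (c + j)]; the total mass 1, for [m = 0],
    is Vandermonde's identity. With [falling_ratio] in place of powers, the moments of order at most
    [N] are exact. *)
Lemma beta_weight_moment (m N : nat) (b c : C) : ~ nonpos_integer c ->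
  Csum (fun k => beta_weight b c N k * falling_ratio N k m) (S N) =
  if (m <=? N)%nat then pochhammer b m / pochhammer c m else 0.
Proof.
  revert N b c; induction m as [|m IH]; intros N b c Hc.
  - simpl (0 <=? N)%nat; cbv iota.
    pose proof (pochhammer_neq_0 c N Hc).
    transitivity (INR (fact N) / pochhammer c N *
      Csum (fun k => ecoef b k * ecoef (c - b) (N - k)) (S N)).
    + rewrite <- Csum_scal; apply Csum_ext; intros k _.
      unfold beta_weight; simpl falling_ratio; ring.
    + rewrite vandermonde; replace (b + (c - b)) with c by ring.
      unfold ecoef, egf; simpl; field;
        repeat split; auto using C1_nz, RtoC_fact_neq_0.
  - destruct N as [|N].
    + simpl (S m <=? 0)%nat; cbv iota.
      cbn [Csum]; rewrite falling_ratio_N0; ring.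
    + rewrite Csum_first, falling_ratio_0.
      transitivity (b / c * Csum (fun k => beta_weight (b + 1) (c + 1) N k *
        falling_ratio N k m) (S N)).
      * rewrite <- Csum_scal, Cmult_0_r, Cplus_0_l; apply Csum_ext; intros k _.
        rewrite falling_ratio_S, RtoC_mult, Cmult_assoc, beta_weight_S by auto.
        ring.
      * rewrite IH by now apply nonpos_integer_succ.
        pose proof (pochhammer_neq_0 c (S m) Hc) as Hp.
        rewrite pochhammer_left in Hp.
        assert (Hc0 : c <> 0) by (intros E; apply Hp; rewrite E; ring).
        assert (Hp' : pochhammer (c + 1) m <> 0)
          by (intros E; apply Hp; rewrite E; ring).
        simpl (S m <=? S N)%nat; destruct (m <=? N)%nat; [|ring].
        rewrite (pochhammer_left b), (pochhammer_left c); field; auto.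
Qed.

Lemma Re_pos_not_nonpos_integer (z : C) : (0 < Re z)%R -> ~ nonpos_integer z.
Proof.
  intros H [k Hk]; rewrite Hk in H; simpl in H; pose proof (pos_INR k); lra.
Qed.

(** * Comparison of complex parameters with their real parts *)

Lemma pochhammer_Re_le (c : C) (n : nat) : (0 < Re c)%R ->
  (Cmod (pochhammer (RtoC (Re c)) n) <= Cmod (pochhammer c n))%R.
Proof.
  intros Hc; induction n as [|n IH]; simpl; [lra|].
  rewrite !Cmod_mult; apply Rmult_le_compat; try apply Cmod_ge_0; [exact IH|].
  rewrite <- RtoC_plus, Cmod_R.
  eapply Rle_trans; [|apply re_le_Cmod]; apply Req_le; reflexivity.
Qed.

(** The quotient [(b)_n / (Re b)_n] converges after multiplication by [n^(Re b - b)], a power of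
    modulus 1; hence it is bounded. *)
Lemma pochhammer_Re_bound (b : C) : (0 < Re b)%R ->
  exists A, (0 <= A)%R /\ forall n,
    (Cmod (pochhammer b n) <= A * Cmod (pochhammer (RtoC (Re b)) n))%R.
Proof.
  intros Hb.
  pose proof (Re_pos_not_nonpos_integer b Hb) as H1.
  assert (H2 : ~ nonpos_integer (RtoC (Re b)))
    by now apply Re_pos_not_nonpos_integer.
  destruct (pochhammer_quotient_tends b _ H1 H2 1%R Rlt_0_1) as [N HN].
  destruct (pochhammer_quotient_geometric b _ H2) as [D [HD Hq]].
  set (L := Cmod (CGamma (Re b) / CGamma b)) in *.
  assert (HL : (0 <= L)%R) by apply Cmod_ge_0.
  assert (HDN : (0 <= D * 2 ^ S N)%R)
    by (apply Rmult_le_pos; [exact HD|apply pow_le; lra]).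
  (* [D * 2 ^ S N] covers the indices up to [N], and [L + 1] the later ones. *)
  exists (D * 2 ^ S N + (L + 1))%R; split; [lra|]; intros n.
  assert (H : (Cmod (pochhammer b n / pochhammer (RtoC (Re b)) n) <=
    D * 2 ^ S N + (L + 1))%R).
  { destruct (Nat.le_gt_cases (S N) n) as [Hn|Hn].
    - specialize (HN n ltac:(lia)).
      set (u := pochhammer b n / pochhammer (RtoC (Re b)) n) in *.
      assert (E : Cmod (u * Cpower (INR n) (RtoC (Re b) - b)) = Cmod u).
      { rewrite Cmod_mult, Cmod_Cpower_RtoC by (apply lt_0_INR; lia).
        replace (Re (RtoC (Re b) - b)) with 0%R by (unfold Re; simpl; ring).
        rewrite Rmult_0_l, exp_0; ring. }
      pose proof (Cmod_ge_sub (u * Cpower (INR n) (RtoC (Re b) - b))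
        (- (CGamma (Re b) / CGamma b))) as Hg.
      rewrite Cmod_opp, E in Hg; fold L in Hg.
      unfold Cminus at 1 in HN; lra.
    - eapply Rle_trans; [apply Hq|].
      assert (2 ^ n <= 2 ^ S N)%R by (apply Rle_pow; [lra|lia]).
      assert (D * 2 ^ n <= D * 2 ^ S N)%R by (apply Rmult_le_compat_l; lra).
      lra. }
  pose proof (pochhammer_neq_0 _ n H2) as Hnz.
  pose proof (proj1 (Cmod_gt_0 _) Hnz).
  rewrite Cmod_div in H by exact Hnz.
  apply Rmult_le_compat_r with (r := Cmod (pochhammer (RtoC (Re b)) n)) in H;
    [|lra].
  unfold Rdiv in H; rewrite Rmult_assoc, Rinv_l, Rmult_1_r in H by lra.
  exact H.
Qed.

(** A nonnegative real number kept in [C]. Equality with the modulus makes the triangle inequality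
    an equality for sums of such numbers. *)
Definition is_nonneg (z : C) : Prop := z = RtoC (Cmod z).

Lemma nonneg_RtoC (r : R) : (0 <= r)%R -> is_nonneg r.
Proof. intros H; unfold is_nonneg; now rewrite Cmod_RtoC_nonneg. Qed.

Lemma nonneg_mult (z w : C) : is_nonneg z -> is_nonneg w -> is_nonneg (z * w).
Proof.
  unfold is_nonneg; intros Hz Hw; rewrite Cmod_mult, RtoC_mult; congruence.
Qed.

Lemma nonneg_div (z w : C) : w <> 0 -> is_nonneg z -> is_nonneg w -> is_nonneg (z / w).
Proof.
  unfold is_nonneg; intros H Hz Hw; rewrite Cmod_div, RtoC_div; auto.
  - rewrite <- Hz, <- Hw; reflexivity.
  - apply Cmod_gt_0 in H; lra.
Qed.

Lemma nonneg_pochhammer (r : R) (n : nat) : (0 < r)%R ->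
  is_nonneg (pochhammer (RtoC r) n).
Proof.
  intros Hr; induction n as [|n IH]; simpl.
  - apply nonneg_RtoC; lra.
  - apply nonneg_mult; [exact IH|]; rewrite <- RtoC_plus.
    apply nonneg_RtoC; pose proof (pos_INR n); lra.
Qed.

Lemma nonneg_ecoef (r : R) (n : nat) : (0 < r)%R -> is_nonneg (ecoef (RtoC r) n).
Proof.
  intros Hr; apply nonneg_div.
  - apply RtoC_fact_neq_0.
  - now apply nonneg_pochhammer.
  - apply nonneg_RtoC, pos_INR.
Qed.

Lemma nonneg_beta_weight (r s : R) (N k : nat) : (0 < r < s)%R ->
  is_nonneg (beta_weight r s N k).
Proof.
  intros H; unfold beta_weight; apply nonneg_mult; [apply nonneg_div|].
  - apply pochhammer_neq_0, Re_pos_not_nonpos_integer; simpl; lra.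
  - apply nonneg_RtoC, pos_INR.
  - apply nonneg_pochhammer; lra.
  - rewrite <- RtoC_minus; apply nonneg_mult; apply nonneg_ecoef; lra.
Qed.

Lemma beta_weight_real_sum (r s : R) (N : nat) : (0 < r < s)%R ->
  Rsum (fun k => Cmod (beta_weight r s N k)) (S N) = 1%R.
Proof.
  intros H; apply RtoC_inj; rewrite <- Csum_RtoC.
  assert (Hs : ~ nonpos_integer s)
    by (apply Re_pos_not_nonpos_integer; simpl; lra).
  pose proof (beta_weight_moment 0 N r s Hs) as HM; simpl (0 <=? N)%nat in HM.
  cbv iota in HM; cbn [pochhammer] in HM.
  replace (RtoC 1) with (1 / 1) by (field; apply C1_nz).
  rewrite <- HM; apply Csum_ext; intros k _.
  rewrite <- (nonneg_beta_weight r s N k H); simpl; ring.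
Qed.

Lemma Cmod_ecoef_le (b : C) : (0 < Re b)%R ->
  exists A, (0 <= A)%R /\ forall n,
    (Cmod (ecoef b n) <= A * Cmod (ecoef (RtoC (Re b)) n))%R.
Proof.
  intros Hb; destruct (pochhammer_Re_bound b Hb) as [A [HA H]].
  exists A; split; [exact HA|]; intros n; unfold ecoef, egf.
  rewrite !Cmod_div_R by apply INR_fact_pos.
  unfold Rdiv; rewrite <- Rmult_assoc; apply Rmult_le_compat_r; [|apply H].
  apply Rlt_le, Rinv_0_lt_compat, INR_fact_pos.
Qed.

(** The three Pochhammer factors are compared separately: the numerators by [pochhammer_Re_bound],
    the denominator by [pochhammer_Re_le]. The total variation of the complex weights is thus
    bounded uniformly in [N]. *)
Lemma beta_weight_bound (b c : C) : (0 < Re b)%R -> (Re b < Re c)%R ->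
  exists A, (0 <= A)%R /\ forall N k, (Cmod (beta_weight b c N k) <=
    A * Cmod (beta_weight (RtoC (Re b)) (RtoC (Re c)) N k))%R.
Proof.
  intros Hb Hbc.
  assert (Hcb : (0 < Re (c - b))%R) by (simpl; unfold Re in *; lra).
  destruct (Cmod_ecoef_le b Hb) as [A [HA H1]].
  destruct (Cmod_ecoef_le (c - b) Hcb) as [A' [HA' H2]].
  replace (RtoC (Re (c - b))) with (RtoC (Re c) - RtoC (Re b)) in H2
    by (rewrite <- RtoC_minus; reflexivity).
  exists (A * A')%R; split; [now apply Rmult_le_pos|]; intros N k.
  assert (Hc : ~ nonpos_integer c) by (apply Re_pos_not_nonpos_integer; lra).
  assert (Hc' : ~ nonpos_integer (RtoC (Re c)))
    by (apply Re_pos_not_nonpos_integer; simpl; lra).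
  pose proof (pochhammer_neq_0 _ N Hc) as Hp.
  pose proof (pochhammer_neq_0 _ N Hc') as Hp'.
  pose proof (proj1 (Cmod_gt_0 _) Hp') as Hm.
  unfold beta_weight; rewrite !Cmod_mult, !Cmod_div by assumption.
  set (f := Cmod (INR (fact N))).
  assert (Hf : (0 <= f)%R) by apply Cmod_ge_0.
  assert (H3 : (f / Cmod (pochhammer c N) <=
    f / Cmod (pochhammer (RtoC (Re c)) N))%R).
  { apply Rmult_le_compat_l; [exact Hf|].
    apply Rinv_le_contravar; [exact Hm|apply pochhammer_Re_le; lra]. }
  specialize (H1 k); specialize (H2 (N - k)%nat).
  pose proof (Cmod_ge_0 (ecoef b k)); pose proof (Cmod_ge_0 (ecoef (c - b) (N - k))).
  set (X := Cmod (ecoef (RtoC (Re b)) k)) in *.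
  set (Y := Cmod (ecoef (RtoC (Re c) - RtoC (Re b)) (N - k))) in *.
  assert (HX : (0 <= X)%R) by apply Cmod_ge_0.
  assert (HY : (0 <= Y)%R) by apply Cmod_ge_0.
  apply Rle_trans with (f / Cmod (pochhammer (RtoC (Re c)) N) *
    ((A * X) * (A' * Y)))%R.
  - apply Rmult_le_compat; [| |exact H3|].
    + apply Rdiv_le_0_compat; [exact Hf|now apply Cmod_gt_0].
    + now apply Rmult_le_pos.
    + apply Rmult_le_compat; assumption.
  - apply Req_le; ring.
Qed.

(** Passing to real parts costs a constant; then [Re b + j <= Re c + j] factor by factor. *)
Lemma pochhammer_quotient_bounded (b c : C) : (0 < Re b)%R -> (Re b < Re c)%R ->
  exists A, (0 <= A)%R /\
    forall m, (Cmod (pochhammer b m / pochhammer c m) <= A)%R.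
Proof.
  intros Hb Hbc; destruct (pochhammer_Re_bound b Hb) as [A [HA H]].
  exists A; split; [exact HA|]; intros m.
  assert (Hc : ~ nonpos_integer c) by (apply Re_pos_not_nonpos_integer; lra).
  pose proof (pochhammer_neq_0 _ m Hc) as Hp.
  pose proof (proj1 (Cmod_gt_0 _) Hp) as Hm.
  rewrite Cmod_div by exact Hp.
  apply Rle_div_l; [exact Hm|].
  eapply Rle_trans; [apply H|]; apply Rmult_le_compat_l; [exact HA|].
  eapply Rle_trans; [|apply pochhammer_Re_le; lra].
  clear - Hb Hbc; induction m as [|m IH]; simpl; [lra|].
  rewrite !Cmod_mult; apply Rmult_le_compat; try apply Cmod_ge_0; [exact IH|].
  pose proof (pos_INR m).
  rewrite <- !RtoC_plus, !Cmod_RtoC_nonneg; lra.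
Qed.

Lemma geo_second_moment (phi : nat -> C) (rho : R) : (1 < rho)%R ->
  geo phi rho -> ex_series (fun m => Cmod (phi m) * INR m ^ 2)%R.
Proof.
  intros Hr Hg.
  destruct (INR_sqr_geometric ((1 + rho) / 2) ltac:(lra)) as [D [HD H]].
  apply ex_series_dominated with
    (fun m => D * (Cmod (phi m) * ((1 + rho) / 2) ^ m))%R.
  - intros m; rewrite Rabs_pos_eq
      by (apply Rmult_le_pos; [apply Cmod_ge_0|apply pow2_ge_0]).
    specialize (H m); pose proof (Cmod_ge_0 (phi m)).
    apply Rmult_le_compat_l with (r := Cmod (phi m)) in H; [|lra]; lra.
  - apply ex_series_mult_l, geo_summable_R with rho; [lra|exact Hg].
Qed.

(** * The beta average of a power series *)

(** The mean of [CPS phi] for the beta distribution of parameters [b] and [c - b], defined through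
    its moments so that complex parameters need no density. *)
Definition beta_functional (b c : C) (phi : nat -> C) : C :=
  CSeries (fun m => phi m * (pochhammer b m / pochhammer c m)).

Lemma beta_functional_summable (b c : C) (phi : nat -> C) (rho : R) :
  (0 < Re b)%R -> (Re b < Re c)%R -> (1 < rho)%R -> geo phi rho ->
  summable (fun m => phi m * (pochhammer b m / pochhammer c m)).
Proof.
  intros Hb Hbc Hr Hg.
  destruct (pochhammer_quotient_bounded b c Hb Hbc) as [A [HA H]].
  apply (summable_le _ (fun m => Cmod (phi m) * 1 ^ m * A)%R).
  - intros m; rewrite Cmod_mult, pow1, Rmult_1_r.
    apply Rmult_le_compat_l; [apply Cmod_ge_0|apply H].
  - apply ex_series_scal_r, geo_summable_R with rho; [lra|exact Hg].
Qed.

(** Two errors of order [1 / N]: the weights lose the moments of order [m > N], and [falling_ratio]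
    differs from [(k / N)^m]. Both are paid by the convergent sum [T] of [|phi_m| m^2]; the second
    also uses the bounded total variation of the weights. *)
Lemma beta_functional_approx (b c : C) (phi : nat -> C) (rho : R) :
  (0 < Re b)%R -> (Re b < Re c)%R -> (1 < rho)%R -> geo phi rho ->
  exists D, (0 <= D)%R /\ forall N, (0 < N)%nat ->
    (Cmod (beta_functional b c phi -
      Csum (fun k => (beta_weight b c N k * CPS phi (RtoC (INR k / INR N)))%C) (S N))
     <= D / INR N)%R.
Proof.
  intros Hb Hbc Hr Hg.
  destruct (pochhammer_quotient_bounded b c Hb Hbc) as [Aw [HAw Hw]].
  destruct (beta_weight_bound b c Hb Hbc) as [AW [HAW HW]].
  pose proof (geo_second_moment phi rho Hr Hg) as H2.
  set (T := Series (fun m => Cmod (phi m) * INR m ^ 2)%R).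
  assert (HT : (0 <= T)%R).
  { rewrite <- (Rmult_0_l (Series (fun m => Cmod (phi m) * INR m ^ 2)%R)).
    rewrite <- Series_scal_l; apply Series_le; [|exact H2].
    intros m; rewrite Rmult_0_l; split; [lra|].
    apply Rmult_le_pos; [apply Cmod_ge_0|apply pow2_ge_0]. }
  exists ((Aw + AW) * T)%R; split; [apply Rmult_le_pos; lra|].
  intros N HN.
  assert (HN' : (0 < INR N)%R) by (apply lt_0_INR; lia).
  assert (Hc : ~ nonpos_integer c) by (apply Re_pos_not_nonpos_integer; lra).
  assert (S0 : ex_series (fun m => Cmod (phi m))).
  { apply (ex_series_ext (fun m => Cmod (phi m) * 1 ^ m)%R).
    - intros m; rewrite pow1; apply Rmult_1_r.
    - apply geo_summable_R with rho; [lra|exact Hg]. }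
  set (psi := fun k => CSeries (fun m => phi m * falling_ratio N k m)).
  assert (Hfr : forall k, (k < S N)%nat ->
    summable (fun m => phi m * falling_ratio N k m)).
  { intros k Hk; apply (summable_le _ (fun m => Cmod (phi m))); [|exact S0].
    intros m; destruct (falling_ratio_close N k m HN ltac:(lia)) as [H _].
    rewrite Cmod_mult, Cmod_RtoC_nonneg by lra.
    pose proof (Cmod_ge_0 (phi m)); nra. }
  assert (Hpsi : forall k, (k < S N)%nat ->
    (Cmod (psi k - CPS phi (RtoC (INR k / INR N))) <= T / INR N)%R).
  { intros k Hk; unfold psi, CPS.
    pose proof (INR_ratio_bounds N k HN ltac:(lia)) as Hkn.
    assert (S1 : summable (fun m => phi m * RtoC (INR k / INR N) ^ m)).
    { apply (geo_summable _ rho); [rewrite Cmod_RtoC_nonneg; lra|exact Hg]. }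
    rewrite <- CSeries_minus by auto.
    unfold T, Rdiv; rewrite <- Series_scal_r; apply CSeries_bound.
    - intros m; destruct (falling_ratio_close N k m HN ltac:(lia)) as [_ H].
      rewrite <- RtoC_pow.
      replace (phi m * falling_ratio N k m - phi m * RtoC ((INR k * / INR N) ^ m))
        with (phi m * RtoC (falling_ratio N k m - (INR k / INR N) ^ m))
        by (rewrite RtoC_minus; unfold Rdiv; ring).
      rewrite Cmod_mult, Cmod_R, Rmult_assoc.
      apply Rmult_le_compat_l; [apply Cmod_ge_0|exact H].
    - now apply ex_series_scal_r. }
  assert (E : Csum (fun k => beta_weight b c N k * psi k) (S N) =
    CSeries (fun m => phi m *
      (if (m <=? N)%nat then pochhammer b m / pochhammer c m else 0))).
  { destruct (Csum_CSeries (fun k m => beta_weight b c N k *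
      (phi m * falling_ratio N k m)) (S N)) as [_ HS].
    - intros k Hk; now apply summable_scal, Hfr.
    - transitivity (Csum (fun k => CSeries (fun m => beta_weight b c N k *
        (phi m * falling_ratio N k m))) (S N)).
      + apply Csum_ext; intros k Hk; unfold psi.
        now rewrite CSeries_scal by auto.
      + rewrite <- HS; apply CSeries_ext; intros m.
        rewrite <- (beta_weight_moment m N b c Hc), <- Csum_scal.
        apply Csum_ext; intros k Hk; ring. }
  assert (S3 : summable (fun m => phi m *
      (if (m <=? N)%nat then pochhammer b m / pochhammer c m else 0))).
  { apply (summable_le _ (fun m => Cmod (phi m) * Aw)%R).
    - intros m; rewrite Cmod_mult; apply Rmult_le_compat_l; [apply Cmod_ge_0|].
      destruct (m <=? N)%nat; [apply Hw|rewrite Cmod_0; exact HAw].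
    - now apply ex_series_scal_r. }
  replace (beta_functional b c phi -
    Csum (fun k => beta_weight b c N k * CPS phi (RtoC (INR k / INR N))) (S N))
    with ((beta_functional b c phi - Csum (fun k => beta_weight b c N k * psi k) (S N))
    + Csum (fun k => beta_weight b c N k *
        (psi k - CPS phi (RtoC (INR k / INR N)))) (S N)).
  2: { rewrite (Csum_ext (fun k => beta_weight b c N k *
         (psi k - CPS phi (RtoC (INR k / INR N)))) (fun k =>
         beta_weight b c N k * psi k + (- (1)) *
         (beta_weight b c N k * CPS phi (RtoC (INR k / INR N)))))
         by (intros; ring).
       rewrite Csum_plus, Csum_scal; ring. }
  eapply Rle_trans; [apply Cmod_triangle|].
  replace ((Aw + AW) * T / INR N)%R with (T * (Aw / INR N) + AW * (T / INR N))%R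
    by (field; lra).
  apply Rplus_le_compat.
  - rewrite E; unfold beta_functional; rewrite <- CSeries_minus; [|
      now apply beta_functional_summable with rho|exact S3].
    unfold T; rewrite <- Series_scal_r; apply CSeries_bound;
      [|now apply ex_series_scal_r].
    intros m; destruct (Nat.leb_spec m N) as [Hm|Hm].
    + replace (_ - _) with (RtoC 0) by ring; rewrite Cmod_0.
      repeat apply Rmult_le_pos; try apply Cmod_ge_0; try apply pos_INR; try lra.
      apply Rlt_le, Rinv_0_lt_compat; lra.
    (* For [m > N] the moment itself is the error, and it is admissible because [1 <= m^2 / N]. *)
    + replace (phi m * (pochhammer b m / pochhammer c m) - phi m * 0) with
        (phi m * (pochhammer b m / pochhammer c m)) by ring.
      rewrite Cmod_mult, Rmult_assoc; apply Rmult_le_compat_l; [apply Cmod_ge_0|].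
      eapply Rle_trans; [apply Hw|].
      assert (Hm1 : (INR N <= INR m)%R) by (apply le_INR; lia).
      assert (Hm2 : (1 <= INR m)%R) by (apply (le_INR 1); lia).
      apply Rmult_le_reg_r with (INR N); [exact HN'|].
      replace (INR m ^ 2 * (Aw / INR N) * INR N)%R with (Aw * INR m ^ 2)%R
        by (field; lra).
      apply Rmult_le_compat_l; [exact HAw|nra].
  - apply Rle_trans with (Rsum (fun k => AW * (T / INR N) *
      Cmod (beta_weight (RtoC (Re b)) (RtoC (Re c)) N k))%R (S N)).
    + apply Cmod_Csum_le; intros k Hk; rewrite Cmod_mult.
      apply Rle_trans with (AW * Cmod (beta_weight (RtoC (Re b)) (RtoC (Re c)) N k)
        * (T / INR N))%R.
      * apply Rmult_le_compat; try apply Cmod_ge_0; [apply HW|now apply Hpsi].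
      * apply Req_le; ring.
    + rewrite Rsum_scal, beta_weight_real_sum by lra; lra.
Qed.

(** For each [N] the inequality holds between the weighted sums at the points [k / N], where the
    majorant is nonnegative, and it survives the limit in [N]. The constant depends on [b] and [c]
    only, so [phi] and [psi] may vary with [z]. *)
Lemma beta_functional_domination (b c : C) : (0 < Re b)%R -> (Re b < Re c)%R ->
  exists A, (0 <= A)%R /\ forall (phi psi : nat -> C) (rho : R), (1 < rho)%R ->
    geo phi rho -> geo psi rho ->
    (forall t : R, (0 <= t <= 1)%R ->
       is_nonneg (CPS psi t) /\ (Cmod (CPS phi t) <= Cmod (CPS psi t))%R) ->
    (Cmod (beta_functional b c phi) <=
     A * Cmod (beta_functional (RtoC (Re b)) (RtoC (Re c)) psi))%R.
Proof.
  intros Hb Hbc.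
  destruct (beta_weight_bound b c Hb Hbc) as [A [HA HW]].
  exists A; split; [exact HA|]; intros phi psi rho Hr Hphi Hpsi H.
  destruct (beta_functional_approx b c phi rho Hb Hbc Hr Hphi) as [D1 [HD1 H1]].
  destruct (beta_functional_approx (RtoC (Re b)) (RtoC (Re c)) psi rho
    Hb Hbc Hr Hpsi) as [D2 [HD2 H2]].
  set (X := Cmod (beta_functional b c phi)).
  set (Y := Cmod (beta_functional (RtoC (Re b)) (RtoC (Re c)) psi)).
  assert (HN : forall N, (0 < N)%nat -> (X <= A * Y + (D1 + A * D2) / INR N)%R).
  { intros N HN; specialize (H1 N HN); specialize (H2 N HN).
    assert (HN' : (0 < INR N)%R) by (apply lt_0_INR; lia).
    set (S1 := Csum _ _) in H1; set (S2 := Csum _ _) in H2.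
    assert (HS : (Cmod S1 <= A * Cmod S2)%R).
    { set (v := fun k => Cmod (beta_weight (RtoC (Re b)) (RtoC (Re c)) N k *
        CPS psi (RtoC (INR k / INR N)))).
      assert (Ht : forall k, (k < S N)%nat -> (0 <= INR k / INR N <= 1)%R)
        by (intros k Hk; apply INR_ratio_bounds; lia).
      assert (E : S2 = RtoC (Rsum v (S N))).
      { unfold S2; rewrite <- Csum_RtoC; apply Csum_ext; intros k Hk.
        apply nonneg_mult; [apply nonneg_beta_weight; lra|apply H, Ht, Hk]. }
      apply Rle_trans with (A * Rsum v (S N))%R.
      - rewrite <- Rsum_scal; apply Cmod_Csum_le; intros k Hk; unfold v.
        rewrite !Cmod_mult, <- Rmult_assoc.
        apply Rmult_le_compat; try apply Cmod_ge_0; [apply HW|apply H, Ht, Hk].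
      - apply Rmult_le_compat_l; [exact HA|].
        rewrite E, Cmod_R; apply Rle_abs. }
    pose proof (Cmod_triangle (beta_functional b c phi - S1) S1) as T1.
    replace (beta_functional b c phi - S1 + S1) with (beta_functional b c phi)
      in T1 by ring.
    pose proof (Cmod_sub_triangle
      (beta_functional (RtoC (Re b)) (RtoC (Re c)) psi)
      (beta_functional (RtoC (Re b)) (RtoC (Re c)) psi - S2)) as T2.
    match type of T2 with (Cmod ?e <= _)%R => replace e with S2 in T2 by ring end.
    fold X in T1; fold Y in T2.
    assert (A * Cmod S2 <= A * (Y + D2 / INR N))%R
      by (apply Rmult_le_compat_l; lra).
    replace ((D1 + A * D2) / INR N)%R with (D1 / INR N + A * (D2 / INR N))%R
      by (field; lra).
    lra. }
  apply Rnot_lt_le; intros Hlt.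
  assert (HE : (0 <= D1 + A * D2)%R)
    by (apply Rplus_le_le_0_compat; [exact HD1|now apply Rmult_le_pos]).
  destruct (INR_unbounded ((D1 + A * D2) / (X - A * Y))) as [n Hn].
  specialize (HN (S n) ltac:(lia)); rewrite S_INR in HN.
  pose proof (pos_INR n).
  assert (H3 : ((D1 + A * D2) / (INR n + 1) < X - A * Y)%R).
  { apply Rlt_div_l; [lra|].
    replace (D1 + A * D2)%R with
      ((D1 + A * D2) / (X - A * Y) * (X - A * Y))%R by (field; lra).
    rewrite (Rmult_comm (X - A * Y)); apply Rmult_lt_compat_r; lra. }
  lra.
Qed.

(** * The exponential series *)

Definition exp_coef : nat -> C := egf (fun _ => 1).

Lemma geo_exp_coef (rho : R) : (0 <= rho)%R -> geo exp_coef rho.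
Proof.
  intros H; apply geo_egf with 1%R 1%R; [lra|exact H|].
  intros n; rewrite Cmod_1, pow1; lra.
Qed.

(** The product of the series with the inverse exponential is constant along the segment from 0 to
    [w]. *)
Lemma CPS_exp_coef (w : C) : CPS exp_coef w = Cexp w.
Proof.
  set (f := fun t : R => CPS exp_coef (0 + RtoC t * w) * Cexp (0 + RtoC t * (- w))).
  assert (Hf : f 1%R = f 0%R).
  { apply is_derC_zero_eq; [lra|]; intros s _.
    refine (is_derC_ext _ _ _ _ _ (fun t => eq_refl) _ (is_derC_mult _ _ _ _ _
      (is_derC_CPS exp_coef (Cmod (0 + RtoC s * w) + 1) 0 w s
        (geo_exp_coef _ _) _)
      (is_derC_Cexp _ _ _ (is_derC_line 0 (- w) s)))).
    - rewrite (CPS_ext (cderiv exp_coef) exp_coef); [ring|].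
      intros n; unfold cderiv, exp_coef, egf.
      rewrite fact_simpl, mult_INR, RtoC_mult; field; auto using RtoC_fact_neq_0, RtoC_INR_S.
    - pose proof (Cmod_ge_0 (0 + RtoC s * w)); lra.
    - lra. }
  unfold f in Hf.
  replace (0 + 1 * w) with w in Hf by ring.
  replace (0 + 1 * (- w)) with (- w) in Hf by ring.
  replace (0 + 0 * w) with (RtoC 0) in Hf by ring.
  replace (0 + 0 * (- w)) with (RtoC 0) in Hf by ring.
  rewrite Cexp_0, (CPS_0 _ 1), Cexp_opp in Hf by (try apply geo_exp_coef; lra).
  replace (CPS exp_coef w) with (CPS exp_coef w * / Cexp w * Cexp w)
    by (field; apply Cexp_neq_0).
  rewrite Hf; unfold exp_coef, egf; simpl; field; apply C1_nz.
Qed.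

Lemma CPS_exp_scaled (Q w : C) (t : R) :
  CPS (fun m => Q * (exp_coef m * w ^ m)) t = Q * Cexp (w * t).
Proof.
  rewrite <- CPS_exp_coef; unfold CPS.
  rewrite <- CSeries_scal.
  - apply CSeries_ext; intros n; rewrite Cpow_mult_l; ring.
  - apply (geo_summable _ (Cmod (w * t) + 1)); [lra|].
    apply geo_exp_coef; pose proof (Cmod_ge_0 (w * t)); lra.
Qed.

Lemma geo_exp_scaled (Q w : C) (rho : R) : (0 <= rho)%R ->
  geo (fun m => Q * (exp_coef m * w ^ m)) rho.
Proof.
  intros Hr; apply geo_scal.
  destruct (geo_exp_coef (Cmod w * rho)
    (Rmult_le_pos _ _ (Cmod_ge_0 w) Hr)) as [D HD].
  exists D; intros n; rewrite Cmod_mult, Cmod_pow, Rmult_assoc, <- Rpow_mult_distr.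
  apply HD.
Qed.

(** Kummer's integral representation read on coefficients: the average of [Q exp (w t)] is
    [Q M(b, c, w)]. *)
Lemma beta_functional_exp (b c Q w : C) : ~ nonpos_integer c ->
  beta_functional b c (fun m => Q * (exp_coef m * w ^ m)) = Q * kummer b c w.
Proof.
  intros Hc; unfold beta_functional, kummer, CPS; rewrite <- CSeries_scal.
  - apply CSeries_ext; intros m; unfold kcoef, exp_coef, egf.
    field; auto using RtoC_fact_neq_0, pochhammer_neq_0.
  - apply (geo_summable _ (Cmod w + 1)); [lra|].
    apply geo_kcoef; [exact Hc|pose proof (Cmod_ge_0 w); lra].
Qed.

(** * The Humbert function as a beta average of Kummer functions *)

(** A binomial probability is at most 1, with denominators cleared. The induction is Pascal's rule,
    in the form [m + n + 2 = (m + 1) + (n + 1)]. *)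
Lemma binomial_probability_le (p : R) (m n : nat) : (0 <= p <= 1)%R ->
  (INR (fact (m + n)) * (p ^ m * (1 - p) ^ n) <= INR (fact m) * INR (fact n))%R.
Proof.
  intros Hp; revert n; induction m as [|m IHm].
  - intros n; simpl Nat.add.
    assert (0 <= (1 - p) ^ n <= 1)%R.
    { split; [apply pow_le; lra|].
      apply Rle_trans with (1 ^ n)%R; [apply pow_incr|rewrite pow1]; lra. }
    pose proof (INR_fact_pos n).
    change (p ^ 0)%R with 1%R; change (INR (fact 0)) with 1%R; nra.
  - induction n as [|n IHn].
    + rewrite Nat.add_0_r.
      assert (0 <= p ^ S m <= 1)%R.
      { split; [apply pow_le; lra|].
        rewrite <- (pow1 (S m)); apply pow_incr; lra. }
      pose proof (INR_fact_pos (S m)).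
      change ((1 - p) ^ 0)%R with 1%R; change (INR (fact 0)) with 1%R; nra.
    + specialize (IHm (S n)).
      rewrite Nat.add_succ_r in IHm; simpl (S m + n)%nat in IHn.
      replace (S m + S n)%nat with (S (S (m + n))) by lia.
      rewrite (fact_simpl (S (m + n))), mult_INR.
      replace (INR (S (S (m + n)))) with (INR (S m) + INR (S n))%R
        by (rewrite <- plus_INR; f_equal; lia).
      rewrite (fact_simpl m), (fact_simpl n), !mult_INR in *.
      pose proof (INR_S_pos m); pose proof (INR_S_pos n).
      set (F := INR (fact (S (m + n)))) in *.
      apply Rmult_le_compat_l with (r := (INR (S m) * p)%R) in IHm;
        [|apply Rmult_le_pos; lra].
      apply Rmult_le_compat_l with (r := (INR (S n) * (1 - p))%R) in IHn;
        [|apply Rmult_le_pos; lra].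
      replace (p ^ S m)%R with (p * p ^ m)%R in * by reflexivity.
      replace ((1 - p) ^ S n)%R with ((1 - p) * (1 - p) ^ n)%R in * by reflexivity.
      nra.
Qed.

Definition humbert_term (a c' : C) (x : R) (y : C) (m n : nat) : C :=
  pochhammer a (m + n) / pochhammer c' n
    * (RtoC x ^ m / INR (fact m)) * (y ^ n / INR (fact n)).

Lemma pochhammer_1 (n : nat) : pochhammer 1 n = INR (fact n).
Proof.
  induction n as [|n IH]; [reflexivity|].
  cbn [pochhammer]; rewrite IH, fact_simpl, mult_INR, S_INR, RtoC_mult, RtoC_plus.
  ring.
Qed.

(** [(a)_(m+n)] is [O ((m + n)! rho^(-m-n))], and [(m + n)! / (m! n!) <= p^(-m) (1 - p)^(-n)]. This
    decouples the indices into a geometric factor in [m] and an exponential term in [n], the product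
    form required by [CSeries_swap]. *)
Lemma humbert_term_bound (a c' : C) (x : R) : ~ nonpos_integer c' ->
  (0 < x < 1)%R ->
  exists theta D K, (0 < theta < 1)%R /\ (0 <= D)%R /\ (0 <= K)%R /\
    forall y m n, (Cmod (humbert_term a c' x y m n) <=
      theta ^ m * (D * ((K * Cmod y) ^ n / INR (fact n))))%R.
Proof.
  intros Hc Hx.
  (* With [p = (1 + x) / 2], [eta] is [x / p < 1]; [rho] lies between [eta] and 1, whence the ratio
     [theta = eta / rho < 1]. *)
  set (eta := (2 * x / (1 + x))%R).
  assert (Heta : (0 < eta < 1)%R).
  { unfold eta; split; [apply Rdiv_lt_0_compat; lra|].
    apply Rlt_div_l; lra. }
  set (rho := ((1 + eta) / 2)%R).
  assert (Hrho : (0 < rho < 1)%R) by (unfold rho; lra).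
  set (p := ((1 + x) / 2)%R).
  assert (Hp : (0 < p < 1)%R) by (unfold p; lra).
  destruct (egf_pochhammer_geo a rho Hrho) as [D1 HD1].
  (* Since [(1)_n = n!], this bounds [n! / (c')_n] by [D2 * 2 ^ n]; hence the 2 in the constant
     [K]. *)
  destruct (pochhammer_quotient_geometric 1 c' Hc) as [D2 [HD2 H2]].
  assert (HD10 : (0 <= D1)%R).
  { eapply Rle_trans; [|apply (HD1 O)]; simpl; rewrite Rmult_1_r.
    apply Cmod_ge_0. }
  exists (eta / rho)%R, (D1 * D2)%R, (2 / (rho * (1 - p)))%R.
  assert (Hrp : (0 < rho * (1 - p))%R) by (apply Rmult_lt_0_compat; lra).
  split; [split|].
  { apply Rdiv_lt_0_compat; lra. }
  { apply Rlt_div_l; unfold rho; lra. }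
  split; [now apply Rmult_le_pos|]; split; [apply Rdiv_le_0_compat; lra|].
  intros y m n.
  pose proof (INR_fact_pos m) as Hm; pose proof (INR_fact_pos n) as Hn.
  pose proof (INR_fact_pos (m + n)) as Hmn.
  assert (Hpm : (0 < p ^ m)%R) by (apply pow_lt; lra).
  assert (Hpn : (0 < (1 - p) ^ n)%R) by (apply pow_lt; lra).
  assert (Hrm : (0 < rho ^ m)%R) by (apply pow_lt; lra).
  assert (Hrn : (0 < rho ^ n)%R) by (apply pow_lt; lra).
  assert (Hxm : (0 <= x ^ m)%R) by (apply pow_le; lra).
  assert (Hy : (0 <= Cmod y ^ n)%R) by (apply pow_le, Cmod_ge_0).
  pose proof (binomial_probability_le p m n ltac:(lra)) as HB.
  specialize (HD1 (m + n)%nat); specialize (H2 n).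
  unfold egf in HD1; rewrite Cmod_div_R, pow_add in HD1 by exact Hmn.
  rewrite pochhammer_1 in H2.
  pose proof (pochhammer_neq_0 c' n Hc) as Hcn.
  pose proof (proj1 (Cmod_gt_0 _) Hcn) as Hcn'.
  rewrite Cmod_div, Cmod_RtoC_nonneg in H2 by (auto; lra).
  unfold humbert_term.
  rewrite !Cmod_mult, Cmod_div, !Cmod_div_R, !Cmod_pow, (Cmod_RtoC_nonneg x)
    by (auto; lra).
  set (A := Cmod (pochhammer a (m + n))) in *.
  set (B := Cmod (pochhammer c' n)) in *.
  assert (HA : (0 <= A)%R) by apply Cmod_ge_0.
  replace (A / B * (x ^ m / INR (fact m)) * (Cmod y ^ n / INR (fact n)))%R with
    ((A / INR (fact (m + n)) * (rho ^ m * rho ^ n)) * (INR (fact n) / B) *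
     (INR (fact (m + n)) * (p ^ m * (1 - p) ^ n) / (INR (fact m) * INR (fact n))) *
     (x ^ m / (rho ^ m * p ^ m)) *
     (Cmod y ^ n / (rho ^ n * (1 - p) ^ n) / INR (fact n)))%R
    by (field; repeat split; lra).
  replace ((eta / rho) ^ m)%R with (x ^ m / (rho ^ m * p ^ m))%R.
  2: { rewrite <- Rpow_mult_distr; unfold Rdiv at 1.
       rewrite <- pow_inv, <- Rpow_mult_distr; f_equal.
       unfold p, eta; field; lra. }
  replace ((2 / (rho * (1 - p)) * Cmod y) ^ n / INR (fact n))%R with
    (2 ^ n * (Cmod y ^ n / (rho ^ n * (1 - p) ^ n) / INR (fact n)))%R.
  2: { rewrite Rpow_mult_distr; unfold Rdiv at 4; rewrite Rpow_mult_distr, pow_inv,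
         Rpow_mult_distr; field; repeat split; lra. }
  set (U := (x ^ m / (rho ^ m * p ^ m))%R).
  set (W := (Cmod y ^ n / (rho ^ n * (1 - p) ^ n) / INR (fact n))%R).
  assert (HU : (0 <= U)%R)
    by (apply Rdiv_le_0_compat; [exact Hxm|now apply Rmult_lt_0_compat]).
  assert (HW : (0 <= W)%R).
  { apply Rdiv_le_0_compat; [|exact Hn].
    apply Rdiv_le_0_compat; [exact Hy|now apply Rmult_lt_0_compat]. }
  assert (HB' : (INR (fact (m + n)) * (p ^ m * (1 - p) ^ n) /
    (INR (fact m) * INR (fact n)) <= 1)%R).
  { apply Rmult_le_reg_r with (INR (fact m) * INR (fact n))%R;
      [now apply Rmult_lt_0_compat|].
    unfold Rdiv; rewrite Rmult_assoc, Rinv_l; [lra|].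
    apply Rgt_not_eq, Rmult_lt_0_compat; lra. }
  set (T := (INR (fact (m + n)) * (p ^ m * (1 - p) ^ n) /
    (INR (fact m) * INR (fact n)))%R) in *.
  assert (HT : (0 <= T)%R).
  { apply Rdiv_le_0_compat; [|now apply Rmult_lt_0_compat].
    apply Rmult_le_pos; [lra|apply Rmult_le_pos; lra]. }
  set (V1 := (A / INR (fact (m + n)) * (rho ^ m * rho ^ n))%R) in *.
  set (V2 := (INR (fact n) / B)%R) in *.
  assert (HV1 : (0 <= V1)%R).
  { apply Rmult_le_pos; [apply Rdiv_le_0_compat; lra|].
    apply Rmult_le_pos; lra. }
  assert (HV2 : (0 <= V2)%R) by (apply Rdiv_le_0_compat; lra).
  replace (U * (D1 * D2 * (2 ^ n * W)))%R with
    (D1 * (D2 * 2 ^ n) * 1 * U * W)%R by ring.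
  apply Rmult_le_compat_r; [exact HW|]; apply Rmult_le_compat_r; [exact HU|].
  apply Rmult_le_compat; [now apply Rmult_le_pos|exact HT| |exact HB'].
  now apply Rmult_le_compat.
Qed.

(** The coefficient of [t^m] in [phi t]. *)
Definition humbert_coef (a c' : C) (x : R) (y : C) (m : nat) : C :=
  CSeries (humbert_term a c' x y m).

Lemma humbert_majorant (D K : R) (y : C) :
  ex_series (fun n => D * ((K * Cmod y) ^ n / INR (fact n)))%R.
Proof. apply ex_series_mult_l; eexists; apply is_series_exp. Qed.

Lemma humbert_term_summable (a c' : C) (x : R) (y : C) (m : nat) :
  ~ nonpos_integer c' -> (0 < x < 1)%R -> summable (humbert_term a c' x y m).
Proof.
  intros Hc Hx.
  destruct (humbert_term_bound a c' x Hc Hx) as [th [D [K [Hth [HD [HK H]]]]]].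
  eapply summable_le; [intros n; apply H|].
  apply ex_series_mult_l, humbert_majorant.
Qed.

(** Since [theta < 1], the radius of convergence in [t] exceeds 1, so the right end point of
    [[0, 1]], where the mass concentrates, is inside the disc. *)
Lemma humbert_coef_geo (a c' : C) (x : R) (y : C) : ~ nonpos_integer c' ->
  (0 < x < 1)%R -> exists rho, (1 < rho)%R /\ geo (humbert_coef a c' x y) rho.
Proof.
  intros Hc Hx.
  destruct (humbert_term_bound a c' x Hc Hx) as [th [D [K [Hth [HD [HK H]]]]]].
  exists (/ th)%R; split.
  { rewrite <- Rinv_1; apply Rinv_lt_contravar; lra. }
  set (S := Series (fun n => D * ((K * Cmod y) ^ n / INR (fact n)))%R).
  exists S; intros m.
  assert (Hm : (Cmod (humbert_coef a c' x y m) <= th ^ m * S)%R).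
  { unfold S; rewrite <- Series_scal_l; apply CSeries_bound; [intros n; apply H|].
    apply ex_series_mult_l, humbert_majorant. }
  assert (Hp : (0 < th ^ m)%R) by (apply pow_lt; lra).
  rewrite pow_inv; apply Rmult_le_reg_r with (th ^ m)%R; [exact Hp|].
  rewrite Rmult_assoc, Rinv_l, Rmult_1_r by lra; lra.
Qed.

Lemma Psi1_beta_functional (a b c c' : C) (x : R) (y : C) :
  ~ nonpos_integer c -> ~ nonpos_integer c' -> (0 < x < 1)%R ->
  Psi1 a b c c' x y = beta_functional b c (humbert_coef a c' x y).
Proof.
  intros Hc Hc' Hx.
  unfold Psi1, beta_functional; apply CSeries_ext; intros m.
  rewrite Cmult_comm; unfold humbert_coef; rewrite <- CSeries_scal.
  - apply CSeries_ext; intros n; unfold humbert_term.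
    field; auto using RtoC_fact_neq_0, pochhammer_neq_0.
  - now apply humbert_term_summable.
Qed.

Lemma Cpower_INR (r : R) (n : nat) : (0 < r)%R -> Cpower r (INR n) = RtoC r ^ n.
Proof.
  intros Hr; induction n as [|n IH].
  - rewrite Cpower_RtoC by exact Hr; simpl; rewrite Cmult_0_l; apply Cexp_0.
  - rewrite S_INR, RtoC_plus, Cpower_succ, IH, Cpow_S by exact Hr; ring.
Qed.

(** After the exchange of sums, [(a)_(m+n) = (a)_n (a + n)_m] turns the sum over [m] into the
    binomial series of [(1 - x t)^(-a-n)]; the power [-n] rescales [y]. *)
Lemma CPS_humbert_coef (a c' : C) (x : R) (y : C) (t : R) :
  ~ nonpos_integer c' -> (0 < x < 1)%R -> (0 <= t <= 1)%R ->
  CPS (humbert_coef a c' x y) t =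
  Cpower (RtoC (1 - x * t)) (- a) * kummer a c' (y / RtoC (1 - x * t)).
Proof.
  intros Hc Hx Ht.
  destruct (humbert_term_bound a c' x Hc Hx) as [th [D [K [Hth [HD [HK H]]]]]].
  assert (Hxt : (0 <= x * t < 1)%R) by nra.
  assert (Htm : forall m, (0 <= t ^ m <= 1)%R).
  { intros m; split; [apply pow_le; lra|].
    rewrite <- (pow1 m); apply pow_incr; lra. }
  assert (Hr0 : RtoC (1 - x * t) <> 0) by (apply RtoC_neq_0; lra).
  transitivity (CSeries (fun m => CSeries (fun n =>
    RtoC t ^ m * humbert_term a c' x y m n))).
  { unfold CPS; apply CSeries_ext; intros m; unfold humbert_coef.
    rewrite Cmult_comm, <- CSeries_scal; [reflexivity|].
    now apply humbert_term_summable. }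
  rewrite (CSeries_swap _ (fun m => th ^ m)%R
    (fun n => D * ((K * Cmod y) ^ n / INR (fact n)))%R).
  - unfold kummer, CPS; rewrite <- CSeries_scal.
    2: { apply (geo_summable _ (Cmod (y / RtoC (1 - x * t)) + 1)); [lra|].
         apply geo_kcoef; [exact Hc|].
         pose proof (Cmod_ge_0 (y / RtoC (1 - x * t))); lra. }
    apply CSeries_ext; intros n.
    transitivity (pochhammer a n / pochhammer c' n * (y ^ n / INR (fact n)) *
      CPS (egf (pochhammer (a + INR n))) (RtoC (x * t))).
    + unfold CPS; rewrite <- CSeries_scal.
      * apply CSeries_ext; intros m; unfold humbert_term, egf.
        rewrite pochhammer_add, RtoC_mult, Cpow_mult_l.
        field; auto using RtoC_fact_neq_0, pochhammer_neq_0.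
      * apply (geo_summable _ ((1 + x * t) / 2)).
        -- rewrite Cmod_RtoC_nonneg; lra.
        -- apply egf_pochhammer_geo; lra.
    + rewrite binomial_series by exact Hxt.
      replace (- (a + INR n)) with (- a + - INR n) by ring.
      rewrite Cpower_plus, (Cpower_opp _ (INR n)), Cpower_INR by lra.
      unfold kcoef, egf, Cdiv; rewrite Cpow_mult_l, Cpow_inv by exact Hr0.
      ring.
  - intros m n; rewrite Cmod_mult, Cmod_pow, Cmod_RtoC_nonneg by lra.
    specialize (H y m n); specialize (Htm m).
    pose proof (Cmod_ge_0 (humbert_term a c' x y m n)); nra.
  - apply ex_series_geom; rewrite Rabs_pos_eq; lra.
  - apply humbert_majorant.
Qed.

(** * Localisation at the right end point *)

Lemma mul_exp_neg_le (u : R) : (0 <= u)%R ->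
  (u * exp (- u) <= 1)%R /\ (u ^ 2 * exp (- u) <= 4)%R.
Proof.
  intros Hu; rewrite exp_Ropp.
  pose proof (exp_pos u) as Hp; pose proof (exp_pos (u / 2)) as Hp2.
  pose proof (exp_ineq1_le u) as H1; pose proof (exp_ineq1_le (u / 2)) as H2.
  assert (E : (exp u = exp (u / 2) * exp (u / 2))%R)
    by (rewrite <- exp_plus; f_equal; field).
  split; apply Rmult_le_reg_r with (exp u); try exact Hp;
    rewrite Rmult_assoc, Rinv_l by lra; nra.
Qed.

Lemma cone_scal (kappa r : R) (z : C) : (0 <= r)%R -> cone kappa z ->
  cone kappa (r * z).
Proof.
  unfold cone; intros Hr Hz.
  rewrite Cmod_mult, Cmod_RtoC_nonneg, re_scal_l by exact Hr.
  apply Rmult_le_compat_l with (r := r) in Hz; [lra|exact Hr].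
Qed.

(** The leading term of [phi] at [t = 1], the exponential [exp z] included. *)
Definition humbert_prefactor (a c' : C) (x : R) (z : C) : C :=
  Cpower (RtoC (1 - x)) (- a) * Cpower z (- (c' - a))
    * (CGamma c' / CGamma a) * Cexp z.

(** With [z = y / (1 - x)] and this [s], [y / (1 - x t) = s z]: the argument of [M] moves along the
    ray of [z]. *)
Definition contraction (x t : R) : R := ((1 - x) / (1 - x * t))%R.

(** The uses, in order: [s z] has modulus at least [(1 - x) |z|]; [exp (- (1 - s) z)] decays in
    [1 - t]; the linearisation of [1 - s] at [t = 1] lies above it, with a quadratic error; powers
    of [s] are [1 + O (1 - t)]. *)
Lemma contraction_bounds (x t : R) : (0 < x < 1)%R -> (0 <= t <= 1)%R ->
  let s := contraction x t in
  (1 - x <= s <= 1)%R /\ (x * (1 - t) <= 1 - s)%R /\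
  (0 <= x / (1 - x) * (1 - t) - (1 - s) <= (x / (1 - x) * (1 - t)) ^ 2)%R /\
  (Rabs (ln s) <= x / (1 - x) * (1 - t))%R.
Proof.
  intros Hx Ht s.
  assert (Hxt : (1 - x <= 1 - x * t <= 1)%R) by nra.
  assert (H1 : (1 - x <= s <= 1)%R).
  { unfold s, contraction; split; apply Rmult_le_reg_r with (1 - x * t)%R; try lra;
      unfold Rdiv; rewrite Rmult_assoc, Rinv_l; nra. }
  split; [exact H1|].
  assert (E1 : (1 - s = x * (1 - t) * / (1 - x * t))%R)
    by (unfold s, contraction; field; lra).
  assert (Hi : (1 <= / (1 - x * t) <= / (1 - x))%R).
  { split; [rewrite <- Rinv_1|]; apply Rinv_le_contravar; lra. }
  assert (Hxs : (0 <= x * (1 - t))%R) by (apply Rmult_le_pos; lra).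
  split; [rewrite E1; nra|].
  assert (E2 : (x / (1 - x) * (1 - t) - (1 - s) =
    x * (1 - t) * (x * (1 - t)) * (/ (1 - x) * / (1 - x * t)))%R)
    by (rewrite E1; field; lra).
  split; [split|].
  - rewrite E2; repeat apply Rmult_le_pos; lra.
  - rewrite E2.
    replace ((x / (1 - x) * (1 - t)) ^ 2)%R with
      (x * (1 - t) * (x * (1 - t)) * (/ (1 - x) * / (1 - x)))%R by (field; lra).
    apply Rmult_le_compat_l; [now apply Rmult_le_pos|].
    apply Rmult_le_compat_l; lra.
  - assert (Hs : (0 < s)%R) by lra.
    assert (ln s <= 0)%R by (rewrite <- ln_1; apply ln_le; lra).
    rewrite Rabs_left1, <- ln_Rinv by lra.
    eapply Rle_trans; [apply ln_le_sub_1, Rinv_0_lt_compat, Hs|].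
    apply Req_le; unfold s, contraction; field; lra.
Qed.

(** An exact factorisation: relative to [humbert_prefactor] there remain a power of [s], a decaying
    exponential and a normalised Kummer value close to 1, and each of them can be estimated
    separately. *)
Lemma humbert_generating_factor (a c' z : C) (x t : R) :
  ~ nonpos_integer a -> ~ nonpos_integer c' ->
  (0 < x < 1)%R -> (0 <= t <= 1)%R -> z <> 0 ->
  let s := contraction x t in
  CPS (humbert_coef a c' x (RtoC (1 - x) * z)) t =
  humbert_prefactor a c' x z *
    (Cpower s (a - (c' - a)) * Cexp (- (RtoC (1 - s) * z)) *
     (knorm (c' - a) a c' (RtoC s * z) / (CGamma c' / CGamma a))).
Proof.
  intros Ha Hc Hx Ht Hz s.
  destruct (contraction_bounds x t Hx Ht) as [Hs _]; fold s in Hs.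
  assert (Hxt : (1 - x <= 1 - x * t <= 1)%R) by nra.
  rewrite CPS_humbert_coef by assumption.
  replace (RtoC (1 - x) * z / RtoC (1 - x * t)) with (RtoC s * z).
  2: { unfold s, contraction; rewrite RtoC_div by lra; unfold Cdiv; ring. }
  assert (E : ln (1 - x * t) = (ln (1 - x) - ln s)%R).
  { unfold s, contraction; rewrite ln_div by lra; ring. }
  destruct (CGamma_spec a Ha) as [Ga _]; destruct (CGamma_spec c' Hc) as [Gc _].
  unfold humbert_prefactor, knorm.
  rewrite (Cpower_scal s z) by (try exact Hz; lra).
  transitivity (Cpower (RtoC (1 - x)) (- a) * Cpower s a *
    (Cpower z (- (c' - a)) * Cpower z (c' - a)) *
    (Cpower s (- (c' - a)) * Cpower s (c' - a)) *
    (Cexp z * Cexp (- (RtoC (1 - s) * z)) * Cexp (- (RtoC s * z))) *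
    kummer a c' (RtoC s * z)).
  - rewrite <- !Cpower_plus, <- !Cexp_plus.
    replace (z + - (RtoC (1 - s) * z) + - (RtoC s * z)) with (RtoC 0)
      by (rewrite RtoC_minus; ring).
    replace (- (c' - a) + (c' - a)) with (RtoC 0) by ring.
    assert (E0 : forall w, Cpower w 0 = 1)
      by (intros w; unfold Cpower; rewrite Cmult_0_l; apply Cexp_0).
    rewrite Cexp_0, !E0, !Cmult_1_r; f_equal.
    rewrite !Cpower_RtoC, <- Cexp_plus, E, RtoC_minus by lra; f_equal; ring.
  - replace (a - (c' - a)) with (a + - (c' - a)) by ring.
    rewrite (Cpower_plus s); field; auto.
Qed.

(** Three errors: [v - 1], at most [e1]; [S - 1], of order [1 - t]; and the defect [d] of the
    linearised exponent, of order [|z| (1 - t)^2]. The available decay is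
    [exp (- 2 lam |z| (1 - t))], because [(1 - s) Re z >= x (1 - t) kappa |z|]. One half of it turns
    the last two errors into [O (1 / |z|)], the other half is kept for the average. *)
Lemma localisation_error (a c' z : C) (x t kappa e1 : R) :
  ~ nonpos_integer a -> ~ nonpos_integer c' ->
  (0 < x < 1)%R -> (0 <= t <= 1)%R -> z <> 0 ->
  (0 < kappa)%R -> cone kappa z -> (0 <= e1)%R ->
  let s := contraction x t in
  (Cmod (knorm (c' - a) a c' (RtoC s * z) / (CGamma c' / CGamma a) - 1) <= e1)%R ->
  let lam := (x * kappa / 2)%R in
  let xi := (x / (1 - x))%R in
  let A := (2 * Cmod (a - (c' - a)) * xi * exp (Cmod (a - (c' - a)) * xi))%R in
  (Cmod (CPS (humbert_coef a c' x (RtoC (1 - x) * z)) t -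
     humbert_prefactor a c' x z * Cexp (- (RtoC (xi * (1 - t)) * z))) <=
   Cmod (humbert_prefactor a c' x z) *
     (((1 + A) * e1 + (A / lam + 8 * xi ^ 2 / lam ^ 2) / Cmod z)
       * exp (- (lam * Cmod z * (1 - t)))))%R.
Proof.
  intros Ha Hc Hx Ht Hz Hk Hcone He1 s Hv lam xi A.
  destruct (contraction_bounds x t Hx Ht) as [Hs [H1 [H2 H3]]].
  fold s in Hs, H1, H2, H3; fold xi in H2, H3.
  rewrite humbert_generating_factor by assumption; fold s.
  set (P := humbert_prefactor a c' x z).
  set (be := a - (c' - a)) in *.
  set (v := knorm (c' - a) a c' (RtoC s * z) / (CGamma c' / CGamma a)) in *.
  set (S := Cpower s be).
  set (E1 := Cexp (- (RtoC (1 - s) * z))).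
  set (d := (xi * (1 - t) - (1 - s))%R).
  assert (Hr : (0 < Cmod z)%R) by now apply Cmod_gt_0.
  set (r := Cmod z) in *.
  assert (Hlam : (0 < lam)%R) by (unfold lam; nra).
  assert (Hxi : (0 < xi)%R) by (apply Rdiv_lt_0_compat; lra).
  assert (Hu : (0 <= 1 - t <= 1)%R) by lra.
  set (u := (1 - t)%R) in *.
  set (U := (lam * r * u)%R).
  assert (HU : (0 <= U)%R) by (unfold U; apply Rmult_le_pos; [nra|lra]).
  assert (HRe : (0 < Re z)%R) by (unfold cone in Hcone; fold r in Hcone; nra).
  replace (Cexp (- (RtoC (xi * u) * z))) with (E1 * Cexp (- (RtoC d * z))).
  2: { unfold E1; rewrite <- Cexp_plus; f_equal; unfold d.
       rewrite !RtoC_minus; ring. }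
  replace (P * (S * E1 * v) - P * (E1 * Cexp (- (RtoC d * z)))) with
    (P * (E1 * (S * (v - 1) + (S - 1) - (Cexp (- (RtoC d * z)) - 1)))) by ring.
  rewrite !Cmod_mult; apply Rmult_le_compat_l; [apply Cmod_ge_0|].
  assert (HE1 : (Cmod E1 <= exp (- U) * exp (- U))%R).
  { unfold E1; rewrite Cmod_Cexp, <- exp_plus; apply exp_le_compat.
    replace (Re (- (RtoC (1 - s) * z))) with (- ((1 - s) * Re z))%R
      by (unfold Re; simpl; ring).
    unfold cone in Hcone; fold r in Hcone.
    assert (x * u * (kappa * r) <= (1 - s) * Re z)%R
      by (apply Rmult_le_compat; nra).
    unfold U, lam; lra. }
  assert (HS1 : (Cmod (S - 1) <= A * u)%R).
  { unfold S; rewrite Cpower_RtoC by lra.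
    eapply Rle_trans; [apply Cexp_sub_1_abs|].
    rewrite Cmod_mult, Cmod_R.
    pose proof (Cmod_ge_0 be); pose proof (Rabs_pos (ln s)).
    assert (xi * u <= xi)%R by nra.
    assert (exp (Cmod be * Rabs (ln s)) <= exp (Cmod be * xi))%R
      by (apply exp_le_compat, Rmult_le_compat_l; lra).
    unfold A; replace (2 * Cmod be * xi * exp (Cmod be * xi) * u)%R with
      (2 * (Cmod be * (xi * u)) * exp (Cmod be * xi))%R by ring.
    apply Rmult_le_compat; try lra; try apply Rlt_le, exp_pos.
    - assert (0 <= Cmod be * Rabs (ln s))%R by (apply Rmult_le_pos; lra); lra.
    - assert (Cmod be * Rabs (ln s) <= Cmod be * (xi * u))%R
        by (apply Rmult_le_compat_l; lra); lra. }
  assert (HA : (0 <= A)%R).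
  { unfold A; pose proof (Cmod_ge_0 be).
    apply Rmult_le_pos; [|apply Rlt_le, exp_pos].
    apply Rmult_le_pos; lra. }
  assert (HS : (Cmod S <= 1 + A)%R).
  { replace S with (1 + (S - 1)) by ring.
    eapply Rle_trans; [apply Cmod_triangle|]; rewrite Cmod_1; nra. }
  (* The sign of [d] matters: with [d >= 0] and [Re z > 0] the exponential of [- d z] does not grow,
     and its distance to 1 is linear in [d |z|]. *)
  assert (HE2 : (Cmod (Cexp (- (RtoC d * z)) - 1) <= 2 * (xi * u) ^ 2 * r)%R).
  { eapply Rle_trans; [apply Cexp_sub_1|].
    rewrite Cmod_opp, Cmod_mult, Cmod_RtoC_nonneg by (unfold d; lra); fold r.
    rewrite Rmax_left.
    - rewrite exp_0, Rmult_1_r.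
      assert (d * r <= (xi * u) ^ 2 * r)%R
        by (apply Rmult_le_compat_r; unfold d; lra); lra.
    - replace (Re (- (RtoC d * z))) with (- (d * Re z))%R
        by (unfold Re; simpl; ring).
      assert (0 <= d * Re z)%R by (apply Rmult_le_pos; unfold d; lra); lra. }
  assert (HT : (Cmod (S * (v - 1) + (S - 1) - (Cexp (- (RtoC d * z)) - 1)) <=
    (1 + A) * e1 + A * u + 2 * (xi * u) ^ 2 * r)%R).
  { eapply Rle_trans; [apply Cmod_sub_triangle|].
    apply Rplus_le_compat; [|exact HE2].
    eapply Rle_trans; [apply Cmod_triangle|].
    apply Rplus_le_compat; [|exact HS1].
    rewrite Cmod_mult; apply Rmult_le_compat; try apply Cmod_ge_0; assumption. }
  (* [U exp (- U) <= 1] and [U^2 exp (- U) <= 4]; the 8 of the statement is this 4 times the 2 of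
     [HE2]. *)
  destruct (mul_exp_neg_le U HU) as [G1 G2].
  pose proof (exp_pos (- U)) as HeU.
  assert (HeU1 : (exp (- U) <= 1)%R)
    by (rewrite <- exp_0; apply exp_le_compat; lra).
  eapply Rle_trans; [apply Rmult_le_compat; [apply Cmod_ge_0|apply Cmod_ge_0|
    exact HE1|exact HT]|].
  fold U.
  match goal with |- (?e * ?e * ?X <= ?Y * ?e)%R =>
    replace (e * e * X)%R with (e * (e * X))%R by ring;
    rewrite (Rmult_comm Y e) end.
  apply Rmult_le_compat_l; [lra|].
  replace (exp (- U) * ((1 + A) * e1 + A * u + 2 * (xi * u) ^ 2 * r))%R with
    (exp (- U) * ((1 + A) * e1) + (A / lam) / r * (U * exp (- U)) +
     (2 * xi ^ 2 / lam ^ 2) / r * (U ^ 2 * exp (- U)))%R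
    by (unfold U; field; lra).
  replace ((1 + A) * e1 + (A / lam + 8 * xi ^ 2 / lam ^ 2) / r)%R with
    (1 * ((1 + A) * e1) + (A / lam) / r * 1 + (2 * xi ^ 2 / lam ^ 2) / r * 4)%R
    by (field; lra).
  assert (0 <= (1 + A) * e1)%R by (apply Rmult_le_pos; lra).
  assert (0 <= A / lam / r)%R
    by (apply Rdiv_le_0_compat; [apply Rdiv_le_0_compat|]; lra).
  assert (0 <= 2 * xi ^ 2 / lam ^ 2 / r)%R.
  { apply Rdiv_le_0_compat; [apply Rdiv_le_0_compat|]; [|apply pow_lt; lra|lra].
    pose proof (pow2_ge_0 xi); lra. }
  repeat apply Rplus_le_compat.
  - apply Rmult_le_compat_r; lra.
  - apply Rmult_le_compat_l; lra.
  - apply Rmult_le_compat_l; lra.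
Qed.

Lemma beta_functional_diff (b c : C) (phi psi : nat -> C) (rho : R) :
  (0 < Re b)%R -> (Re b < Re c)%R -> (1 < rho)%R -> geo phi rho -> geo psi rho ->
  beta_functional b c (fun m => phi m + - (1) * psi m) =
  beta_functional b c phi - beta_functional b c psi.
Proof.
  intros Hb Hbc Hr Hphi Hpsi; unfold beta_functional.
  rewrite <- CSeries_minus by (eapply beta_functional_summable; eassumption).
  apply CSeries_ext; intros m; ring.
Qed.

(** The model [P exp (- w) exp (w t)] with [w = xi z] averages to [G * knorm (c - b) b c w], whose
    second factor tends to [CGamma c / CGamma b]. The rest is dominated by [Q exp (lam r t)], whose
    average for real parameters is [O (|P| e2 r^(- nu))], hence [O (e2 |G|)]. *)
Lemma beta_humbert_asymptotics (a b c c' : C) (x kappa : R) :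
  (0 < Re b)%R -> (Re b < Re c)%R ->
  ~ nonpos_integer a -> ~ nonpos_integer c' -> (0 < x < 1)%R ->
  (0 < kappa <= 1)%R -> forall eps, (0 < eps)%R ->
  exists r0, (0 < r0)%R /\ forall z, cone kappa z -> (r0 <= Cmod z)%R ->
    let G := humbert_prefactor a c' x z
      * Cpower (RtoC (x / (1 - x)) * z) (b - c) in
    (Cmod (beta_functional b c (humbert_coef a c' x (RtoC (1 - x) * z))
       - CGamma c / CGamma b * G) <= eps * Cmod G)%R.
Proof.
  intros Hb Hbc Ha Hc' Hx Hk eps He.
  assert (Hc : ~ nonpos_integer c) by (apply Re_pos_not_nonpos_integer; lra).
  assert (Hb' : ~ nonpos_integer b) by (apply Re_pos_not_nonpos_integer; lra).
  assert (HcR : ~ nonpos_integer (RtoC (Re c)))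
    by (apply Re_pos_not_nonpos_integer; simpl; lra).
  set (xi := (x / (1 - x))%R); set (lam := (x * kappa / 2)%R).
  assert (Hxi : (0 < xi)%R) by (apply Rdiv_lt_0_compat; lra).
  assert (Hlam : (0 < lam)%R) by (unfold lam; nra).
  destruct (knorm_tends b c kappa Hb' Hc Hk (eps / 2)%R ltac:(lra))
    as [r1 [Hr1 H1]].
  destruct (knorm_bounded (RtoC (Re b)) (RtoC (Re c)) kappa HcR ltac:(lra))
    as [r2 [K0 [Hr2 [HK0 H2]]]].
  destruct (beta_functional_domination b c Hb Hbc) as [A [HA HD]].
  destruct (CGamma_spec a Ha) as [Ga _]; destruct (CGamma_spec c' Hc') as [Gc _].
  set (K := CGamma c' / CGamma a).
  assert (HK : (0 < Cmod K)%R).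
  { apply Cmod_gt_0; unfold K; intros E; apply Gc.
    replace (CGamma c') with (CGamma c' / CGamma a * CGamma a) by (field; auto).
    rewrite E; ring. }
  assert (HKnz : K <> 0) by now apply Cmod_gt_0.
  set (nu := Re (c - b)).
  (* Compares [(lam r)^(- nu)] with [|w^(b - c)|]: the moduli differ by the ratio [xi / lam], and
     the argument of [w], at most [PI] in absolute value, counts when [c - b] is not real. *)
  set (A3 := exp (nu * (ln xi - ln lam) + Rabs (Im (c - b)) * PI)).
  assert (HA3 : (0 < A3)%R) by apply exp_pos.
  (* Collects the constants through which [e2] reaches the final error; the added 1 keeps it
     positive. *)
  set (M := (A * K0 * A3 + 1)%R).
  assert (HM : (0 < M)%R).
  { unfold M; assert (0 <= A * K0 * A3)%R; [|lra].
    apply Rmult_le_pos; [now apply Rmult_le_pos|lra]. }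
  set (e2 := (eps / (2 * M))%R).
  assert (He2 : (0 < e2)%R) by (apply Rdiv_lt_0_compat; lra).
  set (A1 := (2 * Cmod (a - (c' - a)) * xi * exp (Cmod (a - (c' - a)) * xi))%R).
  assert (HA1 : (0 <= A1)%R).
  { unfold A1; pose proof (Cmod_ge_0 (a - (c' - a))).
    apply Rmult_le_pos; [|apply Rlt_le, exp_pos].
    apply Rmult_le_pos; lra. }
  set (B := (A1 / lam + 8 * xi ^ 2 / lam ^ 2)%R).
  assert (HB : (0 <= B)%R).
  { unfold B; apply Rplus_le_le_0_compat; apply Rdiv_le_0_compat; try lra.
    - pose proof (pow2_ge_0 xi); lra.
    - apply pow_lt, Hlam. }
  (* Makes [(1 + A1) e1] one half of [e2]; the other half is for [B / r]. *)
  set (e1 := (e2 / (2 * (1 + A1)))%R).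
  assert (He1 : (0 < e1)%R) by (apply Rdiv_lt_0_compat; lra).
  destruct (knorm_tends a c' kappa Ha Hc' Hk (e1 * Cmod K)%R
    ltac:(now apply Rmult_lt_0_compat)) as [r3 [Hr3 H3]].
  assert (P1 : (0 < r1 / xi)%R) by (apply Rdiv_lt_0_compat; lra).
  assert (P2 : (0 < r2 / lam)%R) by (apply Rdiv_lt_0_compat; lra).
  assert (P3 : (0 < r3 / (1 - x))%R) by (apply Rdiv_lt_0_compat; lra).
  assert (P4 : (0 <= 2 * B / e2)%R) by (apply Rdiv_le_0_compat; lra).
  (* One threshold for each of the arguments [w], [lam r] and [s z], of modulus [xi r], [lam r] and
     at least [(1 - x) r]; the last term gives [B / r <= e2 / 2]. *)
  exists (r1 / xi + r2 / lam + r3 / (1 - x) + 2 * B / e2)%R.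
  split; [lra|]; intros z Hz Hzr G.
  set (r := Cmod z) in *.
  assert (Hscale : forall p q : R, (0 < p)%R -> (q / p <= r)%R -> (q <= p * r)%R).
  { intros p q Hp Hq; apply Rmult_le_compat_l with (r := p) in Hq; [|lra].
    replace (p * (q / p))%R with q in Hq by (field; lra); exact Hq. }
  assert (Hr : (0 < r)%R) by lra.
  assert (Hz0 : z <> 0) by now apply Cmod_gt_0.
  set (P := humbert_prefactor a c' x z) in *.
  set (w := RtoC xi * z).
  assert (Hw : Cmod w = (xi * r)%R)
    by (unfold w; rewrite Cmod_mult, Cmod_RtoC_nonneg by lra; reflexivity).
  assert (Hw0 : w <> 0) by (apply Cmod_gt_0; nra).
  set (phi := humbert_coef a c' x (RtoC (1 - x) * z)).
  (* [CPS psi t] is [P exp (- xi z (1 - t))], the local model of [CPS phi t] at [t = 1]. *)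
  set (psi := fun m => P * Cexp (- w) * (exp_coef m * w ^ m)).
  (* With this [Q], [CPS chi t] is [|P| e2 exp (- lam r (1 - t))], the majorant of the localisation
     error. *)
  set (Q := (Cmod P * e2 * exp (- (lam * r)))%R).
  set (chi := fun m => RtoC Q * (exp_coef m * RtoC (lam * r) ^ m)).
  assert (HQ : (0 <= Q)%R).
  { unfold Q; apply Rmult_le_pos; [|apply Rlt_le, exp_pos].
    apply Rmult_le_pos; [apply Cmod_ge_0|lra]. }
  destruct (humbert_coef_geo a c' x (RtoC (1 - x) * z) Hc' Hx) as [rho [Hrho Gphi]].
  fold phi in Gphi.
  assert (Gpsi : geo psi rho) by (apply geo_exp_scaled; lra).
  assert (Gchi : geo chi rho) by (apply geo_exp_scaled; lra).
  assert (Gpsi' : geo (fun m => - (1) * psi m) rho) by now apply geo_scal.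
  assert (Hdom : forall t : R, (0 <= t <= 1)%R -> is_nonneg (CPS chi t) /\
    (Cmod (CPS (fun m => (phi m + - (1) * psi m)%C) t) <= Cmod (CPS chi t))%R).
  { intros t Ht.
    assert (Echi : CPS chi t = RtoC (Q * exp (lam * r * t))).
    { unfold chi; rewrite CPS_exp_scaled, <- RtoC_mult, Cexp_RtoC, <- RtoC_mult.
      reflexivity. }
    assert (Hchi : (0 <= Q * exp (lam * r * t))%R)
      by (apply Rmult_le_pos; [exact HQ|apply Rlt_le, exp_pos]).
    rewrite Echi; split; [now apply nonneg_RtoC|].
    rewrite Cmod_RtoC_nonneg by exact Hchi.
    assert (Hmt : (Cmod t < rho)%R) by (rewrite Cmod_RtoC_nonneg; lra).
    rewrite (CPS_plus _ _ _ rho Hmt Gphi Gpsi'), (CPS_scal _ _ _ rho Hmt Gpsi).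
    replace (CPS psi t) with (P * Cexp (- (RtoC (xi * (1 - t)) * z))).
    2: { unfold psi; rewrite CPS_exp_scaled, <- Cmult_assoc, <- Cexp_plus.
         do 2 f_equal; unfold w; rewrite RtoC_mult, RtoC_minus; ring. }
    destruct (contraction_bounds x t Hx Ht) as [Hs _].
    set (s := contraction x t) in *.
    assert (Hv : (Cmod (knorm (c' - a) a c' (RtoC s * z) / K - 1) <= e1)%R).
    { replace (knorm (c' - a) a c' (RtoC s * z) / K - 1) with
        ((knorm (c' - a) a c' (RtoC s * z) - K) / K) by (field; auto).
      rewrite Cmod_div by exact HKnz.
      apply Rle_div_l; [exact HK|].
      apply H3; [apply cone_scal; [lra|exact Hz]|].
      rewrite Cmod_mult, Cmod_RtoC_nonneg by lra; fold r.
      pose proof (Hscale (1 - x)%R r3 ltac:(lra) ltac:(lra)); nra. }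
    pose proof (localisation_error a c' z x t kappa e1 Ha Hc' Hx Ht Hz0
      ltac:(lra) Hz ltac:(lra) Hv) as HE.
    cbv zeta in HE; fold xi in HE; fold lam in HE; fold A1 in HE; fold B in HE.
    fold r in HE; fold P in HE; fold phi in HE.
    replace (CPS phi t + - (1) * (P * Cexp (- (RtoC (xi * (1 - t)) * z)))) with
      (CPS phi t - P * Cexp (- (RtoC (xi * (1 - t)) * z))) by ring.
    eapply Rle_trans; [exact HE|].
    replace (Q * exp (lam * r * t))%R with
      (Cmod P * (e2 * exp (- (lam * r * (1 - t)))))%R.
    2: { unfold Q; replace (- (lam * r * (1 - t)))%R with
           (- (lam * r) + lam * r * t)%R by ring; rewrite exp_plus; ring. }
    apply Rmult_le_compat_l; [apply Cmod_ge_0|].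
    apply Rmult_le_compat_r; [apply Rlt_le, exp_pos|].
    assert (E1 : ((1 + A1) * e1 = e2 / 2)%R) by (unfold e1; field; lra).
    assert (E2 : (B / r <= e2 / 2)%R).
    { pose proof (Hscale e2 (2 * B)%R He2 ltac:(lra)).
      apply Rle_div_l; [exact Hr|]. lra. }
    lra. }
  pose proof (HD (fun m => phi m + - (1) * psi m) chi rho Hrho (geo_plus _ _ rho ltac:(lra) Gphi Gpsi') Gchi Hdom)
    as HF.
  rewrite (beta_functional_diff b c phi psi rho) in HF by assumption.
  assert (Epsi : beta_functional b c psi = G * knorm (c - b) b c w).
  { unfold psi; rewrite beta_functional_exp by exact Hc.
    unfold G, knorm; fold w.
    replace (b - c) with (- (c - b)) by ring; rewrite Cpower_opp.
    field; apply Cpower_neq_0. }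
  assert (Hchi : (Cmod (beta_functional (RtoC (Re b)) (RtoC (Re c)) chi) <=
    Cmod P * e2 * K0 * exp (- (nu * ln (lam * r))))%R).
  { unfold chi; rewrite beta_functional_exp by exact HcR.
    set (u := (lam * r)%R) in *.
    assert (Hu : (0 < u)%R) by now apply Rmult_lt_0_compat.
    destruct (H2 (RtoC u)) as [H2' _].
    - unfold cone; rewrite Cmod_RtoC_nonneg, re_RtoC by lra; nra.
    - rewrite Cmod_RtoC_nonneg by lra.
      apply Hscale; lra.
    - replace (RtoC Q * kummer (RtoC (Re b)) (RtoC (Re c)) u) with
        (RtoC (Cmod P * e2) * knorm (RtoC (Re c) - RtoC (Re b))
          (RtoC (Re b)) (RtoC (Re c)) u
          * Cpower u (- (RtoC (Re c) - RtoC (Re b)))).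
      2: { unfold knorm, Q; fold u; rewrite (RtoC_mult _ (exp (- u))), Cpower_opp.
           rewrite <- Cexp_RtoC, RtoC_opp; field; apply Cpower_neq_0. }
      rewrite !Cmod_mult, Cmod_Cpower_RtoC by exact Hu.
      replace (Re (- (RtoC (Re c) - RtoC (Re b)))) with (- nu)%R
        by (unfold nu, Re; simpl; ring).
      rewrite Ropp_mult_distr_l.
      apply Rmult_le_compat_r; [apply Rlt_le, exp_pos|].
      rewrite Cmod_RtoC_nonneg by (apply Rmult_le_pos; [apply Cmod_ge_0|lra]).
      apply Rmult_le_compat_l; [apply Rmult_le_pos; [apply Cmod_ge_0|lra]|].
      exact H2'. }
  assert (HG : (Cmod P * exp (- (nu * ln (lam * r))) <= A3 * Cmod G)%R).
  { unfold G; fold w; rewrite Cmod_mult.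
    replace (A3 * (Cmod P * Cmod (Cpower w (b - c))))%R with
      (Cmod P * (A3 * Cmod (Cpower w (b - c))))%R by ring.
    apply Rmult_le_compat_l; [apply Cmod_ge_0|].
    replace (b - c) with (- (c - b)) by ring.
    rewrite Cpower_opp, Cmod_inv by apply Cpower_neq_0.
    pose proof (Cmod_Cpower_le w (c - b) Hw0) as HC.
    fold nu in HC; rewrite Hw in HC.
    pose proof (proj1 (Cmod_gt_0 _) (Cpower_neq_0 w (c - b))) as HC0.
    apply Rle_trans with
      (A3 * / exp (nu * ln (xi * r) + Rabs (Im (c - b)) * PI))%R.
    - unfold A3; rewrite <- exp_Ropp, <- exp_plus.
      apply Req_le; f_equal; rewrite !ln_mult by lra; ring.
    - apply Rmult_le_compat_l; [lra|].
      apply Rinv_le_contravar; assumption. }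
  assert (Hw1 : cone kappa w) by (apply cone_scal; [lra|exact Hz]).
  assert (Hw2 : (r1 <= Cmod w)%R) by (rewrite Hw; apply Hscale; lra).
  pose proof (H1 w Hw1 Hw2) as H4.
  pose proof (Cmod_ge_0 G) as HG0.
  replace (beta_functional b c phi - CGamma c / CGamma b * G) with
    (G * (knorm (c - b) b c w - CGamma c / CGamma b) +
     (beta_functional b c phi - beta_functional b c psi))
    by (rewrite Epsi; ring).
  eapply Rle_trans; [apply Cmod_triangle|]; rewrite Cmod_mult.
  assert (T1 : (Cmod G * Cmod (knorm (c - b) b c w - CGamma c / CGamma b) <=
    Cmod G * (eps / 2))%R) by (apply Rmult_le_compat_l; lra).
  assert (T2 : (Cmod (beta_functional b c phi - beta_functional b c psi) <=
    e2 * M * Cmod G)%R).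
  { eapply Rle_trans; [exact HF|].
    apply Rle_trans with
      (A * (Cmod P * e2 * K0 * exp (- (nu * ln (lam * r)))))%R.
    - apply Rmult_le_compat_l; [exact HA|exact Hchi].
    - replace (A * (Cmod P * e2 * K0 * exp (- (nu * ln (lam * r)))))%R with
        (A * K0 * e2 * (Cmod P * exp (- (nu * ln (lam * r)))))%R by ring.
      apply Rle_trans with (A * K0 * e2 * (A3 * Cmod G))%R.
      + apply Rmult_le_compat_l; [|exact HG].
        apply Rmult_le_pos; [now apply Rmult_le_pos|lra].
      + unfold M; assert (0 <= e2 * Cmod G)%R by (apply Rmult_le_pos; lra).
        lra. }
  replace (e2 * M)%R with (eps / 2)%R in T2 by (unfold e2; field; lra).
  lra.
Qed.

(** * From the cone to the sector, and the final equivalence *)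

(** [Re y = |y| cos (Carg y)], and the cosine decreases on [[0, PI]] with
    [cos (PI / 2 - delta) = sin delta]. *)
Lemma sector_cone (delta : R) (y : C) : (0 < delta < PI / 2)%R -> y <> 0 ->
  sector delta y -> cone (sin delta) y.
Proof.
  intros Hd Hy Hs; unfold sector in Hs; unfold cone.
  pose proof (Carg_polar y Hy) as E.
  assert (HR : Re y = (Cmod y * cos (Carg y))%R)
    by (rewrite E at 1; reflexivity).
  rewrite HR, (Rmult_comm (sin delta)).
  apply Rmult_le_compat_l; [apply Cmod_ge_0|].
  rewrite <- cos_shift.
  assert (Ec : cos (Carg y) = cos (Rabs (Carg y))).
  { unfold Rabs; destruct (Rcase_abs (Carg y)); [now rewrite cos_neg|reflexivity]. }
  rewrite Ec; pose proof (Rabs_pos (Carg y)); pose proof PI_RGT_0.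
  apply cos_decr_1; lra.
Qed.

(** All bases except [z] are positive reals, so the principal powers can be split. The exponents of
    [1 - x] agree: [c' + 2 (c - a - b) + (a + b - c - c') = c - a - b = - a - (b - c)]. *)
Lemma humbert_equivalent_factor (a b c c' z : C) (x : R) :
  (0 < x < 1)%R -> z <> 0 ->
  CGamma a <> 0 -> CGamma b <> 0 ->
  CGamma c * CGamma c' / (CGamma a * CGamma b)
    * Cpower x (b - c)
    * Cpower (1 - x) (c' + 2 * (c - a - b))
    * Cpower (RtoC (1 - x) * z) (a + b - c - c')
    * Cexp z =
  CGamma c / CGamma b * (humbert_prefactor a c' x z
      * Cpower (RtoC (x / (1 - x)) * z) (b - c)).
Proof.
  intros Hx Hz Ga Gb; unfold humbert_prefactor.
  rewrite !(Cpower_scal _ z) by (try exact Hz; try apply Rdiv_lt_0_compat; lra).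
  rewrite <- RtoC_minus.
  transitivity (CGamma c * CGamma c' / (CGamma a * CGamma b) * Cexp z *
    (Cpower x (b - c) * Cpower (RtoC (1 - x)) (c' + 2 * (c - a - b)) *
     Cpower (RtoC (1 - x)) (a + b - c - c') * Cpower z (a + b - c - c')));
    [ring|].
  transitivity (CGamma c * CGamma c' / (CGamma a * CGamma b) * Cexp z *
    (Cpower (RtoC (1 - x)) (- a) * Cpower (RtoC (x / (1 - x))) (b - c) *
     (Cpower z (- (c' - a)) * Cpower z (b - c)))); [|field; auto].
  f_equal.
  rewrite <- Cpower_plus.
  replace (- (c' - a) + (b - c)) with (a + b - c - c') by ring.
  f_equal.
  rewrite !Cpower_RtoC, ln_div, RtoC_minus, <- !Cexp_plus
    by (try apply Rdiv_lt_0_compat; lra).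
  f_equal; ring.
Qed.

(** Balls in [C] are products of intervals, and the modulus bounds both components. *)
Lemma asymp_equiv_intro (F : (C -> Prop) -> Prop) (f g : C -> C) : Filter F ->
  (forall eps, (0 < eps)%R -> F (fun y => (Cmod (f y / g y - 1) < eps)%R)) ->
  asymp_equiv F f g.
Proof.
  intros FF H P [eps HP].
  change (F (fun y => P (f y / g y))).
  generalize (H eps (cond_pos eps)); apply filter_imp.
  intros y Hy; apply HP; split.
  - eapply Rle_lt_trans; [apply (re_le_Cmod (f y / g y - 1))|exact Hy].
  - eapply Rle_lt_trans; [apply (im_le_Cmod (f y / g y - 1))|exact Hy].
Qed.

Theorem corollary3p5 (a b c c' : C) (delta x : R) :
  (Re b < Re c)%R -> (0 < Re b)%R ->
  ~ nonpos_integer a -> ~ nonpos_integer c' ->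
  (0 < delta < PI / 2)%R ->
  (0 < x < 1)%R ->
  asymp_equiv (within (sector delta) C_infty)
    (fun y => Psi1 a b c c' x y)
    (fun y =>
       CGamma c * CGamma c' / (CGamma a * CGamma b)
       * Cpower x (b - c)
       * Cpower (1 - x) (c' + 2 * (c - a - b))
       * Cpower y (a + b - c - c')
       * Cexp (y / (1 - x))).
Proof.
  intros Hbc Hb Ha Hc' Hd Hx.
  apply asymp_equiv_intro; [apply within_filter, C_infty_filter|].
  intros eps He.
  assert (Hc : ~ nonpos_integer c) by (apply Re_pos_not_nonpos_integer; lra).
  assert (Hb' : ~ nonpos_integer b) by (apply Re_pos_not_nonpos_integer; lra).
  destruct (CGamma_spec a Ha) as [Ga _]; destruct (CGamma_spec b Hb') as [Gb _].
  destruct (CGamma_spec c Hc) as [Gc _]; destruct (CGamma_spec c' Hc') as [Gc' _].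
  set (K := CGamma c / CGamma b).
  assert (HK : K <> 0).
  { unfold K; intros E; apply Gc.
    replace (CGamma c) with (CGamma c / CGamma b * CGamma b) by (field; auto).
    rewrite E; ring. }
  pose proof (proj1 (Cmod_gt_0 _) HK) as HKm.
  assert (Hk : (0 < sin delta <= 1)%R).
  { pose proof PI_RGT_0; split; [apply sin_gt_0; lra|apply SIN_bound]. }
  (* The factor [|K|] converts an error relative to [G] into one relative to [K G]; halving [eps]
     makes the final inequality strict. *)
  destruct (beta_humbert_asymptotics a b c c' x (sin delta) Hb Hbc Ha Hc' Hx Hk
    (eps / 2 * Cmod K)%R ltac:(apply Rmult_lt_0_compat; lra)) as [r0 [Hr0 H]].
  exists r0; intros y Hy Hs.
  assert (Hym : (0 < Cmod y)%R) by lra.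
  assert (Hy0 : y <> 0) by now apply Cmod_gt_0.
  assert (Hx1 : RtoC (1 - x) <> 0) by (apply RtoC_neq_0; lra).
  set (z := y / (1 - x)).
  assert (Ez : z = RtoC (/ (1 - x)) * y).
  { unfold z; rewrite <- RtoC_minus, RtoC_inv by lra; unfold Cdiv; ring. }
  assert (Ey : y = RtoC (1 - x) * z).
  { unfold z; rewrite <- RtoC_minus; field; exact Hx1. }
  (* Hence [|z| >= |y|], and the threshold for [z] can be imposed on [y]. *)
  assert (Hi : (1 <= / (1 - x))%R)
    by (rewrite <- Rinv_1; apply Rinv_le_contravar; lra).
  assert (Hz : cone (sin delta) z).
  { rewrite Ez; apply cone_scal; [lra|now apply sector_cone]. }
  assert (Hzm : (r0 <= Cmod z)%R).
  { rewrite Ez, Cmod_mult, Cmod_RtoC_nonneg by lra; nra. }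
  assert (Hz0 : z <> 0) by (apply Cmod_gt_0; lra).
  specialize (H z Hz Hzm); cbv zeta in H.
  rewrite Psi1_beta_functional by assumption.
  replace (Cpower y (a + b - c - c')) with
    (Cpower (RtoC (1 - x) * z) (a + b - c - c')) by (rewrite <- Ey; reflexivity).
  rewrite humbert_equivalent_factor by assumption.
  rewrite <- Ey in H; fold K in H; fold K.
  set (G := humbert_prefactor a c' x z * Cpower (RtoC (x / (1 - x)) * z) (b - c))
    in *.
  assert (HG : G <> 0).
  { unfold G, humbert_prefactor; repeat apply Cmult_neq_0;
      auto using Cpower_neq_0, Cexp_neq_0.
    intros E; apply Gc'.
    replace (CGamma c') with (CGamma c' * / CGamma a * CGamma a) by (field; auto).
    unfold Cdiv in E; rewrite E; ring. }
  pose proof (proj1 (Cmod_gt_0 _) HG) as HGm.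
  replace (beta_functional b c (humbert_coef a c' x y) / (K * G) - 1) with
    ((beta_functional b c (humbert_coef a c' x y) - K * G) / (K * G))
    by (field; auto).
  rewrite Cmod_div, Cmod_mult by now apply Cmult_neq_0.
  assert (HKG : (0 < Cmod K * Cmod G)%R) by now apply Rmult_lt_0_compat.
  apply Rle_lt_trans with (eps / 2)%R; [|lra].
  apply Rle_div_l; [exact HKG|].
  lra.
Qed.
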